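(* Let $(\beta_{\rm sd},\beta_{\rm rd},\beta_{\rm sr})\in\mathbb{R}_+^3$ and, for $\mathsf{SNR}>0$, let $S=\mathsf{SNR}^{\beta_{\rm sd}}$, $I=\mathsf{SNR}^{\beta_{\rm rd}}$, $C=\mathsf{SNR}^{\beta_{\rm sr}}$. Let $C^{\rm(HD\text{-}RC)}(\mathsf{SNR})$ be the capacity of the Gaussian half-duplex relay channel with these gains. Then the generalized degrees of freedom $$\mathsf{d}^{\rm(HD\text{-}RC)}:=\lim_{\mathsf{SNR}\to+\infty}\frac{C^{\rm(HD\text{-}RC)}(\mathsf{SNR})}{\log(1+\mathsf{SNR})}$$ exists and equals $$\mathsf{d}^{\rm(HD\text{-}RC)}=\begin{cases}\beta_{\rm sd}+\dfrac{(\beta_{\rm rd}-\beta_{\rm sd})(\beta_{\rm sr}-\beta_{\rm sd})}{(\beta_{\rm rd}-\beta_{\rm sd})+(\beta_{\rm sr}-\beta_{\rm sd})} & \text{if } \beta_{\rm sr}>\beta_{\rm sd} \text{ and } \beta_{\rm rd}>\beta_{\rm sd},\\[2mm] \beta_{\rm sd} & \text{otherwise.}\end{cases}$$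
   Context: Gaussian half-duplex relay channel (G-HD-RC): a source with message $W\in[1:2^{NR}]$ sends $X_{s,i}(W)\in\mathbb{C}$ at times $i\in[1:N]$; the relay at time $i$ chooses a channel input pair $(X_{r,i},S_{r,i})$, $X_{r,i}\in\mathbb{C}$, $S_{r,i}\in\{0,1\}$, as a (possibly randomized) function of its past outputs $Y_r^{i-1}$; $S_r=0$ means the relay listens and $S_r=1$ means it transmits (so the state may itself carry information). The memoryless outputs are $Y_r=\sqrt{C}\,X_s(1-S_r)+Z_r$ and $Y_d=\sqrt{S}\,X_s+e^{j\theta}\sqrt{I}\,X_rS_r+Z_d$, with constants $C,S,I\ge 0$, $\theta\in\mathbb{R}$, and $Z_r,Z_d$ independent circularly-symmetric complex Gaussian with unit variance, i.i.d. over time. Inputs satisfy average power constraints $\mathbb{E}|X_s|^2\le 1$, $\mathbb{E}|X_r|^2\le1$. The destination decodes $W$ from $Y_d^N$; a rate is achievable if the error probability can be made arbitrarily small, and the capacity $C^{\rm(HD\text{-}RC)}$ is the supremum of achievable rates. Logarithms are base 2 (rates in bits per channel use). *)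

(* Defs.v *)
From HB Require Import structures.
From mathcomp Require Import all_boot all_order all_algebra.
From mathcomp Require Import all_classical all_reals all_analysis.
Set Implicit Arguments. Unset Strict Implicit. Unset Printing Implicit Defensive.
Import Order.TTheory GRing.Theory Num.Theory.
Import numFieldNormedType.Exports.
Local Open Scope classical_set_scope.
Local Open Scope ring_scope.

Section HDRC.
Variable R : realType.
Notation cpx := (R * R)%type.

Definition cadd (x y : cpx) : cpx := (x.1 + y.1, x.2 + y.2).
Definition cmul (x y : cpx) : cpx := (x.1 * y.1 - x.2 * y.2, x.1 * y.2 + x.2 * y.1).
Definition cscale (a : R) (x : cpx) : cpx := (a * x.1, a * x.2).
Definition cnorm2 (x : cpx) : R := x.1 ^+ 2 + x.2 ^+ 2.
Definition cexpj (t : R) : cpx := (cos t, sin t).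

(* law of the real (and of the imaginary) part of a circularly-symmetric
   complex Gaussian of unit variance: N(0, 1/2) *)
Definition gauss_half := @normal_prob R 0 (Num.sqrt (2^-1)).

(* Expectation over N i.i.d. pairs (Z_r, Z_d) of unit-variance circularly
   symmetric complex Gaussians (4N i.i.d. N(0,1/2) real coordinates),
   as an iterated integral. *)
Fixpoint EZ (n : nat) (F : seq (cpx * cpx) -> \bar R) : \bar R :=
  match n with
  | 0 => F [::]
  | n'.+1 =>
    (\int[gauss_half]_a \int[gauss_half]_b \int[gauss_half]_c \int[gauss_half]_d
       EZ n' (fun zs => F (((a, b), (c, d)) :: zs)))%E
  end.

(* A code for block length N: [msgs] messages (indexed 0..msgs-1),
   source encoder enc w i = X_{s,i}(w), relay maps (randomized through a
   private uniform random variable U on [0,1]) rly_x i u y^{i} = X_{r,i},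
   rly_s i u y^{i} = S_{r,i}  (true = relay transmits), where y^{i} is the
   list of the relay's past outputs Y_{r,0..i-1}; decoder dec. *)
Record hd_code := HDCode {
  msgs : nat;
  enc : nat -> nat -> cpx;
  rly_x : nat -> R -> seq cpx -> cpx;
  rly_s : nat -> R -> seq cpx -> bool;
  dec : seq cpx -> nat }.

Record hd_chan := HDChan { gC : R; gS : R; gI : R; theta : R }.

(* Run of the channel for message w, relay randomness u, starting time i,
   past relay outputs yr and remaining noise zs = (Z_r, Z_d) per time.
   Returns the list of (X_{r,i}, Y_{d,i}). *)
Fixpoint trace (ch : hd_chan) (c : hd_code) (w : nat) (u : R) (i : nat)
  (yr : seq cpx) (zs : seq (cpx * cpx)) : seq (cpx * cpx) :=
  match zs with
  | [::] => [::]
  | z :: zs' =>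
    let xs := enc c w i in
    let xr := rly_x c i u yr in
    let s : R := (rly_s c i u yr)%:R in
    let yri := cadd (cscale (Num.sqrt (gC ch) * (1 - s)) xs) z.1 in
    let ydi := cadd (cadd (cscale (Num.sqrt (gS ch)) xs)
                          (cscale (Num.sqrt (gI ch) * s) (cmul (cexpj (theta ch)) xr)))
                    z.2 in
    (xr, ydi) :: trace ch c w u i.+1 (rcons yr yri) zs'
  end.

Definition dest_out ch c w u zs := map snd (trace ch c w u 0 [::] zs).
Definition relay_in ch c w u zs := map fst (trace ch c w u 0 [::] zs).

Definition EUZ (N : nat) (F : R -> seq (cpx * cpx) -> \bar R) : \bar R :=
  (\int[lebesgue_measure]_(u in `[0%R, 1%R]) EZ N (F u))%E.

Definition err_prob (ch : hd_chan) (N : nat) (c : hd_code) : \bar R :=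
  ((msgs c)%:R^-1)%:E *
  (\sum_(w < msgs c) EUZ N (fun u zs => (dec c (dest_out ch c w u zs) != w)%:R%:E))%E.

Definition valid_code (ch : hd_chan) (N : nat) (c : hd_code) : Prop :=
  [/\ (0 < msgs c)%N,
      (forall i : nat, (i < N)%N ->
         measurable_fun setT (fun p : R * i.-tuple cpx => rly_x c i p.1 (tval p.2))
         /\ measurable [set p : R * i.-tuple cpx | rly_s c i p.1 (tval p.2)]),
      (forall k : nat, measurable [set y : N.-tuple cpx | dec c (tval y) = k]),
      ((msgs c * N)%:R^-1 * \sum_(w < msgs c) \sum_(i < N) cnorm2 (enc c w i) <= 1) &
      (((msgs c * N)%:R^-1)%:E *
        (\sum_(w < msgs c)
          EUZ N (fun u zs => (\sum_(x <- relay_in ch c w u zs) cnorm2 x)%:E))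
        <= 1)%E].

Definition achievable (ch : hd_chan) (r : R) : Prop :=
  forall eps : R, 0 < eps -> forall N0 : nat, exists N : nat, exists c : hd_code,
    [/\ (N0 <= N)%N, (0 < N)%N, valid_code ch N c,
        (2 `^ (N%:R * r) <= (msgs c)%:R) & (err_prob ch N c <= eps%:E)%E].

Definition hd_capacity (ch : hd_chan) : R := sup [set r | achievable ch r].

Definition log2 (x : R) : R := ln x / ln 2.

Definition gdof_formula (bsd brd bsr : R) : R :=
  if (bsd < bsr) && (bsd < brd) then
    bsd + (brd - bsd) * (bsr - bsd) / ((brd - bsd) + (bsr - bsd))
  else bsd.

End HDRC.

(* Main.v *)
(* Converse.  The likelihood ratio of the outputs [y = h x + z] of a slot with
   respect to the centred Gaussian law of covariance [I + h h^T] is at most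
   [det (I + h h^T) * exp |x|^2], so over a block one can pass to reference outputs
   that do not depend on the message, at a cost that is exponential in the power
   used and in the high-SNR exponents of the slots.  For the cut (source -> relay
   and destination) the reference keeps the relay active; for the cut (source and
   relay -> destination) it is, in each slot, the equal mixture of the laws for a
   listening and for a transmitting relay, which is independent of the relay's
   states even though these may carry information.  Under a reference law at most
   one message is decoded, and if the relay transmits a fraction [g] of the time,
   one of the two cuts has exponent
   [min (g * max brd bsd + (1 - g) * bsd, (1 - g) * max bsr bsd + g * bsd)]
   or less, which is at most [gdof_formula].

   Achievability.  The source superposes a coarse QAM stream of exponent [bsd],
   meant for the destination, and, while the relay listens, a fine stream of
   exponent [bsr - bsd], meant for the relay, which then forwards it on top of the
   coarse stream with exponent [brd - bsd].  The streams are protected by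
   Gilbert-Varshamov codes over alphabets whose size grows with the SNR, and a
   symbol counts as erroneous when a noise coordinate exceeds a fixed threshold
   [tau]; the Chernoff bound with [exp (|z|^2 / 2)] controls the number of those. *)

From Pilot Require Import Defs.
From HB Require Import structures.
From mathcomp Require Import all_boot all_order all_algebra.
From mathcomp Require Import all_classical all_reals all_analysis measurable_realfun.
From mathcomp Require Import ring lra.
Set Implicit Arguments. Unset Strict Implicit. Unset Printing Implicit Defensive.
Import Order.TTheory GRing.Theory Num.Theory.
Import numFieldNormedType.Exports.
Local Open Scope classical_set_scope.
Local Open Scope ring_scope.
(* MathComp-Analysis also has a [cadd] and a [cscale], on charges. *)
Local Notation cadd := Pilot.Defs.cadd.
Local Notation cscale := Pilot.Defs.cscale.

(** * Gaussian integrals *)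

(** The converse uses likelihood ratios rather than mutual informations because the noise
    expectation is an iterated integral and the relay is an arbitrary randomized causal map: the
    analytic input is then a pointwise inequality between quadratic forms, applied one slot at a
    time. The obstacle is that the relay's power and the time it transmits are random, so neither
    the cost nor the better cut is fixed by the code. The cost is therefore kept inside the
    expectation, as a factor [exp (- cost)], and the cut is selected for each realization
    separately, by bounding the sum of the two weights. In the achievability part every loss is
    either a constant per slot, such as the threshold [tau] or the crude count [2 ^ n] of error
    patterns, or a multiple of [delta * ln snr], with [delta] the tolerated fraction of bad symbols.
    Constants vanish after division by [log2 (1 + snr)] and [delta] is arbitrary, so
    minimum-distance codes are good enough. The quotient in the formula is the rate at which what
    the relay can receive, proportional to its listening time, balances what it can forward in the
    remaining time. *)

Section density.
Local Open Scope ereal_scope.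
Context d (T : measurableType d) (R : realType).
Variables (mu nu : {measure set T -> \bar R}) (p : T -> R).
Hypothesis (mp : measurable_fun setT p) (p0 : forall x, (0 <= p x)%R).
Hypothesis nuE : forall A, measurable A -> nu A = \int[mu]_(x in A) (p x)%:E.
Import HBNNSimple.

Let integral_density_indic E : measurable E ->
  \int[nu]_x (\1_E x)%:E = \int[mu]_x ((\1_E x)%:E * (p x)%:E).
Proof.
move=> mE; rewrite integral_indic// setIT nuE// integral_mkcond/=.
apply: eq_integral => x _; rewrite patchE indicE.
by case: ifPn => xE; rewrite ?mul1e ?mul0e.
Qed.

Let integral_density_nnsfun (f : {nnsfun T >-> R}) :
  \int[nu]_x (f x)%:E = \int[mu]_x ((f x)%:E * (p x)%:E).
Proof.
under [LHS]eq_integral do rewrite fimfunE -fsumEFin//.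
rewrite [LHS]ge0_integral_fsum//; last 2 first.
  - by move=> r; exact/measurable_EFinP/measurableT_comp.
  - by move=> n x _; rewrite EFinM nnfun_muleindic_ge0.
under [RHS]eq_integral.
  move=> x xD; rewrite muleC fimfunE -fsumEFin// ge0_mule_fsumr; last first.
    by move=> r; rewrite EFinM nnfun_muleindic_ge0.
  over.
rewrite [RHS]ge0_integral_fsum//; last 2 first.
  - move=> r; apply: emeasurable_funM; first exact/measurable_EFinP.
    by apply/measurable_EFinP; apply/measurableT_comp => //.
  - move=> n x _; rewrite EFinM mule_ge0//; last by rewrite nnfun_muleindic_ge0.
    by rewrite lee_fin.
apply: eq_fsbigr => r /set_mem [z _ <-].
under [RHS]eq_integral do rewrite EFinM muleCA.
rewrite ge0_integralZl//; last 3 first.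
- apply: emeasurable_funM; exact/measurable_EFinP.
- by move=> x _; rewrite mule_ge0// lee_fin.
- by rewrite lee_fin.
under [LHS]eq_integral do rewrite EFinM.
rewrite ge0_integralZl//; last 2 first.
- exact/measurable_EFinP.
- by rewrite lee_fin.
congr (_ * _); rewrite integral_density_indic//.
by apply: eq_integral => x _; rewrite muleC.
Qed.

Lemma ge0_integral_density (f : T -> \bar R) :
  measurable_fun setT f -> (forall x, 0 <= f x) ->
  \int[nu]_x f x = \int[mu]_x (f x * (p x)%:E).
Proof.
move=> mf f0.
pose f_ := nnsfun_approx measurableT mf.
transitivity (limn (fun n => \int[nu]_x (f_ n x)%:E)).
  rewrite -monotone_convergence//=.
  - apply: eq_integral => ? /[!inE] xD; apply/esym/cvg_lim => //=.
    exact: cvg_nnsfun_approx.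
  - by move=> n; exact/measurable_EFinP/measurable_funTS.
  - by move=> n ? _; rewrite lee_fin.
  - by move=> ? _ ? ? mn; rewrite lee_fin; exact/lefP/nd_nnsfun_approx.
transitivity (limn (fun n => \int[mu]_x ((f_ n x)%:E * (p x)%:E))).
  by congr (limn _); apply/funext => n; exact: integral_density_nnsfun.
rewrite -monotone_convergence//=.
- apply: eq_integral => x /[!inE] xD; apply/cvg_lim => //=.
  by apply: cvgeZr => //; exact: cvg_nnsfun_approx.
- by move=> n; apply: emeasurable_funM; exact/measurable_EFinP/measurable_funTS.
- by move=> n x _; rewrite mule_ge0// lee_fin.
- move=> x _ m n mn; apply: lee_wpmul2r; first by rewrite lee_fin.
  by rewrite lee_fin; exact/lefP/nd_nnsfun_approx.
Qed.
End density.

Section affine.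
Local Open Scope ereal_scope.
Context (R : realType).
Local Notation leb := (@lebesgue_measure R).

Definition affine (l b : R) : measurableTypeR R -> measurableTypeR R :=
  fun x => (l * x + b)%R.

Lemma measurable_affine (l b : R) : measurable_fun setT (affine l b).
Proof. by apply: measurable_funD => //; apply: measurable_funM. Qed.

Local Notation affine_image l b :=
  (measure_function_pushforward__canonical__measure_function_Measure
     leb (measurable_affine l b)).

(** Both measures agree on half-open intervals, and this characterizes Lebesgue measure. *)
Lemma lebesgue_measure_affine (l b : R) (l0 : (0 < l)%R) A : measurable A ->
  leb A = mscale (NngNum (ltW l0)) (affine_image l b) A.
Proof.
move: A; apply: lebesgue_measure_unique => //= _ [[x y]] _ <-.
rewrite /mscale /= /pushforward.
rewrite (_ : _ @^-1` _ = `](x - b) / l, (y - b) / l]%classic)%R.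
  rewrite !lebesgue_measure_itv/= !lte_fin ltr_pM2r ?invr_gt0//.
  rewrite ltrD2r; case: ifP => _; last by rewrite mule0.
  rewrite -!EFinB -EFinM; congr (_%:E).
  by field; rewrite gt_eqF.
rewrite /affine; apply/seteqP; split => z /=;
  by rewrite !in_itv/= ltr_pdivrMr// ler_pdivlMr// ltrBlDr lerBrDr (mulrC z).
Qed.

Lemma ge0_integral_affine (l b : R) (f : R -> \bar R) : (0 < l)%R ->
  measurable_fun [set: measurableTypeR R] f -> (forall x, 0 <= f x) ->
  \int[leb]_x f x = l%:E * \int[leb]_x f (l * x + b)%R.
Proof.
move=> l0 mf f0.
rewrite (eq_measure_integral
  (mscale (NngNum (ltW l0)) (affine_image l b))); last first.
  by move=> A mA _; exact: lebesgue_measure_affine.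
rewrite ge0_integral_mscale//; congr (_ * _).
by rewrite ge0_integral_pushforward//; exact: measurable_affine.
Qed.
End affine.

Section gaussian.
Local Open Scope ereal_scope.
Context (R : realType).
Local Notation leb := (@lebesgue_measure R).
Local Notation gam := (@gauss_half R).
Local Notation sigma := (Num.sqrt (2^-1) : R)%R.

Lemma normal_pdf_half (x : R) : normal_pdf 0 sigma x =
  (normal_peak sigma * expR (- x ^+ 2))%R.
Proof.
have h2 : (0 < 2^-1 :> R)%R by rewrite invr_gt0.
rewrite normal_pdfE ?gt_eqF ?sqrtr_gt0// /normal_fun subr0 sqr_sqrtr ?ltW//.
by rewrite (_ : 2^-1 *+ 2 = 1 :> R)%R ?divr1//; field.
Qed.

Lemma ge0_integral_gauss_half (f : R -> \bar R) :
  measurable_fun [set: measurableTypeR R] f -> (forall x, 0 <= f x) ->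
  \int[gam]_x f x = \int[leb]_x (f x * (normal_pdf 0 sigma x)%:E).
Proof.
move=> mf f0; apply: ge0_integral_density => //.
- exact: measurable_normal_pdf.
- by move=> x; exact: normal_pdf_ge0.
Qed.

(** The weight is the Jacobian [l] times the ratio of the densities [exp (- y ^+ 2)] at
    [y = l * x + b] and at [x]. Both sides are integrals against the same Gaussian law, so
    substitutions can be iterated. *)
Lemma ge0_integral_gauss_half_affine (l b : R) (f : R -> \bar R) : (0 < l)%R ->
  measurable_fun [set: measurableTypeR R] f -> (forall x, 0 <= f x) ->
  \int[gam]_x f x =
  \int[gam]_x (f (l * x + b)%R * (l * expR (x ^+ 2 - (l * x + b) ^+ 2))%:E).
Proof.
move=> l0 mf f0.
have mpdf := @measurable_normal_pdf R 0%R sigma.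
have maff := @measurable_affine R l b.
have mfa : measurable_fun [set: measurableTypeR R] (fun x => f (l * x + b)%R).
  exact: (measurableT_comp mf maff).
have mexp : measurable_fun [set: measurableTypeR R]
    (fun x => (l * expR (x ^+ 2 - (l * x + b) ^+ 2))%R).
  apply: measurable_funM => //; apply: measurableT_comp => //.
  apply: measurable_funB; first exact: measurable_funX.
  exact: measurable_funX.
rewrite !ge0_integral_gauss_half//; last 2 first.
- by apply: emeasurable_funM => //; exact/measurable_EFinP.
- move=> x; rewrite mule_ge0// lee_fin mulr_ge0 ?expR_ge0//; exact: ltW.
rewrite (@ge0_integral_affine R l b)//; last 2 first.
- by apply: emeasurable_funM => //; exact/measurable_EFinP.
- by move=> x; rewrite mule_ge0// lee_fin normal_pdf_ge0.
rewrite -ge0_integralZl//; last 3 first.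
- apply: emeasurable_funM => //; apply/measurable_EFinP.
  exact: (measurableT_comp mpdf maff).
- by move=> x; rewrite mule_ge0// lee_fin normal_pdf_ge0.
- by rewrite lee_fin ltW.
apply: eq_integral => x _; rewrite muleCA -muleA; congr (_ * _).
rewrite -!EFinM; congr (_%:E); rewrite !normal_pdf_half.
rewrite /affine expRD !expRN; set p := normal_peak _.
have := gt_eqF (expR_gt0 (x ^+ 2)); move: (expR (x ^+ 2)) => e /negbT e0.
have := gt_eqF (expR_gt0 ((l * x + b) ^+ 2)).
move: (expR ((l * x + b) ^+ 2)) => e' /negbT e'0.
by field; rewrite e0.
Qed.

(** Rescaling by [sqrt 2] makes the weight cancel the integrand exactly, which leaves a constant. *)
Lemma integral_gauss_half_expR :
  \int[gam]_x (expR (x ^+ 2 / 2))%:E = (Num.sqrt 2)%:E.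
Proof.
have h2 : (0 < 2^-1 :> R)%R by rewrite invr_gt0.
have s2 : (0 < Num.sqrt (2 : R))%R by rewrite sqrtr_gt0.
have mf : measurable_fun [set: measurableTypeR R] (fun x : R => (expR (x ^+ 2 / 2))%:E).
  apply/measurable_EFinP/(measurableT_comp (@measurable_expR R)) => /=.
  by apply: measurable_funM => //; exact: measurable_funX.
rewrite (@ge0_integral_gauss_half_affine (Num.sqrt 2) 0)//.
transitivity (\int[gam]_x (cst (Num.sqrt 2)%:E x)).
  apply: eq_integral => x _; rewrite -EFinM; congr (_%:E) => /=.
  rewrite mulrCA -expRD addr0 exprMn sqr_sqrtr// mulrC -[RHS]mul1r; congr (_ * _)%R.
  by rewrite -[RHS]expR0; congr expR; field.
rewrite integral_cst// [X in _ * X](_ : _ = 1) ?mule1//.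
exact: (@probability_setT _ _ _ (normal_prob 0 sigma)).
Qed.

End gaussian.

(** * Expectation over the noise of one slot *)

Section four_fold_integral.
Local Open Scope ereal_scope.
Context (R : realType).
Local Notation cpx := (R * R)%type.
Local Notation gam := (@gauss_half R).

(** One layer of [EZ]. It stays an iterated integral, so each manipulation needs the measurability
    of every partial integral. *)
Definition I4 (f : cpx * cpx -> \bar R) : \bar R :=
  \int[gam]_a \int[gam]_b \int[gam]_c \int[gam]_d f ((a, b), (c, d)).

Lemma I4E (f : cpx * cpx -> \bar R) :
  I4 f = \int[gam]_a \int[gam]_b \int[gam]_c \int[gam]_d f ((a, b), (c, d)).
Proof. by []. Qed.

Lemma EZS n (F : seq (cpx * cpx) -> \bar R) :
  EZ n.+1 F = I4 (fun z => EZ n (fun zs => F (z :: zs))).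
Proof. by []. Qed.

Lemma gauss_half_setT : gam setT = 1.
Proof. exact: (@probability_setT _ _ _ (normal_prob 0%R (Num.sqrt 2^-1))). Qed.

Lemma measurable_integral_gauss_half d (P : measurableType d) (f : P * R -> \bar R) :
  measurable_fun setT f -> (forall x, 0 <= f x) ->
  measurable_fun setT (fun p => \int[gam]_a f (p, a)).
Proof.
move=> mf f0.
exact: (measurable_fun_fubini_tonelli_F (m2 := normal_prob 0%R (Num.sqrt 2^-1))).
Qed.

Section params.
Context d (P : measurableType d).
Implicit Type f g : P * (cpx * cpx) -> \bar R.

(** Left-nested products let Tonelli's theorem integrate out the last coordinate, four times in a
    row. *)
Lemma measurable_reassoc f : measurable_fun setT f ->
  measurable_fun setT (fun q : P * R * R * R * R =>
    f (q.1.1.1.1, ((q.1.1.1.2, q.1.1.2), (q.1.2, q.2)))).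
Proof.
move=> mf; apply: (measurableT_comp mf).
apply: measurable_fun_pair => /=.
  by do ?apply: (measurableT_comp measurable_fst).
apply: measurable_fun_pair => /=; apply: measurable_fun_pair => //=.
- by apply: (measurableT_comp measurable_snd); do ?apply: (measurableT_comp measurable_fst).
- by apply: (measurableT_comp measurable_snd); do ?apply: (measurableT_comp measurable_fst).
- by apply: (measurableT_comp measurable_snd); do ?apply: (measurableT_comp measurable_fst).
Qed.

Lemma measurable_I4_steps f : measurable_fun setT f -> (forall x, 0 <= f x) ->
  [/\ measurable_fun setT (fun q : P * R * R * R =>
        \int[gam]_d f (q.1.1.1, ((q.1.1.2, q.1.2), (q.2, d)))),
      measurable_fun setT (fun q : P * R * R =>
        \int[gam]_c \int[gam]_d f (q.1.1, ((q.1.2, q.2), (c, d)))),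
      measurable_fun setT (fun q : P * R =>
        \int[gam]_b \int[gam]_c \int[gam]_d f (q.1, ((q.2, b), (c, d)))) &
      measurable_fun setT (fun p => I4 (fun z => f (p, z)))].
Proof.
move=> mf f0.
have m1 := measurable_integral_gauss_half (measurable_reassoc mf) (fun _ => f0 _).
have m2 : measurable_fun setT (fun q : P * R * R =>
    \int[gam]_c \int[gam]_d f (q.1.1, ((q.1.2, q.2), (c, d)))).
  by apply: measurable_integral_gauss_half m1 _ => ?; apply: integral_ge0.
have m3 : measurable_fun setT (fun q : P * R =>
    \int[gam]_b \int[gam]_c \int[gam]_d f (q.1, ((q.2, b), (c, d)))).
  by apply: measurable_integral_gauss_half m2 _ => ?; do 2 apply: integral_ge0 => ? _.
have m4 : measurable_fun setT (fun p => I4 (fun z => f (p, z))).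
  by apply: measurable_integral_gauss_half m3 _ => ?; do 3 apply: integral_ge0 => ? _.
by split.
Qed.

End params.

Lemma I4_ge0 (f : cpx * cpx -> \bar R) : (forall z, 0 <= f z) -> 0 <= I4 f.
Proof. by move=> f0; do 4 apply: integral_ge0 => ? _. Qed.

Lemma integral_gauss_half_cst (k : \bar R) : \int[gam]_x k = k.
Proof. by rewrite integral_cst// [X in _ * X]gauss_half_setT mule1. Qed.

Lemma I4_cst (k : \bar R) : I4 (fun=> k) = k.
Proof. by rewrite /I4 !integral_gauss_half_cst. Qed.

Lemma le_gauss_half (f g : R -> \bar R) :
  measurable_fun setT f -> measurable_fun setT g ->
  (forall x, 0 <= f x) -> (forall x, f x <= g x) ->
  \int[gam]_x f x <= \int[gam]_x g x.
Proof. by move=> mf mg f0 fg; apply: ge0_le_integral. Qed.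

Lemma gauss_halfD (f g : R -> \bar R) :
  measurable_fun setT f -> measurable_fun setT g ->
  (forall x, 0 <= f x) -> (forall x, 0 <= g x) ->
  \int[gam]_x (f x + g x) = \int[gam]_x f x + \int[gam]_x g x.
Proof. by move=> mf mg f0 fg; apply: ge0_integralD. Qed.

Lemma gauss_halfZl (k : \bar R) (f : R -> \bar R) :
  measurable_fun setT f -> (forall x, 0 <= f x) -> 0 <= k ->
  \int[gam]_x (k * f x) = k * \int[gam]_x f x.
Proof. by move=> mf f0 k0; apply: ge0_integralZl. Qed.

Lemma gauss_halfZr (k : R) (f : R -> \bar R) :
  measurable_fun setT f -> (forall x, 0 <= f x) -> (0 <= k)%R ->
  \int[gam]_x (f x * k%:E) = (\int[gam]_x f x) * k%:E.
Proof. by move=> mf f0 k0; apply: ge0_integralZr. Qed.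

Section no_params.
Implicit Type f g : cpx * cpx -> \bar R.

Lemma measurable_I4_inner f : measurable_fun setT f -> (forall x, 0 <= f x) ->
  [/\ forall a b c, measurable_fun [set: R] (fun d => f ((a, b), (c, d))),
      forall a b, measurable_fun [set: R] (fun c => \int[gam]_d f ((a, b), (c, d))),
      forall a, measurable_fun [set: R] (fun b => \int[gam]_c \int[gam]_d f ((a, b), (c, d))) &
      measurable_fun [set: R] (fun a => \int[gam]_b \int[gam]_c \int[gam]_d f ((a, b), (c, d)))].
Proof.
move=> mf f0.
(* The parameter-free case is the case of a one-point parameter space. *)
have mf' : measurable_fun setT (fun p : unit * (cpx * cpx) => f p.2).
  exact: measurableT_comp.
have [m1 m2 m3 _] := measurable_I4_steps mf' (fun _ => f0 _).
have m0 := measurable_reassoc mf'.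
split.
- by move=> a b c; apply: (measurableT_comp m0 (measurable_pair1 (tt, a, b, c))).
- by move=> a b; apply: (measurableT_comp m1 (measurable_pair1 (tt, a, b))).
- by move=> a; apply: (measurableT_comp m2 (measurable_pair1 (tt, a))).
- by apply: (measurableT_comp m3 (measurable_pair1 tt)).
Qed.

Lemma le_I4 f g : measurable_fun setT f -> measurable_fun setT g ->
  (forall z, 0 <= f z) -> (forall z, f z <= g z) -> I4 f <= I4 g.
Proof.
move=> mf mg f0 fg.
have g0 z : 0 <= g z by exact: le_trans (f0 z) (fg z).
have [f1 f2 f3 f4] := measurable_I4_inner mf f0.
have [g1 g2 g3 g4] := measurable_I4_inner mg g0.
apply: (le_gauss_half f4 g4) => [a|a]; first by do 3 apply: integral_ge0 => ? _.
apply: (le_gauss_half (f3 a) (g3 a)) => [b|b].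
  by do 2 apply: integral_ge0 => ? _.
apply: (le_gauss_half (f2 a b) (g2 a b)) => [c|c]; first by apply: integral_ge0 => ? _.
exact: (le_gauss_half (f1 a b c) (g1 a b c)).
Qed.

Lemma eq_I4 f g : f =1 g -> I4 f = I4 g.
Proof. by move=> /funext ->. Qed.

Lemma I4D f g : measurable_fun setT f -> measurable_fun setT g ->
  (forall z, 0 <= f z) -> (forall z, 0 <= g z) ->
  I4 (fun z => f z + g z) = I4 f + I4 g.
Proof.
move=> mf mg f0 g0.
have [f1 f2 f3 f4] := measurable_I4_inner mf f0.
have [g1 g2 g3 g4] := measurable_I4_inner mg g0.
rewrite /I4 -(gauss_halfD f4 g4); last 2 first.
- by move=> ?; do 3 apply: integral_ge0 => ? _.
- by move=> ?; do 3 apply: integral_ge0 => ? _.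
apply: eq_integral => a _; rewrite -(gauss_halfD (f3 a) (g3 a)); last 2 first.
- by move=> ?; do 2 apply: integral_ge0 => ? _.
- by move=> ?; do 2 apply: integral_ge0 => ? _.
apply: eq_integral => b _; rewrite -(gauss_halfD (f2 a b) (g2 a b)); last 2 first.
- by move=> ?; do 1 apply: integral_ge0 => ? _.
- by move=> ?; do 1 apply: integral_ge0 => ? _.
by apply: eq_integral => c _; rewrite -(gauss_halfD (f1 a b c) (g1 a b c)).
Qed.

Lemma I4Zl (k : \bar R) f : measurable_fun setT f ->
  (forall z, 0 <= f z) -> 0 <= k -> I4 (fun z => k * f z) = k * I4 f.
Proof.
move=> mf f0 k0.
have [f1 f2 f3 f4] := measurable_I4_inner mf f0.
rewrite /I4 -(gauss_halfZl f4)//; last first.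
  by move=> ?; do 3 apply: integral_ge0 => ? _.
apply: eq_integral => a _; rewrite -(gauss_halfZl (f3 a))//; last first.
  by move=> ?; do 2 apply: integral_ge0 => ? _.
apply: eq_integral => b _; rewrite -(gauss_halfZl (f2 a b))//; last first.
  by move=> ?; do 1 apply: integral_ge0 => ? _.
by apply: eq_integral => c _; rewrite -(gauss_halfZl (f1 a b c)).
Qed.

End no_params.
End four_fold_integral.

Ltac meas := cbv beta; lazymatch goal with
| |- measurable_fun _ (fun x => x) => exact: measurable_id
| |- measurable_fun _ (fun _ => ?c) => exact: measurable_cst
| |- measurable_fun _ (fun x => (@?f x + @?g x)%R) => apply: (@measurable_funD _ _ _ _ f g); meas
| |- measurable_fun _ (fun x => (@?f x * @?g x)%R) => apply: (@measurable_funM _ _ _ _ f g); meas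
| |- measurable_fun _ (fun x => (- @?f x)%R) => apply: (@measurable_funN _ _ _ _ f); meas
| |- measurable_fun _ (fun x => (@?f x ^+ _)%R) => apply: (@measurable_funX _ _ _ _ f); meas
| |- measurable_fun _ (fun x => (expR (@?f x))) =>
    apply: (measurableT_comp (@measurable_expR _) (g := f)); meas
| |- measurable_fun _ (fun x => (@?f x, @?g x)) => apply: measurable_fun_pair; meas
| |- measurable_fun _ (fun x => (@?f x).1) => apply: (measurableT_comp measurable_fst (g := f)); meas
| |- measurable_fun _ (fun x => (@?f x).2) => apply: (measurableT_comp measurable_snd (g := f)); meas
| |- _ => try done
end.

Section affine_substitution.
Local Open Scope ereal_scope.
Context (R : realType).
Local Notation cpx := (R * R)%type.
Local Notation gam := (@gauss_half R).

Definition jac (l b x : R) : R := (l * expR (x ^+ 2 - (l * x + b) ^+ 2))%R.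

Lemma jac_ge0 l b x : (0 < l)%R -> (0 <= jac l b x)%R.
Proof. by move=> l0; rewrite mulr_ge0 ?expR_ge0 ?ltW. Qed.

Variables (l m k b1 b2 b3 b4 : R).
Hypotheses (l0 : (0 < l)%R) (m0 : (0 < m)%R).

(** Triangular, so that it can be carried out one integral at a time. The coefficient [k] lets the
    relay's noise enter the destination's coordinates, which produces the correlated reference
    outputs of the broadcast cut. *)
Definition subst4 (z : cpx * cpx) : cpx * cpx :=
  ((l * z.1.1 + b1, l * z.1.2 + b2)%R,
   (m * z.2.1 + (k * z.1.1 + b3), m * z.2.2 + (k * z.1.2 + b4))%R).

Let w4 (z : cpx * cpx) := jac m (k * z.1.2 + b4) z.2.2.
Let w3 (z : cpx * cpx) := jac m (k * z.1.1 + b3) z.2.1.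
Let w2 (z : cpx * cpx) := jac l b2 z.1.2.
Let w1 (z : cpx * cpx) := jac l b1 z.1.1.

Lemma measurable_subst4 : measurable_fun setT subst4.
Proof. rewrite /subst4; meas. Qed.

Lemma I4_subst4 (H : cpx * cpx -> \bar R) :
  measurable_fun setT H -> (forall z, 0 <= H z) ->
  I4 H = I4 (fun z => H (subst4 z) * (w4 z * w3 z * w2 z * w1 z)%:E).
Proof.
move=> mH H0.
have mw4 : measurable_fun setT w4 by rewrite /w4 /jac; meas.
have mw3 : measurable_fun setT w3 by rewrite /w3 /jac; meas.
have mw2 : measurable_fun setT w2 by rewrite /w2 /jac; meas.
have mw1 : measurable_fun setT w1 by rewrite /w1 /jac; meas.
have w40 z : (0 <= w4 z)%R by exact: jac_ge0.
have w30 z : (0 <= w3 z)%R by exact: jac_ge0.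
have w20 z : (0 <= w2 z)%R by exact: jac_ge0.
have w10 z : (0 <= w1 z)%R by exact: jac_ge0.
have [h1 h2 h3 h4] := measurable_I4_inner mH H0.
pose H4 z := H (subst4 z) * (w4 z)%:E.
pose H3 z := H4 z * (w3 z)%:E.
pose H2 z := H3 z * (w2 z)%:E.
have mH4 : measurable_fun setT H4.
  apply: emeasurable_funM; last exact/measurable_EFinP.
  exact: (measurableT_comp mH measurable_subst4).
have H40 z : 0 <= H4 z by rewrite mule_ge0// lee_fin.
have mH3 : measurable_fun setT H3.
  by apply: emeasurable_funM => //; exact/measurable_EFinP.
have H30 z : 0 <= H3 z by rewrite mule_ge0// lee_fin.
have mH2 : measurable_fun setT H2.
  by apply: emeasurable_funM => //; exact/measurable_EFinP.
have H20 z : 0 <= H2 z by rewrite mule_ge0// lee_fin.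
have [g11 g12 g13 g14] := measurable_I4_inner mH4 H40.
have [g21 g22 g23 g24] := measurable_I4_inner mH3 H30.
have [g31 g32 g33 g34] := measurable_I4_inner mH2 H20.
transitivity (I4 (fun z => H2 z * (w1 z)%:E)); last first.
  by apply: eq_I4 => z; rewrite /H2 /H3 /H4 !EFinM !muleA.
have J1 a : (0 <= jac l b1 a)%R by exact: jac_ge0.
have J2 b : (0 <= jac l b2 b)%R by exact: jac_ge0.
have J3 a c : (0 <= jac m (k * a + b3) c)%R by exact: jac_ge0.
(* The substitution proceeds from the outermost integral inwards: the shifts [k * a + b3] and
   [k * b + b4] of the inner variables involve the outer ones after their own substitution. *)
apply: etrans (ge0_integral_gauss_half_affine b1 l0 h4 _) _.
  by move=> ?; do 3 apply: integral_ge0 => ? _.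
apply: eq_integral => a _; rewrite -/(jac l b1 a).
transitivity ((\int[gam]_b \int[gam]_c \int[gam]_d H2 (a, b, (c, d))) *
    (jac l b1 a)%:E); last first.
  apply: esym; apply: etrans (gauss_halfZr (g33 a) _ (J1 a)); last first.
    by move=> ?; do 2 apply: integral_ge0 => ? _.
  apply: eq_integral => b _; apply: etrans (gauss_halfZr (g32 a b) _ (J1 a)); last first.
    by move=> ?; do 1 apply: integral_ge0 => ? _.
  apply: eq_integral => c _; exact: (gauss_halfZr (g31 a b c) _ (J1 a)).
refine (congr1 (fun t : \bar R => t * _) _).
apply: etrans (ge0_integral_gauss_half_affine b2 l0 (h3 _) _) _.
  by move=> ?; do 2 apply: integral_ge0 => ? _.
apply: eq_integral => b _; rewrite -/(jac l b2 b).
transitivity ((\int[gam]_c \int[gam]_d H3 (a, b, (c, d))) *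
    (jac l b2 b)%:E); last first.
  apply: esym; apply: etrans (gauss_halfZr (g22 a b) _ (J2 b)); last first.
    by move=> ?; do 1 apply: integral_ge0 => ? _.
  by apply: eq_integral => c _; exact: (gauss_halfZr (g21 a b c) _ (J2 b)).
refine (congr1 (fun t : \bar R => t * _) _).
apply: etrans (ge0_integral_gauss_half_affine (k * a + b3) m0 (h2 _ _) _) _.
  by move=> ?; do 1 apply: integral_ge0 => ? _.
apply: eq_integral => c _; rewrite -/(jac m (k * a + b3) c).
transitivity ((\int[gam]_d H4 (a, b, (c, d))) *
    (jac m (k * a + b3) c)%:E); last first.
  apply: esym; apply: etrans (gauss_halfZr (g11 a b c) _ (J3 a c)); last by [].
  by apply: eq_integral.
refine (congr1 (fun t : \bar R => t * _) _).
apply: etrans (ge0_integral_gauss_half_affine (k * b + b4) m0 (h1 _ _ _) _) _.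
  by [].
by apply: eq_integral => d _.
Qed.

End affine_substitution.

Section expectation_over_noise.
Local Open Scope ereal_scope.
Context (R : realType).
Local Notation cpx := (R * R)%type.
Local Notation noise := (cpx * cpx)%type.
Implicit Types F G : seq noise -> \bar R.

Lemma measurable_cons_tuple d (T : measurableType d) n :
  measurable_fun setT (fun q : T * n.-tuple T => [tuple of q.1 :: q.2]).
Proof. exact: measurable_cons. Qed.

Lemma EZ_ge0 n F : (forall zs, 0 <= F zs) -> 0 <= EZ n F.
Proof.
elim: n F => [|n IH] F F0; first exact: F0.
by rewrite EZS; apply: I4_ge0 => z; apply: IH.
Qed.

Lemma EZ0 F : EZ 0 F = F [::].
Proof. by []. Qed.

Lemma eq_EZ n F G : (forall zs, size zs = n -> F zs = G zs) -> EZ n F = EZ n G.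
Proof.
elim: n F G => [|n IH] F G FG; first exact: FG.
by rewrite !EZS; apply: eq_I4 => z; apply: IH => zs sz; apply: FG => /=; rewrite sz.
Qed.

Lemma EZ_cst n (k : \bar R) : EZ n (fun=> k) = k.
Proof.
elim: n => [//|n IH]; rewrite EZS -[RHS](I4_cst k).
by apply: eq_I4 => z.
Qed.

(** The induction generalizes the parameter space [P], because the noise of the first slot becomes a
    parameter of the remaining ones. *)
Lemma measurable_EZ d (P : measurableType d) n (F : P -> seq noise -> \bar R) :
  measurable_fun setT (fun q : P * n.-tuple noise => F q.1 q.2) ->
  (forall p zs, 0 <= F p zs) -> measurable_fun setT (fun p => EZ n (F p)).
Proof.
elim: n d P F => [|n IH] d P F mF F0.
  have mp : measurable_fun setT (fun p : P => (p, [tuple] : 0.-tuple noise)) by [].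
  exact: (measurableT_comp mF mp).
have mf : measurable_fun setT
    (fun q : P * noise => EZ n (fun zs => F q.1 (q.2 :: zs))).
  apply: (IH _ _ (fun (q : P * noise) zs => F q.1 (q.2 :: zs))) => //.
  have mc : measurable_fun setT (fun q : P * noise * n.-tuple noise =>
      (q.1.1, [tuple of q.1.2 :: q.2])).
    apply: measurable_fun_pair; first by meas.
    apply: measurable_cons => //; meas.
  exact: (measurableT_comp mF mc).
by have [] := measurable_I4_steps mf (fun q => EZ_ge0 n (fun _ => F0 _ _)).
Qed.

Section sections.
Variables (n : nat) (F : seq noise -> \bar R).
Hypothesis mF : measurable_fun setT (fun t : n.+1.-tuple noise => F t).
Hypothesis F0 : forall zs, 0 <= F zs.

Lemma measurable_cons_section z :
  measurable_fun setT (fun t : n.-tuple noise => F (z :: t)).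
Proof.
have mc : measurable_fun setT (fun t : n.-tuple noise => [tuple of z :: t]).
  by apply: measurable_cons.
exact: (measurableT_comp mF mc).
Qed.

Lemma measurable_EZ_section :
  measurable_fun setT (fun z => EZ n (fun zs => F (z :: zs))).
Proof.
apply: (measurable_EZ (F := fun z zs => F (z :: zs))) => //.
exact: (measurableT_comp mF (@measurable_cons_tuple _ noise n)).
Qed.
End sections.

Lemma le_EZ n F G :
  measurable_fun setT (fun t : n.-tuple noise => F t) ->
  measurable_fun setT (fun t : n.-tuple noise => G t) ->
  (forall zs, 0 <= F zs) -> (forall zs, 0 <= G zs) ->
  (forall zs, size zs = n -> F zs <= G zs) -> EZ n F <= EZ n G.
Proof.
elim: n F G => [|n IH] F G mF mG F0 G0 FG; first exact: FG.
rewrite !EZS; apply: le_I4.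
- exact: measurable_EZ_section.
- exact: measurable_EZ_section.
- by move=> z; apply: EZ_ge0.
- move=> z; apply: IH => //; try exact: measurable_cons_section.
  by move=> zs sz; apply: FG => /=; rewrite sz.
Qed.

Lemma EZD n F G :
  measurable_fun setT (fun t : n.-tuple noise => F t) ->
  measurable_fun setT (fun t : n.-tuple noise => G t) ->
  (forall zs, 0 <= F zs) -> (forall zs, 0 <= G zs) ->
  EZ n (fun zs => F zs + G zs) = EZ n F + EZ n G.
Proof.
elim: n F G => [|n IH] F G mF mG F0 G0; first exact: (erefl (F [::] + G [::])).
rewrite !EZS -I4D.
- by apply: eq_I4 => z; apply: IH => //; exact: measurable_cons_section.
- exact: measurable_EZ_section.
- exact: measurable_EZ_section.
- by move=> z; apply: EZ_ge0.
- by move=> z; apply: EZ_ge0.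
Qed.

Lemma EZZl n (k : \bar R) F :
  measurable_fun setT (fun t : n.-tuple noise => F t) ->
  (forall zs, 0 <= F zs) -> 0 <= k ->
  EZ n (fun zs => k * F zs) = k * EZ n F.
Proof.
elim: n F => [|n IH] F mF F0 k0; first exact: (erefl (k * F [::])).
rewrite !EZS -I4Zl.
- by apply: eq_I4 => z; apply: IH => //; exact: measurable_cons_section.
- exact: measurable_EZ_section.
- by move=> z; apply: EZ_ge0.
- exact: k0.
Qed.

Lemma EZ_sum n (I : Type) (s : seq I) (F : I -> seq noise -> \bar R) :
  (forall i, measurable_fun setT (fun t : n.-tuple noise => F i t)) ->
  (forall i zs, 0 <= F i zs) ->
  EZ n (fun zs => \sum_(i <- s) F i zs) = \sum_(i <- s) EZ n (F i).
Proof.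
move=> mF F0; elim: s => [|i s IH].
  rewrite big_nil -[RHS](EZ_cst n 0); apply: eq_EZ => zs _.
  by rewrite big_nil.
rewrite big_cons -IH -EZD//; last 2 first.
- exact: emeasurable_sum.
- by move=> zs; apply: sume_ge0.
by apply: eq_EZ => zs _; rewrite big_cons.
Qed.

End expectation_over_noise.

(* Keeps unification from unfolding iterated integrals. *)
Opaque I4 EZ.

(** * Change of measure *)

Section single_slot_change_of_measure.
Context (R : realType).
Local Notation cpx := (R * R)%type.

(* Up to the factor [l * m], the exponential of the left-hand side is the likelihood
   ratio of the true outputs, written in the noise coordinates [a], [d] of the
   reference. *)
Lemma gaussian_exponent_simo (c t l m x a d : R) :
  l ^+ 2 = 1 + c ^+ 2 -> m ^+ 2 = 1 + t ^+ 2 ->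
  (a ^+ 2 - (l * a + - (c * x)) ^+ 2 + (d ^+ 2 - (m * d + (t * c * a + - (t * l * x))) ^+ 2)
  <= x ^+ 2)%R.
Proof.
move=> hl hm; rewrite -subr_ge0.
suff -> : (x ^+ 2 - (a ^+ 2 - (l * a + - (c * x)) ^+ 2 +
    (d ^+ 2 - (m * d + (t * c * a + - (t * l * x))) ^+ 2)) =
    (l * m * x - c * m * a - t * d) ^+ 2)%R by exact: sqr_ge0.
apply/eqP; rewrite -subr_eq0; apply/eqP.
transitivity (- ((l ^+ 2 - (1 + c ^+ 2)) * (x ^+ 2 - a ^+ 2) +
  (m ^+ 2 - (1 + t ^+ 2)) * (c ^+ 2 * a ^+ 2 - d ^+ 2 + l ^+ 2 * x ^+ 2 - 2 * l * c * a * x)))%R.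
  by ring.
by rewrite hl hm !subrr !mul0r addr0 oppr0.
Qed.

(** Here [z] is the true noise, and [l * d = z + g1 * x + g2 * r]. The claim is the Cauchy-Schwarz
    inequality for [(1, g1, g2)] and [(z, x, r)]; the three squares in the proof are the defect in
    Lagrange's identity. *)
Lemma gaussian_exponent_miso (g1 g2 l x r d : R) : (0 < l)%R ->
  l ^+ 2 = 1 + g1 ^+ 2 + g2 ^+ 2 ->
  (d ^+ 2 - (l * d + - (g1 * x + g2 * r)) ^+ 2 <= x ^+ 2 + r ^+ 2)%R.
Proof.
move=> l0 hl; rewrite lerBlDr.
set z := (l * d + _)%R.
have l20 : (0 < l ^+ 2)%R by rewrite exprn_gt0.
rewrite -(ler_pM2l l20) -exprMn.
have -> : (l * d = z + g1 * x + g2 * r)%R by rewrite /z; ring.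
rewrite hl -subr_ge0.
have -> : ((1 + g1 ^+ 2 + g2 ^+ 2) * (x ^+ 2 + r ^+ 2 + z ^+ 2) - (z + g1 * x + g2 * r) ^+ 2 =
  (g1 * z - x) ^+ 2 + (g2 * z - r) ^+ 2 + (g1 * r - g2 * x) ^+ 2)%R by ring.
by rewrite !addr_ge0 ?sqr_ge0.
Qed.

Lemma measurable_cadd d (T : measurableType d) (f g : T -> cpx) :
  measurable_fun setT f -> measurable_fun setT g ->
  measurable_fun setT (fun x => cadd (f x) (g x)).
Proof. by move=> mf mg; rewrite /cadd; meas. Qed.

Lemma measurable_cscale d (T : measurableType d) (f : T -> R) (g : T -> cpx) :
  measurable_fun setT f -> measurable_fun setT g ->
  measurable_fun setT (fun x => cscale (f x) (g x)).
Proof. by move=> mf mg; rewrite /cscale; meas. Qed.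

Lemma measurable_cmul d (T : measurableType d) (f g : T -> cpx) :
  measurable_fun setT f -> measurable_fun setT g ->
  measurable_fun setT (fun x => cmul (f x) (g x)).
Proof. by move=> mf mg; rewrite /cmul; meas. Qed.

Lemma measurable_cnorm2 d (T : measurableType d) (f : T -> cpx) :
  measurable_fun setT f -> measurable_fun setT (fun x => cnorm2 (f x)).
Proof. by move=> mf; rewrite /cnorm2; meas. Qed.

Lemma cnorm2_ge0 (x : cpx) : (0 <= cnorm2 x)%R.
Proof. by rewrite addr_ge0 ?sqr_ge0. Qed.

Lemma cnorm2_rot (th : R) (x : cpx) : cnorm2 (cmul (cexpj th) x) = cnorm2 x.
Proof.
rewrite /cnorm2 /cmul /cexpj /=.
transitivity ((cos th ^+ 2 + sin th ^+ 2) * (x.1 ^+ 2 + x.2 ^+ 2))%R; first by ring.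
by rewrite cos2Dsin2 mul1r.
Qed.

Local Open Scope ereal_scope.

Lemma le_I4_weight (f : cpx * cpx -> \bar R) (w : cpx * cpx -> R) (K : R) :
  measurable_fun setT f -> measurable_fun setT w ->
  (forall z, 0 <= f z) -> (forall z, 0 <= w z <= K)%R ->
  I4 (fun z => f z * (w z)%:E) <= K%:E * I4 f.
Proof.
move=> mf mw f0 wK.
have K0 : (0 <= K)%R.
  by have /andP[w0 /(le_trans w0)] := wK (0, 0, (0, 0))%R.
have E : I4 (fun z => K%:E * f z) = K%:E * I4 f by apply: I4Zl => //; rewrite lee_fin.
rewrite -E; apply: le_I4.
- by apply: emeasurable_funM => //; exact/measurable_EFinP.
- exact: measurable_funeM.
- by move=> z; rewrite mule_ge0// lee_fin; case/andP: (wK z).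
- by move=> z; rewrite muleC lee_wpmul2r// lee_fin; case/andP: (wK z).
Qed.

(** In use, [H] is a functional of the true outputs and [G] the same functional of the reference
    outputs; [subst4] expresses the true noise through the reference noise. The squares of [l] and
    [m] come from the real and imaginary parts, into which the exponent splits as well. *)
Lemma I4_change (l m k b1 b2 b3 b4 E : R) (H G : cpx * cpx -> \bar R) :
  (0 < l)%R -> (0 < m)%R ->
  measurable_fun setT H -> (forall z, 0 <= H z) -> measurable_fun setT G ->
  (forall z, H (subst4 l m k b1 b2 b3 b4 z) = G z) ->
  (forall a b c d,
    (a ^+ 2 - (l * a + b1) ^+ 2 + (c ^+ 2 - (m * c + (k * a + b3)) ^+ 2)) +
    (b ^+ 2 - (l * b + b2) ^+ 2 + (d ^+ 2 - (m * d + (k * b + b4)) ^+ 2)) <= E)%R ->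
  I4 H <= (l ^+ 2 * m ^+ 2 * expR E)%:E * I4 G.
Proof.
move=> l0 m0 mH H0 mG HG hE.
rewrite (I4_subst4 k b1 b2 b3 b4 l0 m0 mH H0).
set w := fun z : cpx * cpx => (jac m (k * z.1.2 + b4) z.2.2 *
  jac m (k * z.1.1 + b3) z.2.1 * jac l b2 z.1.2 * jac l b1 z.1.1)%R.
have -> : I4 (fun z => H (subst4 l m k b1 b2 b3 b4 z) * (w z)%:E) =
          I4 (fun z => G z * (w z)%:E) by apply: eq_I4 => z; rewrite HG.
apply: le_I4_weight => //; first by rewrite /w /jac; meas.
  by move=> z; rewrite -HG.
move=> z; apply/andP; split; first by
  do 3 (apply: mulr_ge0; last exact: jac_ge0); exact: jac_ge0.
rewrite /w /jac.
set e1 := expR _; set e2 := expR _; set e3 := expR _; set e4 := expR _.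
rewrite (_ : _ * _ = l ^+ 2 * m ^+ 2 * (e4 * e2 * (e3 * e1)))%R; last by ring.
have K0 : (0 <= l ^+ 2 * m ^+ 2)%R by rewrite mulr_ge0 ?sqr_ge0.
rewrite ler_wpM2l// /e1 /e2 /e3 /e4 -!expRD ler_expR.
exact: hE.
Qed.

(** The matrix applied to the noise is the Cholesky factor of [I + h h^T] for [h = (c, s)]. The
    offset [o] is the relay's contribution, which is a function of the past and may remain in the
    reference. *)
Definition simo_ref (c s : R) (o : cpx) (z : cpx * cpx) : cpx * cpx :=
  let l := Num.sqrt (1 + c ^+ 2) in
  let t := (s / l)%R in
  (cscale l z.1, cadd o (cadd (cscale (t * c) z.1) (cscale (Num.sqrt (1 + t ^+ 2)) z.2))).

Lemma I4_simo (c s : R) (x o : cpx) (H : cpx * cpx -> \bar R) :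
  measurable_fun setT H -> (forall y, 0 <= H y) ->
  I4 (fun z => H (cadd (cscale c x) z.1, cadd (cadd (cscale s x) o) z.2)) <=
  ((1 + c ^+ 2 + s ^+ 2) * expR (cnorm2 x))%:E * I4 (fun z => H (simo_ref c s o z)).
Proof.
move=> mH H0.
pose l := Num.sqrt (1 + c ^+ 2)%R; pose t := (s / l)%R; pose m := Num.sqrt (1 + t ^+ 2)%R.
have l0 : (0 < l)%R by rewrite sqrtr_gt0 ltr_pwDl// sqr_ge0.
have m0 : (0 < m)%R by rewrite sqrtr_gt0 ltr_pwDl// sqr_ge0.
have hl : (l ^+ 2 = 1 + c ^+ 2)%R by rewrite sqr_sqrtr// addr_ge0 ?sqr_ge0.
have hm : (m ^+ 2 = 1 + t ^+ 2)%R by rewrite sqr_sqrtr// addr_ge0 ?sqr_ge0.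
have st : s = (t * l)%R by rewrite /t divfK ?gt_eqF.
have mT : measurable_fun setT (fun z : cpx * cpx =>
    (cadd (cscale c x) z.1, cadd (cadd (cscale s x) o) z.2)).
  by rewrite /cadd /cscale; meas.
have mref : measurable_fun setT (simo_ref c s o).
  by rewrite /simo_ref /cadd /cscale; meas.
have lm : (l ^+ 2 * m ^+ 2 = 1 + c ^+ 2 + s ^+ 2)%R
  by rewrite [in RHS]st exprMn hm hl; move: (t) => t'; ring.
rewrite -lm.
apply: (@I4_change l m (t * c) (- (c * x.1)) (- (c * x.2)) (- (t * l * x.1))
  (- (t * l * x.2)) _ _ _ l0 m0 (measurableT_comp mH mT)) => [z||z|a b cc d].
- exact: H0.
- exact: (measurableT_comp mH mref).
- congr H; rewrite /simo_ref -/l -/t -/m /cadd /cscale /= {}st.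
  by congr (_, _); congr (_, _); ring.
- by apply: lerD; apply: gaussian_exponent_simo.
Qed.

Lemma I4_miso (g1 g2 : R) (x r : cpx) (H : cpx -> \bar R) :
  measurable_fun setT H -> (forall y, 0 <= H y) ->
  I4 (fun z => H (cadd (cadd (cscale g1 x) (cscale g2 r)) z.2)) <=
  ((1 + g1 ^+ 2 + g2 ^+ 2) * expR (cnorm2 x + cnorm2 r))%:E *
  I4 (fun z => H (cscale (Num.sqrt (1 + g1 ^+ 2 + g2 ^+ 2)) z.2)).
Proof.
move=> mH H0.
pose m := Num.sqrt (1 + g1 ^+ 2 + g2 ^+ 2)%R.
have m0 : (0 < m)%R by rewrite sqrtr_gt0 -addrA ltr_pwDl// addr_ge0 ?sqr_ge0.
have hm : (m ^+ 2 = 1 + g1 ^+ 2 + g2 ^+ 2)%R by rewrite sqr_sqrtr// !addr_ge0 ?sqr_ge0.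
have mT : measurable_fun setT (fun z : cpx * cpx =>
    cadd (cadd (cscale g1 x) (cscale g2 r)) z.2).
  by rewrite /cadd /cscale; meas.
have mref : measurable_fun setT (fun z : cpx * cpx => cscale m z.2).
  by rewrite /cscale; meas.
rewrite -/m (_ : 1 + g1 ^+ 2 + g2 ^+ 2 = 1 ^+ 2 * m ^+ 2)%R; last first.
  by rewrite expr1n mul1r hm.
(* The relay's noise is left as it is; only the destination's noise is rescaled and shifted. *)
apply: (@I4_change 1 m 0 0 0 (- (g1 * x.1 + g2 * r.1)) (- (g1 * x.2 + g2 * r.2))
  _ _ _ ltr01 m0 (measurableT_comp mH mT)) => [z||z|a b c d].
- exact: H0.
- exact: (measurableT_comp mH mref).
- congr H; rewrite /cadd /cscale /=.
  by congr (_, _); ring.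
- rewrite !mul1r !mul0r !add0r !addr0 !subrr !add0r.
  rewrite (_ : cnorm2 x + cnorm2 r =
    (x.1 ^+ 2 + r.1 ^+ 2) + (x.2 ^+ 2 + r.2 ^+ 2))%R; last by rewrite /cnorm2; ring.
  apply: lerD; apply: gaussian_exponent_miso => //; exact: hm.
Qed.

End single_slot_change_of_measure.

(** * Causal systems driven by the noise *)

Section causal_systems.
Context (R : realType).
Local Notation cpx := (R * R)%type.
Local Notation noise := (cpx * cpx)%type.

(** Common form of the channel and of its reference: a slot turns the relay's past and fresh noise
    into a pair of relay and destination outputs, and only the relay's component feeds back. *)
Fixpoint outputs (step : nat -> seq cpx -> noise -> cpx * cpx) (i : nat)
    (yr : seq cpx) (zs : seq noise) : seq cpx :=
  match zs with
  | [::] => [::]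
  | z :: zs' => let y := step i yr z in
    y.2 :: outputs step i.+1 (rcons yr y.1) zs'
  end.

(** The summand [g i yr] is predictable: it depends on the past only. This is what allows its
    exponential to leave the integral over the current slot. Power, cost and number of transmitting
    slots all have this form. *)
Fixpoint run_sum (step : nat -> seq cpx -> noise -> cpx * cpx)
    (g : nat -> seq cpx -> R) (i : nat) (yr : seq cpx) (zs : seq noise) : R :=
  match zs with
  | [::] => 0
  | z :: zs' => g i yr + run_sum step g i.+1 (rcons yr (step i yr z).1) zs'
  end.

Lemma measurable_rcons d (P : measurableType d) d' (T : measurableType d') i
    (f : P -> i.-tuple T) (g : P -> T) :
  measurable_fun setT f -> measurable_fun setT g ->
  measurable_fun setT (fun p => [tuple of rcons (f p) (g p)]).
Proof.
move=> mf mg; apply/measurable_fun_tnthP => j.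
have [ji|ij] := ltnP j i.
  rewrite (_ : _ \o _ = (fun p => tnth (f p) (Ordinal ji))).
    exact: (measurableT_comp (measurable_tnth (Ordinal ji)) mf).
  apply/funext => p /=; rewrite (tnth_nth (tnth (f p) (Ordinal ji))) /=.
  by rewrite nth_rcons size_tuple ji [RHS](tnth_nth (tnth (f p) (Ordinal ji))).
rewrite (_ : _ \o _ = g) //; apply/funext => p /=.
have e : j = i :> nat by apply/eqP; rewrite eqn_leq ij andbT -ltnS.
by rewrite (tnth_nth (g p)) /= nth_rcons size_tuple ltnNge ij /= e eqxx.
Qed.

Definition measurable_step d (P : measurableType d) N
    (step : P -> nat -> seq cpx -> noise -> cpx * cpx) :=
  forall i, (i < N)%N -> measurable_fun setT
    (fun q : P * i.-tuple cpx * noise => step q.1.1 i q.1.2 q.2).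

Definition measurable_rate d (P : measurableType d) N
    (g : P -> nat -> seq cpx -> R) :=
  forall i, (i < N)%N -> measurable_fun setT
    (fun q : P * i.-tuple cpx => g q.1 i q.2).

Lemma measurable_uncons d (P : measurableType d) n :
  measurable_fun setT (fun q : P * n.+1.-tuple noise =>
    ((q.1, thead q.2), [tuple of behead q.2])).
Proof.
apply: measurable_fun_pair; last first.
  exact: (measurableT_comp (@measurable_behead _ _ n) measurable_snd).
apply: measurable_fun_pair => //.
exact: (measurableT_comp (measurable_tnth ord0) measurable_snd).
Qed.

Section next_step.
Context d (P : measurableType d) (N i : nat)
  (step : P -> nat -> seq cpx -> noise -> cpx * cpx) (yr : P -> i.-tuple cpx).
Hypotheses (mstep : measurable_step N step) (myr : measurable_fun setT yr)
  (iN : (i < N)%N).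

Lemma measurable_step_at :
  measurable_fun setT (fun q : P * noise => step q.1 i (yr q.1) q.2).
Proof.
have m1 : measurable_fun setT (fun q : P * noise => (q.1, yr q.1, q.2)).
  do 2 apply: measurable_fun_pair => //.
  exact: (measurableT_comp myr measurable_fst).
exact: (measurableT_comp (mstep iN) m1).
Qed.

Lemma measurable_past :
  measurable_fun setT (fun q : P * noise =>
    [tuple of rcons (yr q.1) (step q.1 i (yr q.1) q.2).1]).
Proof.
apply: measurable_rcons; first exact: (measurableT_comp myr measurable_fst).
exact: (measurableT_comp measurable_fst measurable_step_at).
Qed.

End next_step.

Lemma measurable_step_fst d (P : measurableType d) N
    (step : P -> nat -> seq cpx -> noise -> cpx * cpx) d' (Q : measurableType d') :
  measurable_step N step ->
  measurable_step N (fun q : P * Q => step q.1).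
Proof.
move=> mstep j jN.
have m1 : measurable_fun setT (fun q : P * Q * j.-tuple cpx * noise =>
    (q.1.1.1, q.1.2, q.2)).
  by meas.
exact: (measurableT_comp (mstep j jN) m1).
Qed.

Lemma measurable_outputs d (P : measurableType d) N n i
    (step : P -> nat -> seq cpx -> noise -> cpx * cpx) (yr : P -> i.-tuple cpx)
    (D : P -> seq cpx -> R) :
  measurable_step N step -> measurable_fun setT yr -> (i + n <= N)%N ->
  measurable_fun setT (fun q : P * n.-tuple cpx => D q.1 q.2) ->
  measurable_fun setT (fun q : P * n.-tuple noise =>
    D q.1 (outputs (step q.1) i (yr q.1) q.2)).
Proof.
elim: n d P i step yr D => [|n IH] d P i step yr D mstep myr iN mD.
  have m0 : measurable_fun setT
    (fun q : P * 0.-tuple noise => (q.1, [tuple] : 0.-tuple cpx)) by meas.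
  rewrite (_ : (fun _ => _) =
    (fun q : P * 0.-tuple cpx => D q.1 q.2) \o (fun q => (q.1, [tuple]))).
    exact: (measurableT_comp mD m0).
  by apply/funext => -[p z] /=; rewrite tuple0.
have iN' : (i < N)%N by rewrite (leq_trans _ iN)// addnS ltnS leq_addr.
pose step' (q : P * noise) := step q.1.
pose yr' (q : P * noise) := [tuple of rcons (yr q.1) (step q.1 i (yr q.1) q.2).1].
pose D' (q : P * noise) (l : seq cpx) := D q.1 ((step q.1 i (yr q.1) q.2).2 :: l).
have mD' : measurable_fun setT (fun q : P * noise * n.-tuple cpx => D' q.1 q.2).
  have m1 : measurable_fun setT (fun q : P * noise * n.-tuple cpx =>
      (q.1.1, [tuple of (step q.1.1 i (yr q.1.1) q.1.2).2 :: q.2])).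
    apply: measurable_fun_pair; first by meas.
    apply: measurable_cons; last by meas.
    apply: (measurableT_comp measurable_snd).
    exact: (measurableT_comp (measurable_step_at mstep myr iN') measurable_fst).
  exact: (measurableT_comp mD m1).
have := IH _ _ i.+1 step' yr' D' (measurable_step_fst mstep)
  (measurable_past mstep myr iN') _ mD'.
rewrite addSnnS => /(_ iN) mIH.
rewrite (_ : (fun _ => _) = (fun q : P * noise * n.-tuple noise =>
    D' q.1 (outputs (step' q.1) i.+1 (yr' q.1) q.2)) \o
    (fun q : P * n.+1.-tuple noise => ((q.1, thead q.2), [tuple of behead q.2]))).
  exact: (measurableT_comp mIH (@measurable_uncons _ P n)).
by apply/funext => -[p /tupleP[z zs]] /=; rewrite theadE.
Qed.

Lemma measurable_run_sum d (P : measurableType d) N n i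
    (step : P -> nat -> seq cpx -> noise -> cpx * cpx) (yr : P -> i.-tuple cpx)
    (g : P -> nat -> seq cpx -> R) :
  measurable_step N step -> measurable_fun setT yr -> (i + n <= N)%N ->
  measurable_rate N g ->
  measurable_fun setT (fun q : P * n.-tuple noise =>
    run_sum (step q.1) (g q.1) i (yr q.1) q.2).
Proof.
elim: n d P i step yr g => [|n IH] d P i step yr g mstep myr iN mg.
  rewrite (_ : (fun _ => _) = cst 0); first by [].
  by apply/funext => -[p z] /=; rewrite tuple0.
have iN' : (i < N)%N by rewrite (leq_trans _ iN)// addnS ltnS leq_addr.
pose step' (q : P * noise) := step q.1.
pose yr' (q : P * noise) := [tuple of rcons (yr q.1) (step q.1 i (yr q.1) q.2).1].
pose g' (q : P * noise) := g q.1.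
have mg' : measurable_rate N g'.
  move=> j jN; have m1 : measurable_fun setT
    (fun q : P * noise * j.-tuple cpx => (q.1.1, q.2)) by meas.
  exact: (measurableT_comp (mg j jN) m1).
have := IH _ _ i.+1 step' yr' g' (measurable_step_fst mstep)
  (measurable_past mstep myr iN') _ mg'.
rewrite addSnnS => /(_ iN) mIH.
have m2 := measurableT_comp mIH (@measurable_uncons _ P n).
have m3 : measurable_fun setT (fun q : P * n.+1.-tuple noise => g q.1 i (yr q.1)).
  have m4 : measurable_fun setT (fun q : P * n.+1.-tuple noise => (q.1, yr q.1)).
    by apply: measurable_fun_pair => //; exact: (measurableT_comp myr measurable_fst).
  exact: (measurableT_comp (mg i iN') m4).
rewrite (_ : (fun _ => _) = (fun q => g q.1 i (yr q.1)) \+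
   ((fun q : P * noise * n.-tuple noise =>
    run_sum (step' q.1) (g' q.1) i.+1 (yr' q.1) q.2) \o
    (fun q : P * n.+1.-tuple noise => ((q.1, thead q.2), [tuple of behead q.2])))).
  exact: (measurable_funD m3 m2).
by apply/funext => -[p /tupleP[z zs]] /=; rewrite theadE.
Qed.

End causal_systems.

Section change_of_measure.
Local Open Scope ereal_scope.
Context (R : realType).
Local Notation cpx := (R * R)%type.
Local Notation noise := (cpx * cpx)%type.
Implicit Types (step ref : nat -> seq cpx -> noise -> cpx * cpx)
  (g : nat -> seq cpx -> R).

Definition measurable_causal N step := forall i, (i < N)%N ->
  measurable_fun setT (fun q : i.-tuple cpx * noise => step i q.1 q.2).

Definition measurable_past_fun N g := forall i, (i < N)%N ->
  measurable_fun setT (fun q : i.-tuple cpx => g i q).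

Lemma measurable_step_cst N step d (P : measurableType d) :
  measurable_causal N step -> measurable_step N (fun _ : P => step).
Proof.
move=> mstep i iN.
have m1 : measurable_fun setT (fun q : P * i.-tuple cpx * noise => (q.1.2, q.2)).
  by meas.
exact: (measurableT_comp (mstep i iN) m1).
Qed.

Lemma measurable_rate_cst N g d (P : measurableType d) :
  measurable_past_fun N g -> measurable_rate N (fun _ : P => g).
Proof.
move=> mg i iN; exact: (measurableT_comp (mg i iN) measurable_snd).
Qed.

Section next_slot.
Variables (N n i : nat) (step : nat -> seq cpx -> noise -> cpx * cpx)
  (g : nat -> seq cpx -> R) (D : seq cpx -> R) (yr : i.-tuple cpx).
Hypotheses (mstep : measurable_causal N step) (mg : measurable_past_fun N g).
Hypothesis iN : (i + n.+1 <= N)%N.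
Hypothesis (mD : measurable_fun setT (fun t : n.+1.-tuple cpx => D t)).

Let iN' : (i.+1 + n <= N)%N. Proof. by rewrite addSnnS. Qed.

Lemma measurable_past_rcons : measurable_fun setT
  (fun y : cpx * cpx => [tuple of rcons yr y.1]).
Proof. by apply: measurable_rcons => //; meas. Qed.

Lemma measurable_outputs_cons : measurable_fun setT
  (fun q : (cpx * cpx) * n.-tuple noise =>
     D (q.1.2 :: outputs step i.+1 (rcons yr q.1.1) q.2)).
Proof.
apply: (@measurable_outputs _ _ _ N n i.+1 (fun=> step)
  (fun y => [tuple of rcons yr y.1]) (fun y l => D (y.2 :: l))) => //.
- exact: measurable_step_cst.
- exact: measurable_past_rcons.
have m1 : measurable_fun setT (fun q : (cpx * cpx) * n.-tuple cpx =>
  [tuple of q.1.2 :: q.2]) by apply: measurable_cons; meas.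
exact: (measurableT_comp mD m1).
Qed.

Lemma measurable_run_sum_rcons : measurable_fun setT
  (fun q : (cpx * cpx) * n.-tuple noise =>
     run_sum step g i.+1 (rcons yr q.1.1) q.2).
Proof.
apply: (@measurable_run_sum _ _ _ N n i.+1 (fun=> step)
  (fun y => [tuple of rcons yr y.1]) (fun=> g)) => //.
- exact: measurable_step_cst.
- exact: measurable_past_rcons.
- exact: measurable_rate_cst.
Qed.

Lemma measurable_step_section : measurable_fun setT (step i yr).
Proof.
have i_ltN : (i < N)%N by rewrite (leq_trans _ iN)// addnS ltnS leq_addr.
exact: (measurableT_comp (mstep i_ltN) (measurable_pair1 yr)).
Qed.

End next_slot.

Lemma measurable_fun_cons n (D : seq cpx -> R) :
  measurable_fun setT (fun t : n.+1.-tuple cpx => D t) -> forall y,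
  measurable_fun setT (fun t : n.-tuple cpx => D (y :: t)).
Proof.
move=> mD y.
have m1 : measurable_fun setT (fun t : n.-tuple cpx => [tuple of y :: t]).
  by apply: measurable_cons.
exact: (measurableT_comp mD m1).
Qed.

Section outputs_tuple.
Variables (N n i : nat) (step : nat -> seq cpx -> noise -> cpx * cpx)
  (D : seq cpx -> R) (yr : i.-tuple cpx).
Hypothesis mstep : measurable_causal N step.
Hypothesis iN : (i + n <= N)%N.
Hypothesis (mD : measurable_fun setT (fun t : n.-tuple cpx => D t)).

Lemma measurable_outputs_tuple : measurable_fun setT (fun t : n.-tuple noise =>
  (D (outputs step i yr t))%:E).
Proof.
apply/measurable_EFinP.
have m1 := @measurable_outputs _ _ unit N n i (fun=> step) (fun=> yr) (fun=> D)
  (measurable_step_cst mstep) (measurable_cst yr) iN (measurableT_comp mD measurable_snd).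
exact: measurableT_comp m1 (measurable_pair1 tt).
Qed.

End outputs_tuple.

(** A supermartingale argument. The future is first replaced by its reference, for each value of the
    current outputs ([PhiPsi]); then the factor [expR (- g i yr)], which depends on the past only,
    leaves the current slot and cancels the price [expR (g i yr)] of changing that slot. *)
Lemma EZ_weighted_outputs_le N n i (yr : i.-tuple cpx) step ref g (D : seq cpx -> R) :
  measurable_causal N step -> measurable_causal N ref -> measurable_past_fun N g ->
  (forall i (yr : i.-tuple cpx) (H : cpx * cpx -> \bar R),
    measurable_fun setT H -> (forall y, 0 <= H y) ->
    I4 (fun z => H (step i yr z)) <=
    (expR (g i yr))%:E * I4 (fun z => H (ref i yr z))) ->
  (i + n <= N)%N ->
  measurable_fun setT (fun t : n.-tuple cpx => D t) -> (forall l, (0 <= D l)%R) ->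
  EZ n (fun zs => (D (outputs step i yr zs) * expR (- run_sum step g i yr zs))%:E) <=
  EZ n (fun zs => (D (outputs ref i yr zs))%:E).
Proof.
move=> mstep mref mg change.
elim: n i yr D => [|n IH] i yr D iN mD D0.
  by rewrite !EZ0 /= oppr0 expR0 mulr1.
pose Psi (y : cpx * cpx) :=
  EZ n (fun zs => (D (y.2 :: outputs ref i.+1 (rcons yr y.1) zs))%:E).
pose f (y : cpx * cpx) zs := (D (y.2 :: outputs step i.+1 (rcons yr y.1) zs) *
   expR (- run_sum step g i.+1 (rcons yr y.1) zs))%R.
pose Phi (y : cpx * cpx) := EZ n (fun zs => (f y zs)%:E).
have f0 y zs : 0 <= (f y zs)%:E by rewrite lee_fin mulr_ge0// expR_ge0.
have mf : measurable_fun setT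
    (fun q : (cpx * cpx) * n.-tuple noise => f q.1 q.2).
  apply: (measurable_funM (measurable_outputs_cons yr mstep iN mD)).
  apply: (measurableT_comp (@measurable_expR R)).
  exact: (measurable_funN (measurable_run_sum_rcons yr mstep mg iN)).
have mPhi : measurable_fun setT Phi.
  by apply: (measurable_EZ (F := fun y zs => (f y zs)%:E)) => //; exact/measurable_EFinP.
have mPsi : measurable_fun setT Psi.
  apply: (measurable_EZ
    (F := fun y zs => (D (y.2 :: outputs ref i.+1 (rcons yr y.1) zs))%:E)).
    by apply/measurable_EFinP; exact: (measurable_outputs_cons yr mref iN mD).
  by move=> p zs; rewrite lee_fin.
have Phi0 y : 0 <= Phi y by exact: EZ_ge0.
have Psi0 y : 0 <= Psi y by apply: EZ_ge0 => zs; rewrite lee_fin.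
have PhiPsi y : Phi y <= Psi y.
  apply: (IH _ [tuple of rcons yr y.1] (fun l => D (y.2 :: l))) => //.
    by rewrite addSnnS.
  exact: measurable_fun_cons.
have ms := measurable_step_section yr mstep iN.
have mr := measurable_step_section yr mref iN.
rewrite !EZS.
have -> : I4 (fun z => EZ n (fun zs => (D (outputs step i yr (z :: zs)) *
      expR (- run_sum step g i yr (z :: zs)))%:E)) =
    I4 (fun z => (expR (- g i yr))%:E * Phi (step i yr z)).
  apply: eq_I4 => z; rewrite /Phi -EZZl; last 3 first.
  - apply/measurable_EFinP.
    exact: (measurableT_comp mf (measurable_pair1 (step i yr z))).
  - by move=> zs; exact: f0.
  - by rewrite lee_fin expR_ge0.
  by apply: eq_EZ => zs _; rewrite -EFinM /f /= opprD expRD mulrCA.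
have mPhis : measurable_fun setT (fun z => Phi (step i yr z)).
  exact: (measurableT_comp mPhi ms).
have mPsis : measurable_fun setT (fun z => Psi (step i yr z)).
  exact: (measurableT_comp mPsi ms).
rewrite I4Zl; [|exact: mPhis|by move=> z; exact: Phi0|by rewrite lee_fin expR_ge0].
have le1 : I4 (fun z => Phi (step i yr z)) <= I4 (fun z => Psi (step i yr z)).
  by apply: le_I4.
have le2 := le_trans le1 (change i yr Psi mPsi Psi0).
apply: (le_trans (lee_wpmul2l _ le2)); first by rewrite lee_fin expR_ge0.
rewrite muleA -EFinM -expRD addNr expR0 mul1e.
by rewrite le_eqVlt; apply/orP; left; apply/eqP; apply: eq_I4 => z.
Qed.

End change_of_measure.

Section mixture_reference.
Context (R : realType).
Local Notation cpx := (R * R)%type.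
Local Notation noise := (cpx * cpx)%type.
Variables (l0 l1 : R).

(* The expectation of [D] under independent equal mixtures of two centred Gaussians,
   one per slot, with the mixing already averaged. *)
Fixpoint mixture (D : seq cpx -> R) (zs : seq noise) : R :=
  match zs with
  | [::] => D [::]
  | z :: zs' => 2^-1 * (mixture (fun l => D (cscale l0 z.2 :: l)) zs' +
                        mixture (fun l => D (cscale l1 z.2 :: l)) zs')
  end.

Lemma mixture_ge0 D zs : (forall l, 0 <= D l) -> 0 <= mixture D zs.
Proof.
elim: zs D => [|z zs IH] D D0 /=; first exact: D0.
by rewrite mulr_ge0 ?invr_ge0// addr_ge0// IH.
Qed.

Lemma sum_mixture_le1 (I : Type) (s : seq I) (D : I -> seq cpx -> R) zs :
  (forall l, \sum_(w <- s) D w l <= 1) -> \sum_(w <- s) mixture (D w) zs <= 1.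
Proof.
elim: zs D => [|z zs IH] D D1 /=; first exact: D1.
rewrite -mulr_sumr big_split/=.
have h0 := IH (fun w l => D w (cscale l0 z.2 :: l)) (fun l => D1 _).
have h1 := IH (fun w l => D w (cscale l1 z.2 :: l)) (fun l => D1 _).
rewrite mulrC ler_pdivrMr// mul1r; have -> : 2 = 1 + 1 :> R by [].
exact: lerD.
Qed.

Lemma measurable_mixture d (P : measurableType d) n (D : P -> seq cpx -> R) :
  measurable_fun setT (fun q : P * n.-tuple cpx => D q.1 q.2) ->
  measurable_fun setT (fun q : P * n.-tuple noise => mixture (D q.1) q.2).
Proof.
elim: n d P D => [|n IH] d P D mD.
  have m0 : measurable_fun setT
    (fun q : P * 0.-tuple noise => (q.1, [tuple] : 0.-tuple cpx)) by meas.
  rewrite (_ : (fun _ => _) =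
    (fun q : P * 0.-tuple cpx => D q.1 q.2) \o (fun q => (q.1, [tuple]))).
    exact: (measurableT_comp mD m0).
  by apply/funext => -[p z] /=; rewrite tuple0.
have mDl l : measurable_fun setT (fun q : P * noise * n.-tuple noise =>
    mixture (fun t => D q.1.1 (cscale l q.1.2.2 :: t)) q.2).
  apply: (IH _ _ (fun (q : P * noise) t => D q.1 (cscale l q.2.2 :: t))).
  have m1 : measurable_fun setT (fun q : P * noise * n.-tuple cpx =>
      (q.1.1, [tuple of cscale l q.1.2.2 :: q.2])).
    apply: measurable_fun_pair; first by meas.
    by apply: measurable_cons; [rewrite /cscale; meas|meas].
  exact: (measurableT_comp mD m1).
rewrite (_ : (fun _ => _) = (fun q : P * noise * n.-tuple noise => 2^-1 *
     (mixture (fun t => D q.1.1 (cscale l0 q.1.2.2 :: t)) q.2 +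
      mixture (fun t => D q.1.1 (cscale l1 q.1.2.2 :: t)) q.2)) \o
    (fun q : P * n.+1.-tuple noise => ((q.1, thead q.2), [tuple of behead q.2]))).
  apply: (measurableT_comp _ (@measurable_uncons _ _ P n)).
  apply: measurable_funM; first exact: measurable_cst.
  exact: (measurable_funD (mDl l0) (mDl l1)).
by apply/funext => -[p /tupleP[z zs]] /=; rewrite theadE.
Qed.

Local Open Scope ereal_scope.

(** As in [EZ_weighted_outputs_le], except that only the destination's output is compared and the
    reference forgets the relay's past altogether. The actual state selects one of the two
    components of the mixture, which is at least half of it: this pays for the division by 2 in the
    hypothesis. *)
Lemma EZ_weighted_mixture_le N n i (yr : i.-tuple cpx)
    (step : nat -> seq cpx -> noise -> cpx * cpx) (g : nat -> seq cpx -> R)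
    (s : nat -> seq cpx -> bool) (D : seq cpx -> R) :
  measurable_causal N step -> measurable_past_fun N g ->
  (forall i (yr : i.-tuple cpx) (H : cpx -> \bar R),
    measurable_fun setT H -> (forall y, 0 <= H y) ->
    I4 (fun z => H (step i yr z).2) <= (expR (g i yr) / 2)%:E *
      I4 (fun z => H (cscale (if s i yr then l1 else l0) z.2))) ->
  (i + n <= N)%N ->
  measurable_fun setT (fun t : n.-tuple cpx => D t) -> (forall l, (0 <= D l)%R) ->
  EZ n (fun zs => (D (outputs step i yr zs) * expR (- run_sum step g i yr zs))%:E) <=
  EZ n (fun zs => (mixture D zs)%:E).
Proof.
move=> mstep mg change.
elim: n i yr D => [|n IH] i yr D iN mD D0.
  by rewrite !EZ0 /= oppr0 expR0 mulr1.
pose Psi (y : cpx) := EZ n (fun zs => (mixture (fun l => D (y :: l)) zs)%:E).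
pose f (y : cpx * cpx) zs := (D (y.2 :: outputs step i.+1 (rcons yr y.1) zs) *
   expR (- run_sum step g i.+1 (rcons yr y.1) zs))%R.
pose Phi (y : cpx * cpx) := EZ n (fun zs => (f y zs)%:E).
have f0 y zs : 0 <= (f y zs)%:E by rewrite lee_fin mulr_ge0// expR_ge0.
have mf : measurable_fun setT
    (fun q : (cpx * cpx) * n.-tuple noise => f q.1 q.2).
  apply: (measurable_funM (measurable_outputs_cons yr mstep iN mD)).
  apply: (measurableT_comp (@measurable_expR R)).
  exact: (measurable_funN (measurable_run_sum_rcons yr mstep mg iN)).
have mPhi : measurable_fun setT Phi.
  by apply: (measurable_EZ (F := fun y zs => (f y zs)%:E)) => //; exact/measurable_EFinP.
have mmix : measurable_fun setT (fun q : cpx * n.-tuple noise =>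
    mixture (fun l => D (q.1 :: l)) q.2).
  apply: (measurable_mixture (D := fun y l => D (y :: l))).
  exact: (measurableT_comp mD (@measurable_cons_tuple _ cpx n)).
have mix0 y zs : 0 <= (mixture (fun l => D (y :: l)) zs)%:E.
  by rewrite lee_fin mixture_ge0.
have mPsi : measurable_fun setT Psi.
  apply: (measurable_EZ (F := fun y zs => (mixture (fun l => D (y :: l)) zs)%:E)) => //.
  exact/measurable_EFinP.
have Phi0 y : 0 <= Phi y by exact: EZ_ge0.
have Psi0 y : 0 <= Psi y by exact: EZ_ge0.
have PhiPsi y : Phi y <= Psi y.2.
  apply: (IH _ [tuple of rcons yr y.1] (fun l => D (y.2 :: l))) => //.
    by rewrite addSnnS.
  exact: measurable_fun_cons.
have ms := measurable_step_section yr mstep iN.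
rewrite !EZS.
have -> : I4 (fun z => EZ n (fun zs => (D (outputs step i yr (z :: zs)) *
      expR (- run_sum step g i yr (z :: zs)))%:E)) =
    I4 (fun z => (expR (- g i yr))%:E * Phi (step i yr z)).
  apply: eq_I4 => z; rewrite /Phi -EZZl; last 3 first.
  - apply/measurable_EFinP.
    exact: (measurableT_comp mf (measurable_pair1 (step i yr z))).
  - by move=> zs; exact: f0.
  - by rewrite lee_fin expR_ge0.
  by apply: eq_EZ => zs _; rewrite -EFinM /f /= opprD expRD mulrCA.
have mPhis : measurable_fun setT (fun z => Phi (step i yr z)).
  exact: (measurableT_comp mPhi ms).
have mPsis : measurable_fun setT (fun z => Psi (step i yr z).2).
  exact: (measurableT_comp mPsi (measurableT_comp measurable_snd ms)).
rewrite I4Zl; [|exact: mPhis|by move=> z; exact: Phi0|by rewrite lee_fin expR_ge0].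
have le1 : I4 (fun z => Phi (step i yr z)) <= I4 (fun z => Psi (step i yr z).2).
  by apply: le_I4.
have le2 := le_trans le1 (change i yr Psi mPsi Psi0).
apply: (le_trans (lee_wpmul2l _ le2)); first by rewrite lee_fin expR_ge0.
rewrite muleA -EFinM mulrA -expRD addNr expR0 mul1r.
set l := if _ then _ else _.
have ml k : measurable_fun setT (fun z : noise => Psi (cscale k z.2)).
  by apply: (measurableT_comp mPsi); rewrite /cscale; meas.
rewrite -I4Zl; [|exact: ml|by move=> z; exact: Psi0|by rewrite lee_fin invr_ge0].
have mmixz y : measurable_fun setT (fun t : n.-tuple noise =>
    (mixture (fun l => D (y :: l)) t)%:E).
  by apply/measurable_EFinP; exact: (measurableT_comp mmix (measurable_pair1 y)).
have E z : EZ n (fun zs => (mixture D (z :: zs))%:E) =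
    (2^-1)%:E * Psi (cscale l0 z.2) + (2^-1)%:E * Psi (cscale l1 z.2).
  have h2 : 0 <= (2^-1 : R)%:E by rewrite lee_fin invr_ge0.
  have hk k : (2^-1)%:E * Psi (cscale k z.2) =
      EZ n (fun zs => (2^-1)%:E * (mixture (fun l => D (cscale k z.2 :: l)) zs)%:E).
    by rewrite EZZl.
  rewrite !hk -EZD; last 4 first.
  - exact: measurable_funeM.
  - exact: measurable_funeM.
  - by move=> zs; exact: mule_ge0.
  - by move=> zs; exact: mule_ge0.
  by apply: eq_EZ => zs _; rewrite -!EFinM -EFinD -mulrDr.
have -> : I4 (fun z => EZ n (fun zs => (mixture D (z :: zs))%:E)) =
    I4 (fun z => (2^-1)%:E * Psi (cscale l0 z.2) + (2^-1)%:E * Psi (cscale l1 z.2)).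
  by apply: eq_I4.
have h0 k z : 0 <= (2^-1)%:E * Psi (cscale k z.2).
  by rewrite mule_ge0// lee_fin invr_ge0.
apply: le_I4.
- exact: measurable_funeM.
- by apply: emeasurable_funD; exact: measurable_funeM.
- by move=> z; exact: h0.
- by move=> z; rewrite /l; case: (s i yr); [rewrite leeDr|rewrite leeDl].
Qed.

End mixture_reference.

(** * Converse *)

Section channel_dynamics.
Context (R : realType).
Local Notation cpx := (R * R)%type.
Local Notation noise := (cpx * cpx)%type.
Variables (ch : hd_chan R) (c : hd_code R).

Definition relay_offset (u : R) (i : nat) (yr : seq cpx) : cpx :=
  cscale (Num.sqrt (gI ch) * (rly_s c i u yr)%:R)
    (cmul (cexpj (theta ch)) (rly_x c i u yr)).

Definition chan_step (w : nat) (u : R) (i : nat) (yr : seq cpx) (z : noise) :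
    cpx * cpx :=
  (cadd (cscale (Num.sqrt (gC ch) * (1 - (rly_s c i u yr)%:R)) (enc c w i)) z.1,
   cadd (cadd (cscale (Num.sqrt (gS ch)) (enc c w i)) (relay_offset u i yr)) z.2).

(** The relay's maps are applied to the reference outputs themselves, so the message has disappeared
    from the recursion. *)
Definition chan_ref (u : R) (i : nat) (yr : seq cpx) (z : noise) : cpx * cpx :=
  simo_ref (Num.sqrt (gC ch) * (1 - (rly_s c i u yr)%:R)) (Num.sqrt (gS ch))
    (relay_offset u i yr) z.

Lemma dest_outE w u zs : dest_out ch c w u zs = outputs (chan_step w u) 0%N [::] zs.
Proof.
rewrite /dest_out; move: 0%N (Nil cpx); elim: zs => //= z zs IH i yr.
by congr (_ :: _); exact: IH.
Qed.

Lemma relay_powerE w u zs : \sum_(x <- relay_in ch c w u zs) cnorm2 x =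
  run_sum (chan_step w u) (fun i yr => cnorm2 (rly_x c i u yr)) 0%N [::] zs.
Proof.
rewrite /relay_in; move: 0%N (Nil cpx); elim: zs => [|z zs IH] i yr /=; first by rewrite big_nil.
by rewrite big_cons; congr (_ + _); exact: IH.
Qed.

Variable N : nat.
Hypothesis mc : forall i : nat, (i < N)%N ->
   measurable_fun setT (fun p : R * i.-tuple cpx => rly_x c i p.1 (tval p.2))
   /\ measurable [set p : R * i.-tuple cpx | rly_s c i p.1 (tval p.2)].

Lemma measurable_rly_s i : (i < N)%N ->
  measurable_fun setT (fun p : R * i.-tuple cpx => rly_s c i p.1 p.2).
Proof.
move=> iN; apply: (measurable_fun_bool true); rewrite setTI.
by have [_] := mc iN.
Qed.

Lemma measurable_rly_s_real i : (i < N)%N ->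
  measurable_fun setT (fun p : R * i.-tuple cpx => (rly_s c i p.1 p.2)%:R : R).
Proof.
move=> iN; rewrite (_ : (fun _ => _) =
  (fun p : R * i.-tuple cpx => if rly_s c i p.1 p.2 then 1 else 0)).
  by apply: measurable_fun_ifT => //; exact: measurable_rly_s.
by apply/funext => p; case: rly_s.
Qed.

Lemma measurable_relay_offset i : (i < N)%N ->
  measurable_fun setT (fun p : R * i.-tuple cpx => relay_offset p.1 i p.2).
Proof.
move=> iN; apply: measurable_cscale.
  by apply: measurable_funM => //; exact: measurable_rly_s_real.
by apply: measurable_cmul => //; have [] := mc iN.
Qed.

Lemma measurable_chan_step w : measurable_step N (chan_step w).
Proof.
move=> i iN; have ms := measurable_rly_s_real iN.
have ms1 := measurableT_comp ms
  (measurable_fst : measurable_fun setT (@fst (R * i.-tuple cpx) noise)).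
have mo := measurable_relay_offset iN.
have mo1 := measurableT_comp mo
  (measurable_fst : measurable_fun setT (@fst (R * i.-tuple cpx) noise)).
apply: measurable_fun_pair.
  apply: measurable_cadd; last by meas.
  apply: measurable_cscale => //; apply: measurable_funM => //.
  exact: measurable_funB.
apply: measurable_cadd; last by meas.
by apply: measurable_cadd.
Qed.

Lemma measurable_simo_ref d (P : measurableType d) k s (o : P -> cpx) (z : P -> noise) :
  measurable_fun setT o -> measurable_fun setT z ->
  measurable_fun setT (fun p => simo_ref k s (o p) (z p)).
Proof. by move=> mo mz; rewrite /simo_ref /cadd /cscale; meas. Qed.

Lemma measurable_chan_ref : measurable_step N chan_ref.
Proof.
move=> i iN.
have mf : measurable_fun setT (@fst (R * i.-tuple cpx) noise) by exact: measurable_fst.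
have mz : measurable_fun setT (@snd (R * i.-tuple cpx) noise) by exact: measurable_snd.
have mo := measurableT_comp (measurable_relay_offset iN) mf.
have ms := measurableT_comp (measurable_rly_s iN) mf.
(* The first coefficient of [simo_ref] takes two values only; splitting on the state makes it
   constant under the square roots and the quotient. *)
rewrite (_ : (fun _ => _) = (fun q : R * i.-tuple cpx * noise =>
  if rly_s c i q.1.1 q.1.2
  then simo_ref 0 (Num.sqrt (gS ch)) (relay_offset q.1.1 i q.1.2) q.2
  else simo_ref (Num.sqrt (gC ch)) (Num.sqrt (gS ch)) (relay_offset q.1.1 i q.1.2) q.2)).
  by apply: measurable_fun_ifT => //; exact: measurable_simo_ref.
apply/funext => q; rewrite /chan_ref.
by case: rly_s; rewrite ?subrr ?mulr0 ?subr0 ?mulr1.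
Qed.

Lemma measurable_causal_at (S : R -> nat -> seq cpx -> noise -> cpx * cpx) u :
  measurable_step N S -> measurable_causal N (S u).
Proof.
move=> mS i iN.
have m1 : measurable_fun setT (fun q : i.-tuple cpx * noise => (u, q.1, q.2)) by meas.
exact: (measurableT_comp (mS i iN) m1).
Qed.

Lemma measurable_past_fun_at (g : R -> nat -> seq cpx -> R) u :
  measurable_rate N g -> measurable_past_fun N (g u).
Proof. by move=> mg i iN; exact: (measurableT_comp (mg i iN) (measurable_pair1 u)). Qed.

End channel_dynamics.

Section expectation_over_noise_and_randomness.
Local Open Scope ereal_scope.
Context (R : realType).
Local Notation cpx := (R * R)%type.
Local Notation noise := (cpx * cpx)%type.
Variable N : nat.
Implicit Types F G : R -> seq noise -> \bar R.

Definition measurable_uz F :=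
  measurable_fun setT (fun q : R * N.-tuple noise => F q.1 q.2).

Lemma measurable_uz_at F u : measurable_uz F ->
  measurable_fun setT (fun t : N.-tuple noise => F u t).
Proof. by move=> mF; exact: (measurableT_comp mF (measurable_pair1 u)). Qed.

Lemma measurable_uz_EZ F (D : set (measurableTypeR R)) :
  measurable_uz F -> (forall u zs, 0 <= F u zs) ->
  measurable_fun D (fun u => EZ N (F u)).
Proof. by move=> mF F0; apply: measurable_funTS; exact: measurable_EZ. Qed.

Lemma EUZ_ge0 F : (forall u zs, 0 <= F u zs) -> 0 <= EUZ N F.
Proof. by move=> F0; apply: integral_ge0 => u _; exact: EZ_ge0. Qed.

Lemma EUZ_cst (k : \bar R) : EUZ N (fun _ _ => k) = k.
Proof.
rewrite /EUZ; under eq_integral do rewrite EZ_cst.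
rewrite integral_cst//= lebesgue_measure_itv/= lte_fin ltr01 -EFinB subr0.
by rewrite mule1.
Qed.

Lemma le_EUZ F G : measurable_uz F -> measurable_uz G ->
  (forall u zs, 0 <= F u zs) -> (forall u zs, 0 <= G u zs) ->
  (forall u zs, size zs = N -> F u zs <= G u zs) -> EUZ N F <= EUZ N G.
Proof.
move=> mF mG F0 G0 FG; apply: ge0_le_integral.
- exact: measurable_itv.
- by move=> u _; exact: EZ_ge0.
- exact: measurable_uz_EZ.
- exact: measurable_uz_EZ.
- move=> u _; apply: le_EZ; [exact: measurable_uz_at|exact: measurable_uz_at|
    exact: F0|exact: G0|exact: FG].
Qed.

Lemma EUZD F G : measurable_uz F -> measurable_uz G ->
  (forall u zs, 0 <= F u zs) -> (forall u zs, 0 <= G u zs) ->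
  EUZ N (fun u zs => F u zs + G u zs) = EUZ N F + EUZ N G.
Proof.
move=> mF mG F0 G0; rewrite /EUZ -ge0_integralD.
- apply: eq_integral => u _; apply: EZD;
    [exact: measurable_uz_at|exact: measurable_uz_at|exact: F0|exact: G0].
- exact: measurable_itv.
- by move=> u _; exact: EZ_ge0.
- exact: measurable_uz_EZ.
- by move=> u _; exact: EZ_ge0.
- exact: measurable_uz_EZ.
Qed.

Lemma EUZZl (k : \bar R) F : measurable_uz F ->
  (forall u zs, 0 <= F u zs) -> 0 <= k ->
  EUZ N (fun u zs => k * F u zs) = k * EUZ N F.
Proof.
move=> mF F0 k0; rewrite /EUZ -ge0_integralZl.
- apply: eq_integral => u _; apply: EZZl; [exact: measurable_uz_at|exact: F0|exact: k0].
- exact: measurable_itv.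
- exact: measurable_uz_EZ.
- by move=> u _; exact: EZ_ge0.
- exact: k0.
Qed.

(** The converse is proved for each value of the relay's private randomness and then averaged. *)
Lemma sum_EUZ_le1 (I : Type) (s : seq I) (F : I -> R -> seq noise -> \bar R) :
  (forall i, measurable_uz (F i)) -> (forall i u zs, 0 <= F i u zs) ->
  (forall u, \sum_(i <- s) EZ N (F i u) <= 1) -> \sum_(i <- s) EUZ N (F i) <= 1.
Proof.
move=> mF F0 F1.
have itv1 := EUZ_cst 1.
rewrite -itv1 /EUZ -ge0_integral_sum.
- apply: ge0_le_integral.
  + exact: measurable_itv.
  + by move=> u _; apply: sume_ge0 => i _; exact: EZ_ge0.
  + by apply: emeasurable_sum => i; exact: measurable_uz_EZ.
  + by rewrite (_ : (fun _ => _) = cst 1)//; apply/funext => u; rewrite EZ_cst.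
  + by move=> u _; rewrite EZ_cst; exact: F1.
- exact: measurable_itv.
- by move=> i; exact: measurable_uz_EZ.
- by move=> i u _; exact: EZ_ge0.
Qed.

End expectation_over_noise_and_randomness.

Section channel_functionals.
Context (R : realType).
Local Notation cpx := (R * R)%type.
Local Notation noise := (cpx * cpx)%type.
Variables (ch : hd_chan R) (c : hd_code R) (N : nat).

Definition decoded w (l : seq cpx) : R := (dec c l == w)%:R.

Lemma decoded_ge0 w l : 0 <= decoded w l. Proof. by rewrite ler0n. Qed.

Lemma sum_decoded_le1 M l : \sum_(w < M) decoded w l <= 1.
Proof.
rewrite /decoded; have [lM|Ml] := ltnP (dec c l) M.
  rewrite (bigD1 (Ordinal lM))//= eqxx big1 ?addr0// => i.
  by rewrite -val_eqE/= eq_sym => /negbTE ->.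
by rewrite big1// => i _; rewrite gtn_eqF// (leq_trans (ltn_ord i)).
Qed.

Hypothesis mc : forall i : nat, (i < N)%N ->
   measurable_fun setT (fun p : R * i.-tuple cpx => rly_x c i p.1 (tval p.2))
   /\ measurable [set p : R * i.-tuple cpx | rly_s c i p.1 (tval p.2)].
Hypothesis mdec : forall k : nat, measurable [set y : N.-tuple cpx | dec c (tval y) = k].

Lemma measurable_decoded w :
  measurable_fun setT (fun t : N.-tuple cpx => decoded w t).
Proof.
have mb : measurable_fun setT (fun t : N.-tuple cpx => dec c t == w).
  apply: (measurable_fun_bool true); rewrite setTI.
  rewrite (_ : _ @^-1` _ = [set y : N.-tuple cpx | dec c (tval y) = w])//.
  by apply/seteqP; split => y /= /eqP.
rewrite (_ : (fun _ => _) = (fun t : N.-tuple cpx => if dec c t == w then 1 else 0)).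
  by apply: measurable_fun_ifT.
by apply/funext => t; rewrite /decoded; case: eqP.
Qed.

Lemma measurable_relay_power w :
  measurable_uz N (fun u zs => (\sum_(x <- relay_in ch c w u zs) cnorm2 x)%:E).
Proof.
have m0 : measurable_fun setT (fun u : R => [tuple] : 0.-tuple cpx) by [].
have mr : measurable_rate N (fun u i yr => cnorm2 (rly_x c i u yr)).
  by move=> i iN; have [mx _] := mc iN; exact: measurable_cnorm2.
have m2 := @measurable_run_sum _ _ _ N N 0 (chan_step ch c w) (fun=> [tuple])
  _ (measurable_chan_step ch mc w) m0 (leqnn N) mr.
apply/measurable_EFinP; rewrite (_ : (fun _ => _) = (fun q : R * N.-tuple noise =>
  run_sum (chan_step ch c w q.1) (fun i yr => cnorm2 (rly_x c i q.1 yr)) 0 [::] q.2)) //.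
by apply/funext => q; rewrite relay_powerE.
Qed.

Lemma measurable_dec_error w :
  measurable_uz N (fun u zs => ((dec c (dest_out ch c w u zs) != w)%:R : R)%:E).
Proof.
have m0 : measurable_fun setT (fun u : R => [tuple] : 0.-tuple cpx) by [].
have m1 := @measurable_outputs _ _ _ N N 0 (chan_step ch c w) (fun=> [tuple])
  (fun=> decoded w) (measurable_chan_step ch mc w) m0 (leqnn N)
  (measurableT_comp (measurable_decoded w) measurable_snd).
apply/measurable_EFinP; rewrite (_ : (fun _ => _) = (fun q : R * N.-tuple noise =>
  1 - decoded w (outputs (chan_step ch c w q.1) 0 [::] q.2))%R).
  by apply: measurable_funB; [exact: measurable_cst|exact: m1].
apply/funext => q; rewrite dest_outE /decoded.
by case: eqP => _; rewrite ?subrr ?subr0.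
Qed.

End channel_functionals.

Section block_converse.
Context (R : realType).
Local Notation cpx := (R * R)%type.
Local Notation noise := (cpx * cpx)%type.
Variables (snr bsd brd bsr th : R).
Hypothesis (snr1 : 1 <= snr).

Let ch := HDChan (snr `^ bsr) (snr `^ bsd) (snr `^ brd) th.
Let L := ln snr.

Let L0 : 0 <= L. Proof. exact: ln_ge0. Qed.

Let snr0 : 0 < snr. Proof. exact: lt_le_trans ltr01 snr1. Qed.

Lemma powR_snr b : snr `^ b = expR (L * b).
Proof. by rewrite /powR gt_eqF// mulrC. Qed.

Variables (N : nat) (c : hd_code R).
Hypothesis mc : forall i : nat, (i < N)%N ->
   measurable_fun setT (fun p : R * i.-tuple cpx => rly_x c i p.1 (tval p.2))
   /\ measurable [set p : R * i.-tuple cpx | rly_s c i p.1 (tval p.2)].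
Hypothesis mdec : forall k : nat, measurable [set y : N.-tuple cpx | dec c (tval y) = k].

Definition slot_power w u i yr : R := cnorm2 (enc c w i) + cnorm2 (rly_x c i u yr).

(* [ln 6] is [ln 3], for the three terms of the determinant, plus [ln 2], the price
   of the mixture in the second cut. *)
Definition slot_cost (e0 e1 : R) w u i yr : R :=
  slot_power w u i yr + ln 6 + L * (if rly_s c i u yr then e1 else e0).

Lemma expR_slot_cost e0 e1 w u i yr : expR (slot_cost e0 e1 w u i yr) =
  6 * snr `^ (if rly_s c i u yr then e1 else e0) * expR (slot_power w u i yr).
Proof. by rewrite /slot_cost !expRD lnK ?posrE// powR_snr; ring. Qed.

Lemma le_snr a b : a <= b -> snr `^ a <= snr `^ b.
Proof. by move=> ab; rewrite !powR_snr ler_expR ler_wpM2l. Qed.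

Hypothesis (bsd0 : 0 <= bsd).

Lemma one_le_snr b : 0 <= b -> 1 <= snr `^ b.
Proof. by move=> b0; rewrite powR_snr -[leLHS]expR0 ler_expR mulr_ge0. Qed.

(** A transmitting relay receives pure noise, which reduces the determinant to [1 + S] and the
    exponent to [bsd]. *)
Lemma broadcast_cut w u i (yr : i.-tuple cpx) (H : cpx * cpx -> \bar R) :
  measurable_fun setT H -> (forall y, (0 <= H y)%E) ->
  (I4 (fun z => H (chan_step ch c w u i yr z)) <=
  (expR (slot_cost (Num.max bsr bsd) bsd w u i yr))%:E *
    I4 (fun z => H (chan_ref ch c u i yr z)))%E.
Proof.
move=> mH H0; have := I4_simo (Num.sqrt (gC ch) * (1 - (rly_s c i u yr)%:R))
  (Num.sqrt (gS ch)) (enc c w i) (relay_offset ch c u i yr) mH H0.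
move=> /le_trans; apply; apply: lee_wpmul2r; first by apply: I4_ge0 => z; exact: H0.
rewrite lee_fin expR_slot_cost /slot_power expRD mulrA -[leLHS]mulr1.
apply: ler_pM.
- by rewrite mulr_ge0 ?expR_ge0// !addr_ge0 ?sqr_ge0.
- by [].
- rewrite ler_pM2r ?expR_gt0//= exprMn !sqr_sqrtr ?powR_ge0//.
  have h1 := one_le_snr bsd0.
  case: rly_s => /=.
    by rewrite subrr expr0n/= mulr0 addr0; lra.
  have h2 : snr `^ bsr <= snr `^ Num.max bsr bsd by apply: le_snr; rewrite le_max lexx.
  have h3 : snr `^ bsd <= snr `^ Num.max bsr bsd by apply: le_snr; rewrite le_max lexx orbT.
  by rewrite subr0 expr1n mulr1; lra.
- by rewrite -[leLHS]expR0 ler_expR cnorm2_ge0.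
Qed.

Definition mac_scale (s : bool) : R :=
  Num.sqrt (1 + Num.sqrt (gS ch) ^+ 2 + (Num.sqrt (gI ch) * s%:R) ^+ 2).

Lemma mac_cut w u i (yr : i.-tuple cpx) (H : cpx -> \bar R) :
  measurable_fun setT H -> (forall y, (0 <= H y)%E) ->
  (I4 (fun z => H (chan_step ch c w u i yr z).2) <=
  (expR (slot_cost bsd (Num.max brd bsd) w u i yr) / 2)%:E *
    I4 (fun z => H (cscale (if rly_s c i u yr then mac_scale true else mac_scale false)
                           z.2)))%E.
Proof.
move=> mH H0.
rewrite (_ : (if rly_s c i u yr then mac_scale true else mac_scale false) =
  mac_scale (rly_s c i u yr)); last by case: rly_s.
have := I4_miso (Num.sqrt (gS ch)) (Num.sqrt (gI ch) * (rly_s c i u yr)%:R)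
  (enc c w i) (cmul (cexpj th) (rly_x c i u yr)) mH H0.
move=> /le_trans; apply; apply: lee_wpmul2r; first by apply: I4_ge0 => z; exact: H0.
rewrite lee_fin expR_slot_cost /slot_power cnorm2_rot mulrAC.
rewrite ler_pM2r ?expR_gt0//= exprMn !sqr_sqrtr ?powR_ge0//.
have h1 := one_le_snr bsd0.
have h2 : snr `^ brd <= snr `^ Num.max brd bsd by apply: le_snr; rewrite le_max lexx.
have h3 : snr `^ bsd <= snr `^ Num.max brd bsd by apply: le_snr; rewrite le_max lexx orbT.
by case: rly_s; rewrite /= ?expr1n ?expr0n/= ?mulr1 ?mulr0; lra.
Qed.

Lemma measurable_slot_cost e0 e1 w : measurable_rate N (slot_cost e0 e1 w).
Proof.
move=> i iN; have [mx _] := mc iN.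
have ms := measurable_rly_s mc iN.
rewrite /slot_cost /slot_power; apply: measurable_funD.
  apply: measurable_funD => //; apply: measurable_funD => //.
  exact: measurable_cnorm2.
apply: measurable_funM => //.
by apply: measurable_fun_ifT.
Qed.

(** Correct decoding, discounted by the cost of the run. For either cut the expectations of these
    weights sum to at most 1 over the messages, whatever their number. *)
Definition correct_weight e0 e1 w u zs : R :=
  decoded c w (outputs (chan_step ch c w u) 0 [::] zs) *
  expR (- run_sum (chan_step ch c w u) (slot_cost e0 e1 w u) 0 [::] zs).

Lemma correct_weight_ge0 e0 e1 w u zs : 0 <= correct_weight e0 e1 w u zs.
Proof. by rewrite mulr_ge0 ?decoded_ge0 ?expR_ge0. Qed.

Lemma measurable_correct_weight e0 e1 w :
  measurable_uz N (fun u zs => (correct_weight e0 e1 w u zs)%:E).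
Proof.
apply/measurable_EFinP.
have m0 : measurable_fun setT (fun u : R => [tuple] : 0.-tuple cpx) by [].
have N0 : (0 + N <= N)%N by [].
have m1 := @measurable_outputs _ _ _ N N 0 (chan_step ch c w) (fun=> [tuple])
  (fun=> decoded c w) (measurable_chan_step ch mc w) m0 N0
  (measurableT_comp (measurable_decoded mdec w) measurable_snd).
have m2 := @measurable_run_sum _ _ _ N N 0 (chan_step ch c w) (fun=> [tuple])
  (slot_cost e0 e1 w) (measurable_chan_step ch mc w) m0 N0 (measurable_slot_cost e0 e1 w).
apply: (measurable_funM m1); apply: (measurableT_comp (@measurable_expR R)).
exact: (measurable_funN m2).
Qed.

Lemma sum_broadcast_le1 M :
  (\sum_(w < M) EUZ N (fun u zs =>
     (correct_weight (Num.max bsr bsd) bsd w u zs)%:E) <= 1)%E.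
Proof.
apply: sum_EUZ_le1 => [w|w u zs|u].
- exact: measurable_correct_weight.
- by rewrite lee_fin correct_weight_ge0.
have mref := measurable_causal_at u (measurable_chan_ref ch mc).
apply: (@le_trans _ _ (\sum_(w < M) EZ N (fun zs =>
    (decoded c w (outputs (chan_ref ch c u) 0 [::] zs))%:E))%E).
  apply: lee_sum => w _.
  apply: (@EZ_weighted_outputs_le _ N N 0 [tuple]).
  - exact: measurable_causal_at (measurable_chan_step ch mc w).
  - exact: mref.
  - exact: measurable_past_fun_at (measurable_slot_cost _ _ w).
  - by move=> i yr H mH H0; exact: broadcast_cut.
  - by [].
  - exact: measurable_decoded.
  - exact: decoded_ge0.
have mo w := @measurable_outputs_tuple _ N N 0 _ _ [tuple] mref (leqnn N)
  (measurable_decoded mdec w).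
rewrite -EZ_sum; [|by move=> w; exact: mo|by move=> w zs; rewrite lee_fin decoded_ge0].
rewrite -[leRHS](EZ_cst N); apply: le_EZ.
- by apply: emeasurable_sum => w; exact: mo.
- exact: measurable_cst.
- by move=> zs; apply: sume_ge0 => w _; rewrite lee_fin decoded_ge0.
- by move=> zs; rewrite lee_fin.
- by move=> zs _; rewrite sumEFin lee_fin sum_decoded_le1.
Qed.

Lemma sum_mac_le1 M :
  (\sum_(w < M) EUZ N (fun u zs =>
     (correct_weight bsd (Num.max brd bsd) w u zs)%:E) <= 1)%E.
Proof.
apply: sum_EUZ_le1 => [w|w u zs|u].
- exact: measurable_correct_weight.
- by rewrite lee_fin correct_weight_ge0.
apply: (@le_trans _ _ (\sum_(w < M) EZ N (fun zs =>
    (mixture (mac_scale false) (mac_scale true) (decoded c w) zs)%:E))%E).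
  apply: lee_sum => w _.
  apply: (@EZ_weighted_mixture_le _ _ _ N N 0 [tuple] _ _ (fun i yr => rly_s c i u yr)).
  - exact: measurable_causal_at (measurable_chan_step ch mc w).
  - exact: measurable_past_fun_at (measurable_slot_cost _ _ w).
  - by move=> i yr H mH H0; exact: mac_cut.
  - by [].
  - exact: measurable_decoded.
  - exact: decoded_ge0.
have mo w : measurable_fun setT (fun t : N.-tuple noise =>
    (mixture (mac_scale false) (mac_scale true) (decoded c w) t)%:E).
  apply/measurable_EFinP.
  have m1 := @measurable_mixture _ (mac_scale false) (mac_scale true) _ unit N
    (fun=> decoded c w) (measurableT_comp (measurable_decoded mdec w) measurable_snd).
  exact: measurableT_comp m1 (measurable_pair1 tt).
have mix0 w zs : (0 <= (mixture (mac_scale false) (mac_scale true) (decoded c w) zs)%:E)%E.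
  by rewrite lee_fin mixture_ge0// => l; exact: decoded_ge0.
rewrite -EZ_sum; [|by move=> w; exact: mo|by move=> w zs; exact: mix0].
rewrite -[leRHS](EZ_cst N); apply: le_EZ.
- by apply: emeasurable_sum => w; exact: mo.
- exact: measurable_cst.
- by move=> zs; apply: sume_ge0 => w _; exact: mix0.
- by move=> zs; rewrite lee_fin.
- move=> zs _; rewrite sumEFin lee_fin; apply: sum_mixture_le1 => l.
  exact: sum_decoded_le1.
Qed.

End block_converse.

Section run_sum_identities.
Context (R : realType).
Local Notation cpx := (R * R)%type.
Local Notation noise := (cpx * cpx)%type.
Variable step : nat -> seq cpx -> noise -> cpx * cpx.
Implicit Types (f g : nat -> seq cpx -> R) (zs : seq noise).

Lemma run_sumD f g i yr zs : run_sum step (fun i yr => f i yr + g i yr) i yr zs =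
  run_sum step f i yr zs + run_sum step g i yr zs.
Proof.
elim: zs i yr => [|z zs IH] i yr /=; first by rewrite addr0.
by rewrite IH addrACA.
Qed.

Lemma run_sum_affine f (k m : R) (s : nat -> seq cpx -> bool) (e0 e1 : R) i yr zs :
  run_sum step (fun i yr => f i yr + k + m * (if s i yr then e1 else e0)) i yr zs =
  run_sum step f i yr zs + (size zs)%:R * k +
  m * ((size zs)%:R * e0 + (e1 - e0) * run_sum step (fun i yr => (s i yr)%:R) i yr zs).
Proof.
elim: zs i yr => [|z zs IH] i yr /=; first by ring.
by rewrite IH -natr1; case: (s i yr); rewrite /=; ring.
Qed.

Lemma run_sum_bool (s : nat -> seq cpx -> bool) i yr zs :
  0 <= run_sum step (fun i yr => (s i yr)%:R) i yr zs <= (size zs)%:R.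
Proof.
elim: zs i yr => [|z zs IH] i yr /=; first by rewrite lexx.
have /andP[h0 h1] := IH i.+1 (rcons yr (step i yr z).1).
by rewrite addr_ge0//= -natr1 addrC lerD//; case: (s i yr).
Qed.

Lemma run_sum_nopast (f : nat -> R) i yr zs :
  run_sum step (fun i _ => f i) i yr zs = \sum_(k < size zs) f (i + k)%N.
Proof.
elim: zs i yr => [|z zs IH] i yr /=; first by rewrite big_ord0.
rewrite big_ord_recl addn0 IH; congr (_ + _); apply: eq_bigr => k _.
by rewrite addSnnS.
Qed.

End run_sum_identities.

Section gdof_exponents.
Context (R : realType).
Implicit Types bsd brd bsr N n : R.

(* [n] is the number of slots in which the relay transmits. *)
Lemma cut_exponent_le bsd brd bsr N n : 0 <= n <= N ->
  let d := gdof_formula bsd brd bsr in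
  (N * bsd + (Num.max brd bsd - bsd) * n <= N * d) \/
  (N * Num.max bsr bsd + (bsd - Num.max bsr bsd) * n <= N * d).
Proof.
move=> /andP[n0 nN]; rewrite /= /gdof_formula.
have N0 : 0 <= N by exact: le_trans nN.
have [h1|h1] := ltP bsd bsr; have [h2|h2] := ltP bsd brd => /=; last 3 first.
- by left; rewrite subrr mul0r addr0.
- by right; rewrite subrr mul0r addr0 mulrC.
- by left; rewrite subrr mul0r addr0.
set a := brd - bsd; set b := bsr - bsd.
have a0 : 0 < a by rewrite subr_gt0.
have b0 : 0 < b by rewrite subr_gt0.
have ab0 : 0 < a + b by rewrite addr_gt0.
(* At [n = N * b / (a + b)] the two cut exponents coincide and equal [N * d]; the first one
   increases with [n] and the second one decreases. *)
have [h|h] := leP (n * (a + b)) (N * b).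
- left; rewrite (mulrDr N bsd) lerD2l mulrA ler_pdivlMr//.
  rewrite -mulrA [N * _]mulrCA; apply: ler_wpM2l; first exact: ltW.
  by [].
- right; have -> : bsr = b + bsd by rewrite /b subrK.
  have -> : bsd - (b + bsd) = - b by ring.
  have -> : N * (b + bsd) + - b * n = N * bsd + (N * b - b * n) by ring.
  rewrite (mulrDr N bsd) lerD2l mulrA ler_pdivlMr// -subr_ge0.
  have -> : N * (a * b) - (N * b - b * n) * (a + b) = b * (n * (a + b) - N * b) by ring.
  by rewrite mulr_ge0 ?ltW// subr_gt0.
Qed.
End gdof_exponents.

Section block_converse_conclusion.
Context (R : realType).
Local Notation cpx := (R * R)%type.
Local Notation noise := (cpx * cpx)%type.
Variables (snr bsd brd bsr th : R).
Hypothesis (snr1 : 1 <= snr) (bsd0 : 0 <= bsd).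
Let ch := HDChan (snr `^ bsr) (snr `^ bsd) (snr `^ brd) th.
Let L := ln snr.
Let d := gdof_formula bsd brd bsr.

Variables (N : nat) (c : hd_code R).
Hypothesis N0 : (0 < N)%N.

(** The [8] bounds the power per slot on the runs that are kept; the other terms are the cost of a
    slot when the cheaper cut has average exponent at most [d]. *)
Let K := expR (N%:R * (8 + ln 6 + L * d)).
Let weight := @correct_weight R snr bsd brd bsr th c.

Definition source_energy w : R := \sum_(i < N) cnorm2 (enc c w i).

(* Decoding fails, or the power exceeds eight times its budget (which Markov's
   inequality makes rare), or the weight of the cheaper cut is at least [K^-1]. *)
Lemma decoding_dichotomy w u (zs : seq noise) : size zs = N ->
  1 <= (dec c (dest_out ch c w u zs) != w)%:R +
       ((8 * N%:R)^-1 * source_energy w +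
        (8 * N%:R)^-1 * (\sum_(x <- relay_in ch c w u zs) cnorm2 x)) +
       K * (weight (Num.max bsr bsd) bsd w u zs + weight bsd (Num.max brd bsd) w u zs).
Proof.
move=> sz.
have K0 : 0 < K by exact: expR_gt0.
have w0 e0 e1 : 0 <= weight e0 e1 w u zs by exact: correct_weight_ge0.
have NR0 : 0 < N%:R :> R by rewrite ltr0n.
have N80 : 0 < 8 * N%:R :> R by rewrite mulr_gt0.
set X := source_energy w; set Y := \sum_(x <- _) _.
have X0 : 0 <= X by apply: sumr_ge0 => i _; exact: cnorm2_ge0.
have Y0 : 0 <= Y by apply: sumr_ge0 => i _; exact: cnorm2_ge0.
have V0 : 0 <= (8 * N%:R)^-1 :> R by rewrite invr_ge0 ltW.
have XY0 : 0 <= (8 * N%:R)^-1 * X + (8 * N%:R)^-1 * Y by rewrite addr_ge0 ?mulr_ge0.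
have [dw|dw] := eqVneq (dec c (dest_out ch c w u zs)) w; last first.
  rewrite /= -addrA lerDl; apply: addr_ge0 => //.
  by apply: mulr_ge0; [exact: ltW|exact: addr_ge0].
rewrite /= add0r; have [XY|XY] := leP (8 * N%:R) (X + Y).
  apply: (@le_trans _ _ ((8 * N%:R)^-1 * X + (8 * N%:R)^-1 * Y)).
    by rewrite -mulrDr mulrC ler_pdivlMr// mul1r.
  by rewrite lerDl; apply: mulr_ge0; [exact: ltW|exact: addr_ge0].
set step := chan_step ch c w u.
set n := run_sum step (fun i yr => (rly_s c i u yr)%:R) 0%N [::] zs.
have nN : 0 <= n <= N%:R by rewrite -sz; exact: run_sum_bool.
have TXY : run_sum step (slot_power c w u) 0%N [::] zs = X + Y.
  by rewrite /slot_power run_sumD run_sum_nopast sz -relay_powerE.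
have big e0 e1 : N%:R * e0 + (e1 - e0) * n <= N%:R * d ->
    1 <= K * weight e0 e1 w u zs.
  move=> he; rewrite /weight /correct_weight /decoded -dest_outE dw eqxx mul1r.
  rewrite -[leLHS]expR0 /K -expRD ler_expR subr_ge0.
  rewrite /slot_cost run_sum_affine sz -/n TXY.
  have h : L * (N%:R * e0 + (e1 - e0) * n) <= L * (N%:R * d).
    by apply: ler_wpM2l => //; exact: ln_ge0.
  rewrite -/L; nra.
have Kw e0 e1 : 0 <= K * weight e0 e1 w u zs by rewrite mulr_ge0// ltW.
rewrite mulrDr; apply: (@le_trans _ _ (K * weight (Num.max bsr bsd) bsd w u zs +
   K * weight bsd (Num.max brd bsd) w u zs)); last by rewrite lerDr.
case: (cut_exponent_le bsd brd bsr nN) => /big h.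
  by apply: (le_trans h); rewrite lerDr.
by apply: (le_trans h); rewrite lerDl.
Qed.

Local Open Scope ereal_scope.

(** Summing [decoding_dichotomy] over the [M] messages gives [M <= M / 4 + M / 8 + M / 8 + 2 * K]:
    the error, the source's power, the relay's power, and one unit of weight for each cut. The power
    cut-off [8] leaves half of [M] to be bounded by [2 * K]. *)
Lemma msgs_le : valid_code ch N c -> err_prob ch N c <= (4^-1)%:E ->
  ((msgs c)%:R <= 4 * K)%R.
Proof.
move=> [M0 mc mdec hX hY] herr.
set M := msgs c in M0 hX hY herr *.
have MR0 : (0 < M%:R :> R)%R by rewrite ltr0n.
have NR0 : (0 < N%:R :> R)%R by rewrite ltr0n.
have N80 : (0 < 8 * N%:R :> R)%R by rewrite mulr_gt0.
have V0 : (0 <= (8 * N%:R)^-1 :> R)%R by rewrite invr_ge0 ltW.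
have K0 : (0 < K)%R by exact: expR_gt0.
pose Ee w := EUZ N (fun u zs => ((dec c (dest_out ch c w u zs) != w)%:R : R)%:E).
pose Ey w := EUZ N (fun u zs => (\sum_(x <- relay_in ch c w u zs) cnorm2 x)%:E).
pose E2 w := EUZ N (fun u zs => (weight (Num.max bsr bsd) bsd w u zs)%:E).
pose E1 w := EUZ N (fun u zs => (weight bsd (Num.max brd bsd) w u zs)%:E).
have w0 e0 e1 w u zs : (0 <= (weight e0 e1 w u zs)%:E).
  by rewrite lee_fin correct_weight_ge0.
have mw e0 e1 w : measurable_uz N (fun u zs => (weight e0 e1 w u zs)%:E).
  exact: measurable_correct_weight.
have me w := measurable_dec_error ch mc mdec w.
have my w := measurable_relay_power ch mc w.
have y0 w u zs : 0 <= (\sum_(x <- relay_in ch c w u zs) cnorm2 x)%:E.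
  by rewrite lee_fin; apply: sumr_ge0 => i _; exact: cnorm2_ge0.
have e0 w u zs : 0 <= ((dec c (dest_out ch c w u zs) != w)%:R : R)%:E.
  by rewrite lee_fin ler0n.
have X0 w : (0 <= source_energy w)%R by apply: sumr_ge0 => i _; exact: cnorm2_ge0.
have onew w : 1 <= Ee w + (((8 * N%:R)^-1 * source_energy w)%:E +
    ((8 * N%:R)^-1)%:E * Ey w) + K%:E * (E2 w + E1 w).
  have mww : measurable_uz N (fun u zs =>
    (weight (Num.max bsr bsd) bsd w u zs)%:E + (weight bsd (Num.max brd bsd) w u zs)%:E).
    by apply: emeasurable_funD; exact: mw.
  have ww0 u zs : 0 <= (weight (Num.max bsr bsd) bsd w u zs)%:E +
    (weight bsd (Num.max brd bsd) w u zs)%:E by rewrite adde_ge0.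
  have EK : K%:E * (E2 w + E1 w) = EUZ N (fun u zs => K%:E *
    ((weight (Num.max bsr bsd) bsd w u zs)%:E + (weight bsd (Num.max brd bsd) w u zs)%:E)).
    rewrite (EUZZl mww ww0) ?lee_fin ?ltW//.
    by rewrite (EUZD (mw _ _ w) (mw _ _ w) (w0 _ _ w) (w0 _ _ w)).
  rewrite EK -(EUZ_cst N 1).
  have V0' : 0 <= ((8 * N%:R)^-1 : R)%:E by rewrite lee_fin.
  rewrite -(EUZZl (my w) (y0 w) V0').
  rewrite -(EUZ_cst N ((8 * N%:R)^-1 * source_energy w)%:E).
  have mx : measurable_uz N (fun (u : R) (zs : seq noise) =>
    ((8 * N%:R)^-1 * source_energy w)%:E) by exact: measurable_cst.
  have x0 (u : R) (zs : seq noise) : 0 <= ((8 * N%:R)^-1 * source_energy w)%:E.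
    by rewrite lee_fin mulr_ge0.
  have my' : measurable_uz N (fun u zs => ((8 * N%:R)^-1)%:E *
    (\sum_(x <- relay_in ch c w u zs) cnorm2 x)%:E).
    by apply: measurable_funeM; exact: my.
  have y0' u zs : 0 <= ((8 * N%:R)^-1)%:E * (\sum_(x <- relay_in ch c w u zs) cnorm2 x)%:E.
    by rewrite mule_ge0.
  have mw' : measurable_uz N (fun u zs => K%:E *
    ((weight (Num.max bsr bsd) bsd w u zs)%:E + (weight bsd (Num.max brd bsd) w u zs)%:E)).
    by apply: measurable_funeM; exact: mww.
  have w0' u zs : 0 <= K%:E *
    ((weight (Num.max bsr bsd) bsd w u zs)%:E + (weight bsd (Num.max brd bsd) w u zs)%:E).
    by rewrite mule_ge0// lee_fin ltW.
  have mxy := emeasurable_funD mx my'.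
  have xy0 u zs := adde_ge0 (x0 u zs) (y0' u zs).
  have mexy := emeasurable_funD (me w) mxy.
  have exy0 u zs := adde_ge0 (e0 w u zs) (xy0 u zs).
  rewrite -(EUZD mx my' x0 y0') -(EUZD (me w) mxy (e0 w) xy0).
  rewrite -(EUZD mexy mw' exy0 w0'); apply: le_EUZ.
  - exact: measurable_cst.
  - exact: (emeasurable_funD mexy mw').
  - by move=> u zs; rewrite lee_fin.
  - by move=> u zs; exact: (adde_ge0 (exy0 u zs) (w0' u zs)).
  - move=> u zs sz; have := decoding_dichotomy w u sz.
    by rewrite -lee_fin !(EFinD, EFinM).
have sum1 : M%:R%:E <= \sum_(w < M) (Ee w + (((8 * N%:R)^-1 * source_energy w)%:E +
    ((8 * N%:R)^-1)%:E * Ey w) + K%:E * (E2 w + E1 w)).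
  apply: (@le_trans _ _ (\sum_(w < M) 1%:E)); last by apply: lee_sum => w _; exact: onew.
  by rewrite sumEFin lee_fin sumr_const card_ord.
have Ee_le : \sum_(w < M) Ee w <= (M%:R / 4)%:E.
  by move: herr; rewrite /err_prob lee_pdivrMl// -EFinM.
have Ey_le : \sum_(w < M) Ey w <= (M * N)%:R%:E.
  by move: hY; rewrite lee_pdivrMl ?mule1// ltr0n muln_gt0 M0.
have X_le : (\sum_(w < M) source_energy w <= (M * N)%:R)%R.
  by move: hX; rewrite mulrC ler_pdivrMr ?mul1r// ltr0n muln_gt0 M0.
have E2_le : \sum_(w < M) E2 w <= 1 by exact: sum_broadcast_le1.
have E1_le : \sum_(w < M) E1 w <= 1 by exact: sum_mac_le1.
have Ee0 w : 0 <= Ee w by exact: EUZ_ge0.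
have Ey0 w : 0 <= Ey w by exact: EUZ_ge0.
have E20 w : 0 <= E2 w by exact: EUZ_ge0.
have E10 w : 0 <= E1 w by exact: EUZ_ge0.
clearbody Ee Ey E2 E1.
have KE : \sum_(w < M) K%:E * (E2 w + E1 w) =
    K%:E * (\sum_(w < M) E2 w + \sum_(w < M) E1 w).
  by rewrite -big_split ge0_sume_distrr// => w _; exact: adde_ge0.
have VE : \sum_(w < M) ((8 * N%:R)^-1)%:E * Ey w =
    ((8 * N%:R)^-1)%:E * \sum_(w < M) Ey w by rewrite ge0_sume_distrr.
have : M%:R%:E <= (M%:R / 4)%:E + (((8 * N%:R)^-1 * (M * N)%:R)%:E +
    ((8 * N%:R)^-1 * (M * N)%:R)%:E) + (K * (1 + 1))%:E.
  apply: (le_trans sum1); rewrite !big_split/= KE VE sumEFin -mulr_sumr.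
  apply: leeD; last first.
    by rewrite EFinM; apply: lee_wpmul2l; [rewrite lee_fin ltW|rewrite EFinD; exact: leeD].
  apply: leeD => //; apply: leeD.
    by rewrite lee_fin ler_wpM2l.
  by rewrite [leRHS]EFinM; apply: lee_wpmul2l.
rewrite -!EFinD lee_fin natrM.
have -> : ((8 * N%:R)^-1 * (M%:R * N%:R) = M%:R / 8 :> R)%R by field; rewrite gt_eqF.
lra.
Qed.

End block_converse_conclusion.

(** A single code of error at most 1/4 suffices, at any block length: the factor 4 in [msgs_le]
    costs [ln 4 / N], which is at most [ln 4], and only the coefficient of [ln snr] matters in the
    limit. *)
Lemma achievable_le (R : realType) (snr bsd brd bsr th r : R) :
  1 <= snr -> 0 <= bsd ->
  achievable (HDChan (snr `^ bsr) (snr `^ bsd) (snr `^ brd) th) r ->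
  r * ln 2 <= ln 4 + 8 + ln 6 + ln snr * gdof_formula bsd brd bsr.
Proof.
move=> snr1 bsd0 /(_ 4^-1 _ 0%N) [|N [c [_ N0 vc rM err]]]; first by rewrite invr_gt0.
have := msgs_le snr1 bsd0 N0 vc err.
move=> /(le_trans rM) h0.
have h : N%:R * r * ln 2 <= ln 4 + N%:R * (8 + ln 6 + ln snr * gdof_formula bsd brd bsr).
  rewrite -ler_expR expRD lnK ?posrE//; apply: le_trans h0.
  by rewrite /powR pnatr_eq0.
have NR1 : 1 <= N%:R :> R by rewrite ler1n.
have NR0 : 0 < N%:R :> R by rewrite ltr0n.
have l4 : 0 <= ln 4 :> R by rewrite ln_ge0// ler1n.
set A := 8 + ln 6 + _ in h.
have h2 : N%:R * (r * ln 2) <= N%:R * (ln 4 + A).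
  by rewrite mulrA (le_trans h)// (mulrDr N%:R (ln 4)) lerD2r ler_peMl.
move: h2; rewrite ler_pM2l// => h2; apply: (le_trans h2).
by rewrite /A !addrA.
Qed.

(** * Codes and threshold decoding *)

Section gilbert_varshamov.
Local Open Scope set_scope.
Local Open Scope nat_scope.
Variables (Q : finType) (n : nat).
Implicit Types (u v : {ffun 'I_n -> Q}) (D : {set 'I_n}).

Definition hamming u v := #|[set i | u i != v i]|.

Lemma hammingC u v : hamming u v = hamming v u.
Proof. by apply: eq_card => i; rewrite !inE eq_sym. Qed.

Let agree_off D u : {set {ffun 'I_n -> Q}} :=
  [set v in family (fun i : 'I_n => if i \in D then predT else pred1 (u i))].

Let card_agree_off D u : #|agree_off D u| = #|Q| ^ #|D|.
Proof.
rewrite cardsE card_family foldrE big_map -[enum _]/(enum 'I_n) big_enum/=.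
rewrite (bigID (fun i => i \in D))/= [X in _ * X]big1 ?muln1.
  rewrite (eq_bigr (fun=> #|Q|)) ?prod_nat_const// => i ->; exact: eq_card.
by move=> i /negbTE ->; rewrite card1.
Qed.

(** The ball is covered by the sets of words that agree with [u] off some [D] of size at most [r].
    Counting all [2 ^ n] sets costs one bit per slot, independently of the alphabet. *)
Lemma card_hamming_ball u r : 0 < #|Q| ->
  #|[set v | hamming u v <= r]| <= 2 ^ n * #|Q| ^ r.
Proof.
move=> Q0.
apply: (@leq_trans #|\bigcup_(D : {set 'I_n} | #|D| <= r) agree_off D u|).
  apply: subset_leq_card; apply/fintype.subsetP => v; rewrite inE => hv.
  apply/finset.bigcupP; exists [set i | u i != v i] => //.
  rewrite inE; apply/familyP => i; rewrite inE.
  by case: eqVneq => //= ->; rewrite inE.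
apply: (@leq_trans (\sum_(D : {set 'I_n} | #|D| <= r) #|Q| ^ r)).
  apply: (big_ind2 (fun (A : {set {ffun 'I_n -> Q}}) k => #|A| <= k)).
  - by rewrite cards0.
  - move=> A k B l Ak Bl; apply: (leq_trans (leq_card_setU A B)).
    exact: leq_add.
  - by move=> D Dr; rewrite card_agree_off leq_pexp2l.
rewrite sum_nat_const leq_mul2r; apply/orP; right.
rewrite -[X in _ ^ X](card_ord n) -cardsT -card_powerset.
by apply: subset_leq_card; apply/fintype.subsetP => D _; rewrite powersetE finset.subsetT.
Qed.

(** Greedy choice: as long as the balls around the chosen words do not cover the space, any
    uncovered word can be added. *)
Lemma gilbert_varshamov (M r : nat) : 0 < #|Q| ->
  M * (2 ^ n * #|Q| ^ r) <= #|Q| ^ n ->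
  exists cw : nat -> {ffun 'I_n -> Q}, forall w w', w < M -> w' < M -> w != w' ->
    r < hamming (cw w) (cw w').
Proof.
move=> Q0; have /card_gt0P[q _] := Q0.
have V0 : 0 < 2 ^ n * #|Q| ^ r by rewrite muln_gt0 !expn_gt0 Q0.
elim: M => [|M IH] hM; first by exists (fun=> [ffun=> q]).
have [|cw hcw] := IH; first by apply: leq_trans hM; rewrite leq_mul2r leqnSn orbT.
pose U := \bigcup_(w < M) [set v | hamming (cw w) v <= r].
have : #|U| < #|{ffun 'I_n -> Q}|.
  rewrite card_ffun card_ord; apply: leq_trans hM; rewrite mulSn -addn1 addnC.
  apply: leq_add => //; rewrite -[M in M * _](card_ord M) -sum_nat_const.
  apply: (big_ind2 (fun (A : {set {ffun 'I_n -> Q}}) k => #|A| <= k)).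
  - by rewrite cards0.
  - move=> A k B l Ak Bl; apply: (leq_trans (leq_card_setU A B)).
    exact: leq_add.
  - by move=> w _; exact: card_hamming_ball.
move=> hU; have [v vU] : exists v, v \notin U.
  apply/existsP; rewrite -negb_forall; apply: contraL hU => /forallP hU.
  by rewrite -leqNgt -cardsT; apply: subset_leq_card; apply/fintype.subsetP => v _.
exists (fun w => if w == M then v else cw w) => w w'; rewrite !ltnS.
have hv x : x < M -> r < hamming (cw x) v.
  move=> xM; rewrite ltnNge; apply: contra vU => hx.
  by apply/finset.bigcupP; exists (Ordinal xM); rewrite // inE.
rewrite leq_eqVlt => /predU1P[->|wM]; rewrite leq_eqVlt => /predU1P[->|w'M].
- by rewrite eqxx.
- by rewrite eqxx (ltn_eqF w'M) hammingC => _; exact: hv.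
- by rewrite eqxx (ltn_eqF wM) => _; exact: hv.
- by rewrite (ltn_eqF wM) (ltn_eqF w'M); exact: hcw.
Qed.
End gilbert_varshamov.

(* Decoders depend on the outputs through finitely many threshold tests only. *)
Lemma measurable_finitely_determined d (T : measurableType d) (I : finType)
    (b : I -> T -> bool) (U : Type) (f : T -> U) (A : set U) :
  (forall i, measurable [set t | b i t]) ->
  (forall t t', (forall i, b i t = b i t') -> f t = f t') ->
  measurable (f @^-1` A).
Proof.
move=> mb fb.
pose S := [set v : {ffun I -> bool} | exists2 t, A (f t) & forall i, b i t = v i].
have -> : f @^-1` A = \bigcup_(v in S) \bigcap_(i in [set: I]) [set t | b i t = v i].
  apply/seteqP; split => [t /= At|t [v [t' At' bt'] bt]] /=.
    exists [ffun i => b i t]; first by exists t => // i; rewrite ffunE.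
    by move=> i _ /=; rewrite ffunE.
  rewrite (fb t t') // => i; rewrite bt'; exact: bt.
apply: fin_bigcup_measurable; first exact: finite_finset.
move=> v _; apply: fin_bigcap_measurable; first exact: finite_finset.
move=> i _; case: (v i); first exact: mb.
rewrite (_ : [set t | b i t = false] = ~` [set t | b i t]).
  exact: measurableC.
by apply/seteqP; split => t /=; [move=> ->|move/negP/negbTE].
Qed.

Section threshold_decoding.
Context (R : realType).
Local Notation cpx := (R * R)%type.
Variable tau : R.
Implicit Types (m : nat -> cpx) (y : seq cpx).

Definition near_point (t : R) (x y : cpx) : bool :=
  (`|x.1 - y.1| <= t) && (`|x.2 - y.2| <= t).

(** Deviations are counted, not measured, so an outlier of any size costs the same. Only the first
    [n] entries of [y] are read, which lets the relay apply this to a longer past. *)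
Definition consistent e n m y : bool :=
  (count (fun i => ~~ near_point tau (nth (0, 0)%R y i) (m i)) (iota 0 n) <= e)%N.

(** The value is [M], not a message, if no message is consistent. *)
Definition first_consistent e n M (m : nat -> nat -> cpx) y : nat :=
  find (fun w => consistent e n (m w) y) (iota 0 M).

Lemma first_consistentP e n M (m : nat -> nat -> cpx) y w : (w < M)%N ->
  consistent e n (m w) y ->
  let w' := first_consistent e n M m y in (w' <= w)%N /\ consistent e n (m w') y.
Proof.
move=> wM cw /=; set P := fun w => consistent e n (m w) y.
have hP : has P (iota 0 M) by apply/hasP; exists w; rewrite // mem_iota.
have fM : (find P (iota 0 M) < M)%N by rewrite -[X in (_ < X)%N](size_iota 0) -has_find.
split; last by have := nth_find 0%N hP; rewrite nth_iota.
rewrite leqNgt; apply/negP => wf.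
by have := before_find 0%N wf; rewrite nth_iota// /P cw.
Qed.

Lemma near_point_triangle (x y z : cpx) : near_point tau x y -> near_point tau x z ->
  near_point (2 * tau) y z.
Proof.
have h (a b c : R) : `|a - b| <= tau -> `|a - c| <= tau -> `|b - c| <= 2 * tau.
  move=> h1 h2; have -> : b - c = (a - c) - (a - b) by ring.
  by apply: (le_trans (ler_normB _ _)); lra.
by move=> /andP[h1 h2] /andP[h3 h4]; apply/andP; split; [apply: h h3|apply: h h4].
Qed.

(** At a position where [y] is within [tau] of both means, they are within [2 * tau] of each other;
    the exceptional positions of the two messages add up. *)
Lemma consistent_close e n m m' y : consistent e n m y -> consistent e n m' y ->
  (count (fun i => ~~ near_point (2 * tau) (m i) (m' i)) (iota 0 n) <= 2 * e)%N.
Proof.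
rewrite /consistent; set a := fun i => _; set b := fun i => _ => ha hb.
rewrite mul2n -addnn; apply: leq_trans (leq_add ha hb).
rewrite -count_predUI; apply: leq_trans (leq_addr _ _).
apply: sub_count => i; rewrite /= -negb_and; apply: contra => /andP[].
exact: near_point_triangle.
Qed.

Lemma measurable_near_point d (T : measurableType d) (f : T -> cpx) (m : cpx) :
  measurable_fun setT f -> measurable [set t | near_point tau (f t) m].
Proof.
move=> mf; rewrite -[X in measurable X]setTI.
have h (g : T -> R) (a : R) : measurable_fun setT g ->
    measurable_fun setT (fun t => `|g t - a| <= tau).
  move=> mg; apply: measurable_fun_ler => //.
  apply: (measurableT_comp (@normr_measurable R setT)).
  exact: measurable_funB.
have : measurable_fun setT (fun t => near_point tau (f t) m).
  by apply: measurable_and; apply: h; [exact: (measurableT_comp measurable_fst mf)|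
    exact: (measurableT_comp measurable_snd mf)].
by move=> /(_ measurableT [set true]); apply.
Qed.

Lemma measurable_nth_tuple d (T : measurableType d) x0 n i :
  measurable_fun setT (fun t : n.-tuple T => nth x0 t i).
Proof.
have [ni|ni] := ltnP i n.
  rewrite (_ : (fun _ => _) = (fun t : n.-tuple T => tnth t (Ordinal ni))).
    exact: measurable_tnth.
  by apply/funext => t; rewrite (tnth_nth x0).
rewrite (_ : (fun _ => _) = cst x0)//.
by apply/funext => t; rewrite nth_default// size_tuple.
Qed.

Lemma measurable_first_consistent d (T : measurableType d) k (f : T -> k.-tuple cpx)
    e n M (m : nat -> nat -> cpx) (A : set nat) :
  measurable_fun setT f ->
  measurable ((fun t => first_consistent e n M m (f t)) @^-1` A).
Proof.
move=> mf; apply: (@measurable_finitely_determined _ _ ('I_M * 'I_n)%type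
  (fun p t => near_point tau (nth (0, 0)%R (f t) p.2) (m p.1 p.2))).
  move=> [w i] /=; apply: measurable_near_point.
  exact: (measurableT_comp (measurable_nth_tuple _ _) mf).
move=> t t' tt'; apply: eq_in_find => w; rewrite mem_iota add0n => /andP[_ wM].
rewrite /consistent; congr (_ <= _)%N; apply: eq_in_count => i.
rewrite mem_iota add0n => /andP[_ iN].
by rewrite (tt' (Ordinal wM, Ordinal iN)).
Qed.

End threshold_decoding.

(** * Number of symbols with large noise *)

Section noise_tail.
Context (R : realType).
Local Notation cpx := (R * R)%type.
Local Notation noise := (cpx * cpx)%type.
Variable tau : R.
Hypothesis tau0 : 0 <= tau.

Definition noise_energy (z : noise) : R := cnorm2 z.1 + cnorm2 z.2.

Definition small_noise (z : noise) : bool :=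
  near_point tau z.1 (0, 0) && near_point tau z.2 (0, 0).

Lemma noise_energy_ge0 z : 0 <= noise_energy z.
Proof. by rewrite addr_ge0 ?cnorm2_ge0. Qed.

Lemma large_noise_energy z : ~~ small_noise z -> tau ^+ 2 <= noise_energy z.
Proof.
have h (a : R) : ~~ (`|a - 0| <= tau) -> tau ^+ 2 <= a ^+ 2.
  rewrite subr0 -ltNge => /ltW ht; rewrite -(ger0_norm (sqr_ge0 a)) normrX.
  by rewrite lerXn2r ?nnegrE.
have s0 (a : R) : 0 <= a ^+ 2 := sqr_ge0 a.
rewrite /small_noise /near_point /noise_energy /cnorm2 !negb_and.
have := (s0 z.1.1, s0 z.1.2, s0 z.2.1, s0 z.2.2).
move: (h z.1.1) (h z.1.2) (h z.2.1) (h z.2.2) => h1 h2 h3 h4 [[[p1 p2] p3] p4].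
by move=> /orP[/orP[/h1|/h2]|/orP[/h3|/h4]]; lra.
Qed.

Lemma count_large_noise (zs : seq noise) :
  (count (predC small_noise) zs)%:R * tau ^+ 2 <= \sum_(z <- zs) noise_energy z.
Proof.
elim: zs => [|z zs IH]; first by rewrite big_nil mul0r.
rewrite big_cons /= natrD mulrDl; apply: lerD => //.
case sz : (small_noise z); first by rewrite mul0r noise_energy_ge0.
by rewrite mul1r large_noise_energy// sz.
Qed.

Lemma measurable_noise_energy : measurable_fun setT noise_energy.
Proof. by rewrite /noise_energy /cnorm2; meas. Qed.

Local Open Scope ereal_scope.

Lemma I4_expR_noise_energy :
  I4 (fun z : noise => (expR (noise_energy z / 2))%:E) = 4%:E.
Proof.
have mh : measurable_fun [set: R] (fun x : R => (expR (x ^+ 2 / 2))%:E).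
  by apply/measurable_EFinP; meas.
have h0 (x : R) : 0 <= (expR (x ^+ 2 / 2))%:E by rewrite lee_fin expR_ge0.
pose e x : R := expR (x ^+ 2 / 2).
have e0 x : (0 <= e x)%R by exact: expR_ge0.
pose q : R := Num.sqrt 2.
have q0 : (0 <= q)%R by exact: sqrtr_ge0.
have E k : (0 <= k)%R -> \int[@gauss_half R]_x (e x * k)%:E = (q * k)%:E.
  move=> k0; under eq_integral do rewrite EFinM.
  by rewrite (gauss_halfZr mh h0 k0) integral_gauss_half_expR -EFinM.
transitivity (I4 (fun z : noise => (e z.2.2 * (e z.2.1 * (e z.1.2 * e z.1.1)))%:E)).
  apply: eq_I4 => z; rewrite /e -!expRD /noise_energy /cnorm2; congr (expR _)%:E.
  by field.
have Ed (a b c : R) : \int[@gauss_half R]_d (e d * (e c * (e b * e a)))%:E =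
    (e c * (q * (e b * e a)))%:E.
  by rewrite E ?mulr_ge0//; congr (_%:E); ring.
have Ec (a b : R) : \int[@gauss_half R]_c \int[@gauss_half R]_d
    (e d * (e c * (e b * e a)))%:E = (e b * (q ^+ 2 * e a))%:E.
  transitivity (\int[@gauss_half R]_c (e c * (q * (e b * e a)))%:E).
    by apply: eq_integral => c _; exact: Ed.
  by rewrite E ?mulr_ge0//; congr (_%:E); ring.
have Eb (a : R) : \int[@gauss_half R]_b \int[@gauss_half R]_c \int[@gauss_half R]_d
    (e d * (e c * (e b * e a)))%:E = (e a * q ^+ 3)%:E.
  transitivity (\int[@gauss_half R]_b (e b * (q ^+ 2 * e a))%:E).
    by apply: eq_integral => b _; exact: Ec.
  by rewrite E ?mulr_ge0 ?exprn_ge0//; congr (_%:E); ring.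
rewrite I4E; transitivity (\int[@gauss_half R]_a (e a * q ^+ 3)%:E).
  by apply: eq_integral => a _; exact: Eb.
rewrite E ?exprn_ge0//; congr (_%:E).
by rewrite -exprS (_ : 4 = 2 * 2)%N// exprM sqr_sqrtr//; ring.
Qed.

Lemma EZ_expR_noise_energy n :
  EZ n (fun zs => (expR ((\sum_(z <- zs) noise_energy z) / 2))%:E) = (4 ^+ n)%:E.
Proof.
elim: n => [|n IH]; first by rewrite EZ0 big_nil mul0r expR0 expr0.
have me : measurable_fun setT (fun z : noise => (expR (noise_energy z / 2))%:E).
  apply/measurable_EFinP; apply: (measurableT_comp (@measurable_expR R)).
  by apply: measurable_funM => //; exact: measurable_noise_energy.
have ms : measurable_fun setT (fun t : n.-tuple noise =>
    (expR ((\sum_(z <- t) noise_energy z) / 2))%:E).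
  apply/measurable_EFinP; apply: (measurableT_comp (@measurable_expR R)).
  apply: measurable_funM => //.
  rewrite (_ : (fun _ => _) = (fun t : n.-tuple noise =>
      (\sum_(i < n) noise_energy (tnth t i))%R)).
    apply: measurable_sum => i.
    exact: (measurableT_comp measurable_noise_energy (measurable_tnth i)).
  by apply/funext => t; rewrite big_tuple.
rewrite EZS (@eq_I4 _ _ (fun z => (4 ^+ n)%:E * (expR (noise_energy z / 2))%:E)).
  rewrite I4Zl; [|exact: me|by move=> z; rewrite lee_fin expR_ge0|].
    by rewrite I4_expR_noise_energy -EFinM exprSr.
  by rewrite lee_fin exprn_ge0.
move=> z; rewrite -IH muleC -EZZl; last 3 first.
- exact: ms.
- by move=> zs; rewrite lee_fin expR_ge0.
- by rewrite lee_fin expR_ge0.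
by apply: eq_EZ => zs _; rewrite big_cons mulrDl expRD EFinM.
Qed.

End noise_tail.

(** * Achievability *)

Section two_phase_code.
Context (R : realType).
Local Notation cpx := (R * R)%type.
Local Notation noise := (cpx * cpx)%type.
Variables (ch : hd_chan R) (N1 N M e : nat) (tau : R) (xs xr : nat -> nat -> cpx).
Hypotheses (tau0 : 0 < tau) (N1N : (N1 <= N)%N).

Definition relay_mean w i : cpx := cscale (Num.sqrt (gC ch)) (xs w i).

Definition dest_mean w i : cpx :=
  if (i < N1)%N then cscale (Num.sqrt (gS ch)) (xs w i)
  else cadd (cscale (Num.sqrt (gS ch)) (xs w i))
            (cscale (Num.sqrt (gI ch)) (cmul (cexpj (theta ch)) (xr w i))).

(** The relay listens for the first [N1] slots; afterwards its past has length at least [N1], and it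
    sends the symbols of the message it decodes from that prefix. The means in [dest_mean] suppose
    that it forwards the right symbols. *)
Definition two_phase_code : hd_code R := HDCode M xs
  (fun i _ y => if (N1 <= i)%N
                then xr (first_consistent tau e N1 M relay_mean y) i else (0, 0))
  (fun i _ _ => (N1 <= i)%N)
  (first_consistent tau e N M dest_mean).

(** The relay may confuse messages for which it would send the same symbols: the coarse codewords
    extend over all [N] slots and need not be resolved after [N1] of them. *)
Hypothesis relay_separation : forall w w', (w < M)%N -> (w' < M)%N ->
  (count (fun i => ~~ near_point (2 * tau) (relay_mean w i) (relay_mean w' i)) (iota 0 N1)
     <= 2 * e)%N -> xr w =1 xr w'.
Hypothesis dest_separation : forall w w', (w < M)%N -> (w' < M)%N -> w != w' ->
  (2 * e < count (fun i => ~~ near_point (2 * tau) (dest_mean w i) (dest_mean w' i))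
     (iota 0 N))%N.
Hypothesis xs_power : forall w i, cnorm2 (xs w i) <= 1.
Hypothesis xr_power : forall w i, cnorm2 (xr w i) <= 1.

Let z0 : noise := ((0, 0), (0, 0)).

Lemma near_point_add (m z : cpx) : near_point tau z (0, 0) -> near_point tau (cadd m z) m.
Proof. by rewrite /near_point /cadd/= !subr0 !(addrAC _ _ (- _)) !subrr !add0r. Qed.

Section good_noise.
Variables (w : nat) (u : R) (zs : seq noise).
Hypotheses (wM : (w < M)%N) (szs : size zs = N)
  (good : (count (predC (small_noise tau)) zs <= e)%N).

Let count_iota (n : nat) (P : nat -> bool) : (n <= N)%N ->
  (forall i, (i < n)%N -> P i -> ~~ small_noise tau (nth z0 zs i)) ->
  (count P (iota 0 n) <= e)%N.
Proof.
move=> nN hP; apply: leq_trans good.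
rewrite -[X in (_ <= count _ X)%N](mkseq_nth z0) szs /mkseq count_map.
rewrite -(subnKC nN) iotaD count_cat; apply: leq_trans (leq_addr _ _).
rewrite -(@eq_in_count _ (fun i => P i && (i < n)%N)); last first.
  by move=> i; rewrite mem_iota add0n => /andP[_ ->]; rewrite andbT.
apply: sub_count => i /andP[Pi iltn]; exact: hP.
Qed.

Lemma relay_consistent (y : seq cpx) :
  (forall j, (j < N1)%N -> nth (0, 0) y j = cadd (relay_mean w j) (nth z0 zs j).1) ->
  xr (first_consistent tau e N1 M relay_mean y) =1 xr w.
Proof.
move=> hy.
have cw : consistent tau e N1 (relay_mean w) y.
  apply: count_iota => // i iN; rewrite hy//; apply: contra => /andP[h _].
  exact: near_point_add.
have [w'w cw'] := first_consistentP wM cw.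
apply: relay_separation => //; first exact: leq_ltn_trans wM.
exact: consistent_close cw' cw.
Qed.

(** The invariant on [yr] concerns the slots before [N1] only, the ones in which the relay hears the
    source; it is what makes the forwarded symbols correct later. *)
Lemma outputs_two_phase n i (yr : seq cpx) : (i + n)%N = N -> size yr = i ->
  (forall j, (j < i)%N -> (j < N1)%N ->
     nth (0, 0) yr j = cadd (relay_mean w j) (nth z0 zs j).1) ->
  outputs (chan_step ch two_phase_code w u) i yr (drop i zs) =
  [seq cadd (dest_mean w j) (nth z0 zs j).2 | j <- iota i n].
Proof.
elim: n i yr => [|n IH] i yr iN syr hyr.
  by rewrite drop_oversize// szs -iN addn0.
have iltN : (i < N)%N by rewrite -iN addnS ltnS leq_addr.
rewrite (drop_nth z0) ?szs//=; congr (_ :: _).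
  congr (cadd _ _); rewrite /dest_mean /relay_offset /=.
  case: ltnP => iN1 /=.
    by rewrite /cadd /cscale /= !mulr0 !mul0r !addr0.
  rewrite mulr1 relay_consistent// => j jN1.
  by apply: hyr => //; exact: leq_trans iN1.
apply: IH; first by rewrite addSnnS.
  by rewrite size_rcons syr.
move=> j; rewrite ltnS leq_eqVlt => /predU1P[->|ji] jN1; last first.
  by rewrite nth_rcons syr ji hyr.
by rewrite nth_rcons syr ltnn eqxx leqNgt jN1/= subr0 mulr1.
Qed.

Lemma dec_two_phase : dec two_phase_code (dest_out ch two_phase_code w u zs) = w.
Proof.
rewrite dest_outE -[zs in outputs _ _ _ zs]drop0 (@outputs_two_phase N)//.
set y := map _ _; rewrite /two_phase_code /=.
have hy j : (j < N)%N -> nth (0, 0) y j = cadd (dest_mean w j) (nth z0 zs j).2.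
  by move=> jN; rewrite (nth_map 0%N) ?size_iota// nth_iota.
have cw : consistent tau e N (dest_mean w) y.
  apply: count_iota => // i iN; rewrite hy//; apply: contra => /andP[_ h].
  exact: near_point_add.
have [w'w cw'] := first_consistentP wM cw.
apply/eqP; apply: contraT => ne.
have := dest_separation (leq_ltn_trans w'w wM) wM ne.
by rewrite ltnNge (consistent_close cw' cw).
Qed.

End good_noise.

Lemma two_phase_measurable i : (i < N)%N ->
  measurable_fun setT (fun p : R * i.-tuple cpx => rly_x two_phase_code i p.1 (tval p.2))
  /\ measurable [set p : R * i.-tuple cpx | rly_s two_phase_code i p.1 (tval p.2)].
Proof.
move=> iN /=; case: (N1 <= i)%N; split.
- move=> _ A _; rewrite setTI.
  exact: (measurable_first_consistent tau e N1 M relay_mean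
    (xr ^~ i @^-1` A) measurable_snd).
- by rewrite (_ : [set _ | _] = setT)//; apply/seteqP; split.
- exact: measurable_cst.
- by rewrite (_ : [set _ | _] = set0)//; apply/seteqP; split.
Qed.

Lemma two_phase_measurable_dec k :
  measurable [set y : N.-tuple cpx | dec two_phase_code (tval y) = k].
Proof.
exact: (measurable_first_consistent tau e N M dest_mean [set k] (@measurable_id _ _ setT)).
Qed.

Hypotheses (M0 : (0 < M)%N) (N0 : (0 < N)%N).

Lemma two_phase_valid : valid_code ch N two_phase_code.
Proof.
have MN0 : 0 < (M * N)%:R :> R by rewrite ltr0n muln_gt0 M0.
split => //=.
- exact: two_phase_measurable.
- exact: two_phase_measurable_dec.
- rewrite mulrC ler_pdivrMr// mul1r natrM.
  rewrite -[M in M%:R](card_ord M) mulr_natl -sumr_const; apply: ler_sum => w _.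
  rewrite -[N in N%:R](card_ord N) -sumr_const; apply: ler_sum => i _.
  exact: xs_power.
rewrite lee_pdivrMl// mule1 natrM -[M in M%:R](card_ord M) mulr_natl -sumr_const -sumEFin.
apply: lee_sum => w _; rewrite -(EUZ_cst N N%:R%:E); apply: le_EUZ.
- exact: measurable_relay_power two_phase_measurable _.
- exact: measurable_cst.
- by move=> u zs; rewrite lee_fin; apply: sumr_ge0 => i _; exact: cnorm2_ge0.
- by move=> u zs; rewrite lee_fin.
move=> u zs szs; rewrite lee_fin relay_powerE -szs.
move: 0%N (Nil cpx); elim: zs {szs} => [|z zs IH] i yr //.
rewrite [size _]/= -natr1 addrC; apply: lerD; last exact: IH.
by rewrite /=; case: ifP => _ //; rewrite /cnorm2/= expr0n addr0.
Qed.

(** Decoding fails only if more than [e] symbols are noisy, hence if the noise energy is at least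
    [tau ^+ 2 * e.+1]. By the Chernoff bound this has probability at most [8 ^- N * 4 ^+ N], where 4
    is the exponential moment of one slot. *)
Lemma two_phase_err (delta : R) : delta * N%:R <= e.+1%:R ->
  ln 8 <= tau ^+ 2 * delta / 2 ->
  (err_prob ch N two_phase_code <= ((2 ^+ N)^-1)%:E)%E.
Proof.
move=> hdelta htau.
have MR0 : 0 < M%:R :> R by rewrite ltr0n.
rewrite /err_prob (_ : msgs two_phase_code = M)// lee_pdivrMl// -EFinM.
rewrite -[M in M%:R](card_ord M) mulr_natl -sumr_const -sumEFin.
apply: lee_sum => w _.
pose b := expR (- (tau ^+ 2 * e.+1%:R / 2)).
have b0 : 0 <= b by exact: expR_ge0.
have mE : measurable_uz N (fun (u : R) zs =>
    (expR ((\sum_(z <- zs) noise_energy z) / 2))%:E).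
  apply/measurable_EFinP; apply: (measurableT_comp (@measurable_expR R)).
  apply: measurable_funM => //.
  rewrite (_ : (fun _ => _) = (fun q : R * N.-tuple noise =>
      \sum_(i < N) noise_energy (tnth q.2 i))).
    apply: measurable_sum => i; apply: (measurableT_comp (@measurable_noise_energy R)).
    exact: (measurableT_comp (measurable_tnth i) measurable_snd).
  by apply/funext => q; rewrite big_tuple.
have E0 (u : R) (zs : seq noise) : (0 <= (expR ((\sum_(z <- zs) noise_energy z) / 2))%:E)%E.
  by rewrite lee_fin expR_ge0.
apply: (@le_trans _ _ (EUZ N (fun (u : R) zs =>
    b%:E * (expR ((\sum_(z <- zs) noise_energy z) / 2))%:E))%E).
  apply: le_EUZ.
  - exact: (measurable_dec_error ch two_phase_measurable two_phase_measurable_dec w).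
  - exact: measurable_funeM.
  - by move=> u zs; rewrite lee_fin ler0n.
  - by move=> u zs; rewrite mule_ge0.
  move=> u zs szs; rewrite -EFinM lee_fin -expRD.
  have [good|bad] := leqP (count (predC (small_noise tau)) zs) e.
    by rewrite dec_two_phase// eqxx expR_ge0.
  apply: (@le_trans _ _ 1); first by case: (_ != _).
  rewrite -[leLHS]expR0 ler_expR addrC subr_ge0 ler_pM2r//.
  apply: le_trans (count_large_noise (ltW tau0) zs).
  by rewrite mulrC ler_wpM2r ?sqr_ge0// ler_nat.
rewrite EUZZl// /EUZ; under eq_integral do rewrite EZ_expR_noise_energy.
rewrite integral_cst//= lebesgue_measure_itv/= lte_fin ltr01 -EFinB subr0 mule1.
rewrite -EFinM lee_fin.
have -> : (2 ^+ N)^-1 = (expR (- ln 8) * 4) ^+ N :> R.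
  rewrite expRN lnK ?posrE// -exprVn; congr (_ ^+ N); by field.
rewrite exprMn ler_wpM2r ?exprn_ge0// -expRM_natl ler_expR mulrN lerN2.
apply: (@le_trans _ _ (N%:R * (tau ^+ 2 * delta / 2))).
  by rewrite ler_wpM2l.
have -> : N%:R * (tau ^+ 2 * delta / 2) = tau ^+ 2 * (delta * N%:R) / 2 by ring.
by rewrite ler_pM2r// ler_wpM2l// sqr_ge0.
Qed.

End two_phase_code.

(** The alphabet consists of pairs, one digit for each real coordinate. The size condition is
    required only for [1 < M], so that a one-message code exists even over a trivial alphabet.
    Outside the block the codewords are extended by [(0, 0)]. *)
Lemma exists_spread_code (q n r M : nat) : (0 < q)%N ->
  ((1 < M)%N -> (M * (2 ^ n * (q * q) ^ r) <= (q * q) ^ n)%N) ->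
  exists cw : nat -> nat -> nat * nat,
    (forall w i, ((cw w i).1 < q)%N && ((cw w i).2 < q)%N) /\
    (forall w w', (w < M)%N -> (w' < M)%N -> w != w' ->
       (r < count (fun i => cw w i != cw w' i) (iota 0 n))%N).
Proof.
move=> q0 hM; have [M1|/hM {}hM] := leqP M 1.
  exists (fun _ _ => (0, 0)%N); split => [w i|w w' wM w'M]; first by rewrite /= q0.
  move: (leq_trans wM M1) (leq_trans w'M M1).
  by rewrite !ltnS !leqn0 => /eqP -> /eqP ->; rewrite eqxx.
have cQ : #|{: 'I_q * 'I_q}| = (q * q)%N by rewrite card_prod card_ord.
have [|| cw hcw] := @gilbert_varshamov ('I_q * 'I_q)%type n M r.
- by rewrite cQ muln_gt0 q0.
- by rewrite cQ.
exists (fun w i => if insub i is Some j then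
    (nat_of_ord (cw w j).1, nat_of_ord (cw w j).2) else (0, 0)%N); split.
  by move=> w i; case: insub => [j|] /=; rewrite ?q0// !ltn_ord.
move=> w w' wM w'M ww'; apply: leq_trans (hcw _ _ wM w'M ww') _.
rewrite /hamming cardE size_filter -val_enum_ord count_map.
rewrite -enumT; apply: sub_count => i /=; rewrite finset.in_set valK.
apply: contraNN => /eqP[h1 h2].
by apply/eqP; rewrite [LHS]surjective_pairing [RHS]surjective_pairing;
  congr (_, _); exact: val_inj.
Qed.

(** * Nested constellations *)

Section constellation.
Context (R : realType).
Local Notation cpx := (R * R)%type.

Lemma far_point (t : R) (x y : cpx) :
  t < `|x.1 - y.1| \/ t < `|x.2 - y.2| -> ~~ near_point t x y.
Proof. by rewrite /near_point negb_and -!ltNge => /orP. Qed.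

Lemma dist_nat_ge1 (k k' : nat) : k != k' -> 1 <= `|k%:R - k'%:R| :> R.
Proof.
wlog kk' : k k' / (k < k')%N.
  move=> h; case: (ltngtP k k') => // kk' _; last by rewrite distrC h// ltn_eqF.
  by rewrite h// ltn_eqF.
move=> _; rewrite distrC ger0_norm; last by rewrite subr_ge0 ler_nat ltnW.
by rewrite lerBrDr nat1r ler_nat.
Qed.

Lemma pair_neq (p p' : nat * nat) : p != p' -> p.1 != p'.1 \/ p.2 != p'.2.
Proof.
by move=> h; apply/orP; rewrite -negb_and; apply: contra h; case: p p' => a b [a' b'].
Qed.

Lemma cmul_cexpjN (th : R) (x : cpx) : cmul (cexpj th) (cmul (cexpj (- th)) x) = x.
Proof.
rewrite /cmul /cexpj /= cosN sinN [RHS]surjective_pairing.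
have h := cos2Dsin2 th.
congr (_, _).
  transitivity ((cos th ^+ 2 + sin th ^+ 2) * x.1); first by ring.
  by rewrite h mul1r.
transitivity ((cos th ^+ 2 + sin th ^+ 2) * x.2); first by ring.
by rewrite h mul1r.
Qed.

(* [q1] coarse levels [k1], each split into [q2] fine levels [k2], spread over
   [[0, 1/2]] so that a pair of them has power at most 1. *)
Definition level (q1 q2 k1 k2 : nat) : R := (q2 * k1 + k2)%:R / (2 * (q1 * q2)%:R).

Section levels.
Variables (q1 q2 : nat).
Hypotheses (q10 : (0 < q1)%N) (q20 : (0 < q2)%N).

Let den0 : 0 < 2 * (q1 * q2)%:R :> R.
Proof. by rewrite mulr_gt0// ltr0n muln_gt0 q10. Qed.

Let norm_den : `|(2 * (q1 * q2)%:R)^-1| = (2 * (q1 * q2)%:R)^-1 :> R.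
Proof. by rewrite ger0_norm// invr_ge0 ltW. Qed.

Lemma level_ge0 k1 k2 : 0 <= level q1 q2 k1 k2.
Proof. by rewrite divr_ge0// ltW. Qed.

Lemma level_le k1 k2 : (k1 < q1)%N -> (k2 < q2)%N -> level q1 q2 k1 k2 <= 2^-1.
Proof.
move=> h1 h2; rewrite /level ler_pdivrMr// mulKf// ler_nat.
apply: (@leq_trans (q2 * k1.+1)); first by rewrite mulnS addnC leq_add2r ltnW.
by rewrite mulnC leq_mul2r h1 orbT.
Qed.

(** The fine digit is the residue of the numerator modulo [q2], so distinct fine digits give
    distinct levels whatever the coarse digits are. *)
Lemma level_fine k1 k2 k1' k2' : (k2 < q2)%N -> (k2' < q2)%N -> k2 != k2' ->
  (2 * (q1 * q2)%:R)^-1 <= `|level q1 q2 k1 k2 - level q1 q2 k1' k2'|.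
Proof.
move=> h h' ne; rewrite /level -mulrBl normrM norm_den.
rewrite ler_peMl ?invr_ge0 ?(ltW den0)// dist_nat_ge1//.
apply: contra ne => /eqP /(congr1 (modn^~ q2)).
by rewrite !(mulnC q2) !modnMDl !modn_small// => ->.
Qed.

Lemma level_coarse k1 k1' k2 : k1 != k1' ->
  (2 * q1%:R)^-1 <= `|level q1 q2 k1 k2 - level q1 q2 k1' k2|.
Proof.
move=> ne; rewrite /level -mulrBl normrM norm_den.
rewrite !natrD opprD addrACA subrr addr0 !natrM -mulrBr normrM ger0_norm//.
have := dist_nat_ge1 ne; set D := `|_| => D1.
have q1R : 0 < q1%:R :> R by rewrite ltr0n.
have q2R : 0 < q2%:R :> R by rewrite ltr0n.
have -> : q2%:R * D / (2 * (q1%:R * q2%:R)) = D / (2 * q1%:R).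
  by field; rewrite !gt_eqF.
by rewrite ler_peMl// invr_ge0 mulr_ge0.
Qed.

End levels.
End constellation.

Lemma leq_count_in (T : eqType) (s : seq T) (P Q : pred T) :
  {in s, forall x, P x -> Q x} -> (count P s <= count Q s)%N.
Proof.
elim: s => //= x s IH h; apply: leq_add; last first.
  by apply: IH => y ys; apply: h; rewrite inE ys orbT.
by have := h x (mem_head x s); case: (P x) => // ->.
Qed.

Section superposition_code.
Context (R : realType).
Local Notation cpx := (R * R)%type.
Variables (C S I th tau : R) (N1 N2 e q1 q2 q3 M1 M2 : nat).
Let N := (N1 + N2)%N.
Let ch := HDChan C S I th.
Hypotheses (tau0 : 0 < tau) (q10 : (0 < q1)%N) (q20 : (0 < q2)%N) (q30 : (0 < q3)%N)
  (M20 : (0 < M2)%N).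
(** Received spacings must exceed [2 * tau]: [sqrt S / (2 * q1)] for the coarse stream,
    [sqrt C / (2 * q1 * q2)] for the fine one. The relay's spacing [sqrt I / (2 * q3)] must also
    exceed the full range [sqrt S / 2] of the source. A one-letter alphabet needs no gain. *)
Hypothesis gain1 : (1 < q1)%N -> 4 * tau * q1%:R < Num.sqrt S.
Hypothesis gain2 : (1 < q2)%N -> 4 * tau * (q1 * q2)%:R < Num.sqrt C.
Hypothesis gain3 : (1 < q3)%N -> q3%:R * (Num.sqrt S + 4 * tau) < Num.sqrt I.

Variables (cA cB cC : nat -> nat -> nat * nat).
Hypothesis cA_lt : forall w i, ((cA w i).1 < q1)%N && ((cA w i).2 < q1)%N.
Hypothesis cB_lt : forall w i, ((cB w i).1 < q2)%N && ((cB w i).2 < q2)%N.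
Hypothesis cC_lt : forall w i, ((cC w i).1 < q3)%N && ((cC w i).2 < q3)%N.
Hypothesis cA_dist : forall w w', (w < M1)%N -> (w' < M1)%N -> w != w' ->
  (2 * e < count (fun i => cA w i != cA w' i) (iota 0 N))%N.
Hypothesis cB_dist : forall w w', (w < M2)%N -> (w' < M2)%N -> w != w' ->
  (2 * e < count (fun i => cB w i != cB w' i) (iota 0 N1))%N.
Hypothesis cC_dist : forall w w', (w < M2)%N -> (w' < M2)%N -> w != w' ->
  (2 * e < count (fun i => cC w i != cC w' i) (iota 0 N2))%N.

(** A message is a pair: [w %/ M2] is its coarse part and [w %% M2] its fine part. While the relay
    transmits, the source sends the coarse stream alone. *)
Definition fine_digit w i : nat * nat :=
  if (i < N1)%N then cB (w %% M2)%N i else (0, 0)%N.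

Definition source_symbol w i : cpx :=
  (level R q1 q2 (cA (w %/ M2)%N i).1 (fine_digit w i).1,
   level R q1 q2 (cA (w %/ M2)%N i).2 (fine_digit w i).2).

Definition relay_level w i : cpx :=
  (level R q3 1 (cC (w %% M2)%N (i - N1)%N).1 0,
   level R q3 1 (cC (w %% M2)%N (i - N1)%N).2 0).

(** The rotation by [- th] undoes the phase of the channel, so that the levels arrive aligned with
    the axes. *)
Definition relay_symbol w i : cpx := cmul (cexpj (- th)) (relay_level w i).

Let fine_lt w i : ((fine_digit w i).1 < q2)%N && ((fine_digit w i).2 < q2)%N.
Proof. by rewrite /fine_digit; case: ifP => _; [exact: cB_lt|rewrite /= q20]. Qed.

Lemma cnorm2_level_le (x : cpx) : 0 <= x.1 <= 2^-1 -> 0 <= x.2 <= 2^-1 -> cnorm2 x <= 1.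
Proof. by rewrite /cnorm2 => /andP[h1 h2] /andP[h3 h4]; nra. Qed.

Let source_range w i : (0 <= (source_symbol w i).1 <= 2^-1) &&
  (0 <= (source_symbol w i).2 <= 2^-1).
Proof.
have /andP[a1 a2] := cA_lt (w %/ M2) i; have /andP[b1 b2] := fine_lt w i.
by rewrite /= !level_ge0// !level_le.
Qed.

Lemma source_symbol_power w i : cnorm2 (source_symbol w i) <= 1.
Proof. by have /andP[h1 h2] := source_range w i; exact: cnorm2_level_le. Qed.

Lemma relay_symbol_power w i : cnorm2 (relay_symbol w i) <= 1.
Proof.
have /andP[a1 a2] := cC_lt (w %% M2) (i - N1).
by rewrite cnorm2_rot; apply: cnorm2_level_le; rewrite /= level_ge0// level_le.
Qed.

Lemma superposition_relay_separation w w' : (w < M1 * M2)%N -> (w' < M1 * M2)%N ->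
  (count (fun i => ~~ near_point (2 * tau) (relay_mean ch source_symbol w i)
     (relay_mean ch source_symbol w' i)) (iota 0 N1) <= 2 * e)%N ->
  relay_symbol w =1 relay_symbol w'.
Proof.
move=> _ _ hcount.
suff E : (w %% M2 = w' %% M2)%N by move=> i; rewrite /relay_symbol /relay_level E.
apply/eqP; apply: contraT => ne.
have far := cB_dist (ltn_pmod w M20) (ltn_pmod w' M20) ne.
suff : (2 * e < 2 * e)%N by rewrite ltnn.
apply: (leq_trans far); apply: leq_trans hcount; apply: leq_count_in => i.
rewrite mem_iota add0n => /andP[_ iN1] hne.
have h (k1 k1' k2 k2' : nat) : (k2 < q2)%N -> (k2' < q2)%N -> k2 != k2' ->
    2 * tau < `|Num.sqrt C * level R q1 q2 k1 k2 - Num.sqrt C * level R q1 q2 k1' k2'|.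
  move=> h1 h2 k12; have q2gt : (1 < q2)%N.
    by rewrite ltnNge; apply: contra k12 => q21; move: h1 h2;
      rewrite (eqP (_ : q2 == 1%N)) ?eqn_leq ?q21//; case: k2 k2' => [|?] [|?].
  have hC := gain2 q2gt.
  have := level_fine R q10 q20 k1 k1' h1 h2 k12; set D := `|_| => hD.
  rewrite -mulrBr normrM ger0_norm ?sqrtr_ge0// -/D.
  have qq0 : 0 < 2 * (q1 * q2)%:R :> R by rewrite mulr_gt0// ltr0n muln_gt0 q10.
  have D0 : 0 < D by apply: lt_le_trans hD; rewrite invr_gt0.
  have h3 : 1 <= D * (2 * (q1 * q2)%:R) by rewrite -ler_pdivrMr// mul1r.
  apply: (@le_lt_trans _ _ (4 * tau * (q1 * q2)%:R * D)); last by rewrite ltr_pM2r.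
  have -> : 4 * tau * (q1 * q2)%:R * D = 2 * tau * (D * (2 * (q1 * q2)%:R)) by ring.
  by rewrite ler_peMr// mulr_ge0// ltW.
have /andP[a1 a2] := fine_lt w i; have /andP[b1 b2] := fine_lt w' i.
apply: far_point; rewrite /relay_mean /cscale /source_symbol /=.
have {}hne : fine_digit w i != fine_digit w' i by rewrite /fine_digit iN1.
by have [ne1|ne2] := pair_neq hne; [left|right]; exact: h.
Qed.

(** If the fine parts agree, the fine digits and the relay's symbols cancel in the difference, and
    the coarse code separates over all [N] slots. If they differ, the second phase suffices: by
    [gain3] the relay's spacing dominates any difference of coarse symbols. *)
Lemma superposition_dest_separation w w' : (w < M1 * M2)%N -> (w' < M1 * M2)%N ->
  w != w' ->
  (2 * e < count (fun i => ~~ near_point (2 * tau)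
     (dest_mean ch N1 source_symbol relay_symbol w i)
     (dest_mean ch N1 source_symbol relay_symbol w' i)) (iota 0 N))%N.
Proof.
move=> wM w'M ww'; have S0 := sqrtr_ge0 S; have I0 := sqrtr_ge0 I.
have tau2 : 0 < 2 * tau by rewrite mulr_gt0.
have [E|ne] := eqVneq (w %% M2)%N (w' %% M2)%N.
  have ne : (w %/ M2 != w' %/ M2)%N.
    by apply: contra ww' => /eqP h; rewrite (divn_eq w M2) (divn_eq w' M2) h E.
  have d1 : (w %/ M2 < M1)%N by rewrite ltn_divLR.
  have d2 : (w' %/ M2 < M1)%N by rewrite ltn_divLR.
  apply: (leq_trans (cA_dist d1 d2 ne)); apply: leq_count_in => i _ hne.
  have hf : fine_digit w' i = fine_digit w i by rewrite /fine_digit E.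
  have hr : relay_symbol w' i = relay_symbol w i.
    by rewrite /relay_symbol /relay_level E.
  have h (k1 k1' k2 : nat) : (k1 < q1)%N -> (k1' < q1)%N -> k1 != k1' ->
      2 * tau < `|Num.sqrt S * level R q1 q2 k1 k2 - Num.sqrt S * level R q1 q2 k1' k2|.
    move=> h1 h2 k12; have q1gt : (1 < q1)%N.
      by rewrite ltnNge; apply: contra k12 => q21; move: h1 h2;
        rewrite (eqP (_ : q1 == 1%N)) ?eqn_leq ?q21//; case: k1 k1' => [|?] [|?].
    have hS := gain1 q1gt.
    have := level_coarse R q10 q20 k2 k12; set D := `|_| => hD.
    rewrite -mulrBr normrM ger0_norm// -/D.
    have qq0 : 0 < 2 * q1%:R :> R by rewrite mulr_gt0// ltr0n.
    have D0 : 0 < D by apply: lt_le_trans hD; rewrite invr_gt0.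
    have h3 : 1 <= D * (2 * q1%:R) by rewrite -ler_pdivrMr// mul1r.
    apply: (@le_lt_trans _ _ (4 * tau * q1%:R * D)); last by rewrite ltr_pM2r.
    have -> : 4 * tau * q1%:R * D = 2 * tau * (D * (2 * q1%:R)) by ring.
    by rewrite ler_peMr// ltW.
  have /andP[a1 a2] := cA_lt (w %/ M2) i; have /andP[b1 b2] := cA_lt (w' %/ M2) i.
  apply: far_point; rewrite /dest_mean hr; case: ifP => _.
    rewrite /cscale /source_symbol hf /=.
    by have [ne1|ne2] := pair_neq hne; [left|right]; exact: h.
  have cancel (a b r : R) : a + r - (b + r) = a - b by ring.
  rewrite /cadd /cscale /source_symbol hf [fst (_, _)]/= [snd (_, _)]/= !cancel.
  by have [ne1|ne2] := pair_neq hne; [left|right]; exact: h.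
have := cC_dist (ltn_pmod w M20) (ltn_pmod w' M20) ne.
move=> /leq_trans; apply; rewrite /N iotaD count_cat add0n.
apply: leq_trans (leq_addl _ _).
have -> : iota N1 N2 = map (addn N1) (iota 0 N2) by rewrite -iotaDl addn0.
rewrite count_map; apply: leq_count_in => i _ /=.
have -> : (cC (w %% M2) i != cC (w' %% M2) i) =
    (cC (w %% M2) ((N1 + i)%N - N1)%N != cC (w' %% M2) ((N1 + i)%N - N1)%N).
  by rewrite addKn.
move: (N1 + i)%N (leq_addr i N1) => {}i iN1 hne.
have h (k k' : nat) (l l' : R) : 0 <= l <= 2^-1 -> 0 <= l' <= 2^-1 ->
    (k < q3)%N -> (k' < q3)%N -> k != k' ->
    2 * tau < `|(Num.sqrt S * l + Num.sqrt I * level R q3 1 k 0) -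
                (Num.sqrt S * l' + Num.sqrt I * level R q3 1 k' 0)|.
  move=> /andP[l0 l2] /andP[l'0 l'2] h1 h2 kk'; have q3gt : (1 < q3)%N.
    by rewrite ltnNge; apply: contra kk' => q31; move: h1 h2;
      rewrite (eqP (_ : q3 == 1%N)) ?eqn_leq ?q31//; case: k k' => [|?] [|?].
  have hI := gain3 q3gt.
  have := level_coarse R q30 (ltn0Sn 0) 0 kk'.
  set A := level R q3 1 k 0; set B := level R q3 1 k' 0; set D := `|_| => hD.
  have qq0 : 0 < q3%:R :> R by rewrite ltr0n.
  have -> : Num.sqrt S * l + Num.sqrt I * A - (Num.sqrt S * l' + Num.sqrt I * B) =
     Num.sqrt I * (A - B) - Num.sqrt S * (l' - l) by ring.
  apply: lt_le_trans (lerB_dist _ _).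
  rewrite !normrM !(ger0_norm S0) !(ger0_norm I0) -/D.
  have hl : `|l' - l| <= 2^-1 by rewrite ler_norml; apply/andP; split; lra.
  have hSl : Num.sqrt S * `|l' - l| <= Num.sqrt S * 2^-1 by rewrite ler_wpM2l.
  have hID : Num.sqrt I * (2 * q3%:R)^-1 <= Num.sqrt I * D by rewrite ler_wpM2l.
  have : (Num.sqrt S + 4 * tau) / 2 < Num.sqrt I * (2 * q3%:R)^-1.
    rewrite invfM [_ / 2]mulrC mulrCA ltr_pM2l ?invr_gt0//.
    by rewrite ltr_pdivlMr// mulrC.
  by lra.
have /andP[a1 a2] := cC_lt (w %% M2) (i - N1).
have /andP[b1 b2] := cC_lt (w' %% M2) (i - N1).
have /andP[s1 s2] := source_range w i; have /andP[s1' s2'] := source_range w' i.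
have iN1F : (i < N1)%N = false by rewrite ltnNge iN1.
apply: far_point; rewrite /dest_mean iN1F /relay_symbol !cmul_cexpjN.
rewrite /cadd /cscale /relay_level [fst (_, _)]/= [snd (_, _)]/=.
by have [ne1|ne2] := pair_neq hne; [left|right]; exact: h.
Qed.

End superposition_code.

Section rounding.
Context (R : realType).
Implicit Types y : R.

(** The lower bound 1 keeps alphabets and message sets nonempty. Rounding loses at most a factor 2,
    and the result can exceed [y] only when it is 1, the trivial case. *)
Definition round1 y : nat := maxn 1 (Num.truncn y).

Lemma round1_gt0 y : (0 < round1 y)%N. Proof. by rewrite leq_max. Qed.

Lemma round1_le y : 0 <= y -> (1 < round1 y)%N -> (round1 y)%:R <= y.
Proof.
move=> y0; rewrite /round1 leq_max ltnn /= => h.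
by rewrite (maxn_idPr (ltnW h)) truncn_le.
Qed.

Lemma round1_le_max y z : 0 <= y -> y <= z -> 1 <= z -> (round1 y)%:R <= z.
Proof.
move=> y0 yz z1; have [h|h] := ltnP 1 (round1 y).
  exact: le_trans (round1_le y0 h) yz.
by apply: le_trans z1; rewrite lern1.
Qed.

Lemma round1_ge y : 0 <= y -> y / 2 <= (round1 y)%:R.
Proof.
move=> y0; rewrite ler_pdivrMr//.
have h1 : 1 <= (round1 y)%:R :> R by rewrite ler1n round1_gt0.
have h2 : (Num.truncn y)%:R <= (round1 y)%:R :> R by rewrite ler_nat leq_maxr.
have := truncnS_gt y; rewrite -natr1; lra.
Qed.

Lemma round1_eq1 y : 0 <= y < 1 -> round1 y = 1%N.
Proof.
by move=> /andP[y0 y1]; apply/maxn_idPl; rewrite -ltnS truncn_lt_nat// (lt_trans y1) ?ltr1n.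
Qed.

End rounding.

Section rates.
Context (R : realType).

Lemma round1_spread_code (q n e : nat) (m : R) : (0 < q)%N ->
  m <= (n%:R - (2 * e)%:R) * ln (q * q)%:R - n%:R * ln 2 ->
  let M := round1 (expR m) in
  ((1 < M)%N -> (M * (2 ^ n * (q * q) ^ (2 * e)) <= (q * q) ^ n)%N).
Proof.
move=> q0 hm M M1.
have Q0 : 0 < (q * q)%:R :> R by rewrite ltr0n muln_gt0 q0.
have MR := round1_le (expR_ge0 m) M1.
rewrite -(ler_nat R) natrM natrM !natrX.
rewrite -{1 2}[(q * q)%:R]lnK ?posrE// -[2 in X in _ * (X * _)](@lnK R) ?posrE//.
rewrite -!expRM_natl -expRD.
apply: (le_trans (ler_wpM2r (expR_ge0 _) MR)).
rewrite -expRD ler_expR; move: hm; set A := ln _; lra.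
Qed.

End rates.

Section achievability.
Context (R : realType).

(** The fine stream is encoded twice, by the source over [N1] slots and by the relay over [N2], so
    its log-size [m2] meets two constraints. The division by 4 pays for rounding the two numbers of
    messages. *)
Lemma exists_superposition_code (C S I th tau delta m1 m2 : R)
    (N1 N2 e q1 q2 q3 : nat) (N := (N1 + N2)%N) (ch := HDChan C S I th) :
  0 < tau -> (0 < q1)%N -> (0 < q2)%N -> (0 < q3)%N ->
  ((1 < q1)%N -> 4 * tau * q1%:R < Num.sqrt S) ->
  ((1 < q2)%N -> 4 * tau * (q1 * q2)%:R < Num.sqrt C) ->
  ((1 < q3)%N -> q3%:R * (Num.sqrt S + 4 * tau) < Num.sqrt I) ->
  (0 < N)%N -> delta * N%:R <= e.+1%:R -> ln 8 <= tau ^+ 2 * delta / 2 ->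
  m1 <= (N%:R - (2 * e)%:R) * ln (q1 * q1)%:R - N%:R * ln 2 ->
  m2 <= (N1%:R - (2 * e)%:R) * ln (q2 * q2)%:R - N1%:R * ln 2 ->
  m2 <= (N2%:R - (2 * e)%:R) * ln (q3 * q3)%:R - N2%:R * ln 2 ->
  exists c : hd_code R, [/\ valid_code ch N c, expR (m1 + m2) / 4 <= (msgs c)%:R &
    (err_prob ch N c <= ((2 ^+ N)^-1)%:E)%E].
Proof.
move=> tau0 q10 q20 q30 g1 g2 g3 N0 hdelta htau hm1 hm2 hm3.
have [cA [cA_lt cA_dist]] := exists_spread_code q10 (round1_spread_code q10 hm1).
have [cB [cB_lt cB_dist]] := exists_spread_code q20 (round1_spread_code q20 hm2).
have [cC [cC_lt cC_dist]] := exists_spread_code q30 (round1_spread_code q30 hm3).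
set M1 := round1 (expR m1) in cA_dist; set M2 := round1 (expR m2) in cB_dist cC_dist.
have M10 : (0 < M1)%N := round1_gt0 _.
have M20 : (0 < M2)%N := round1_gt0 _.
pose xs := source_symbol R N1 q1 q2 M2 cA cB.
pose xr := relay_symbol th N1 q3 M2 cC.
have MM0 : (0 < M1 * M2)%N by rewrite muln_gt0 M10.
have N1N : (N1 <= N)%N by exact: leq_addr.
have sepR := @superposition_relay_separation R C S I th tau N1 e q1 q2 q3 M1 M2
  tau0 q10 q20 M20 g2 cA cB cC cB_lt cB_dist.
have sepD := @superposition_dest_separation R C S I th tau N1 N2 e q1 q2 q3 M1 M2
  tau0 q10 q20 q30 M20 g1 g3 cA cB cC cA_lt cB_lt cC_lt cA_dist cC_dist.
have powS := @source_symbol_power R N1 q1 q2 M2 q10 q20 cA cB cA_lt cB_lt.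
have powR := @relay_symbol_power R th N1 q3 M2 q30 cC cC_lt.
exists (two_phase_code ch N1 N (M1 * M2) e tau xs xr); split.
- exact: two_phase_valid.
- have h1 := round1_ge (expR_ge0 m1); have h2 := round1_ge (expR_ge0 m2).
  rewrite [msgs _]/= natrM expRD.
  have -> : expR m1 * expR m2 / 4 = (expR m1 / 2) * (expR m2 / 2) by field.
  by apply: ler_pM; rewrite // divr_ge0 ?expR_ge0.
- exact: (two_phase_err tau0 N1N sepR sepD MM0 hdelta htau).
Qed.

Section power_scaling.
Variables (snr : R).
Hypothesis snr1 : 1 <= snr.
Let L := ln snr.
Let L0 : 0 <= L. Proof. exact: ln_ge0. Qed.

Lemma sqrt_powR b : Num.sqrt (snr `^ b) = expR (L * b / 2).
Proof.
rewrite powR_snr// -/L.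
have -> : expR (L * b) = expR (L * b / 2) ^+ 2 by rewrite -expRM_natl; congr expR; field.
by rewrite sqrtr_sqr ger0_norm// expR_ge0.
Qed.

Variable tau : R.
Hypothesis tau1 : 1 < tau.

(* Separation needs an amplitude gain of [4 * tau] per level; the extra [tau] leaves
   room for the coarse stream in [pam_gain3]. *)
Definition pam_size b : nat := round1 (expR (L * b / 2) / (5 * tau)).

Let t5 : 0 < 5 * tau. Proof. by rewrite mulr_gt0// (lt_trans ltr01). Qed.

Let y0 b : 0 <= expR (L * b / 2) / (5 * tau).
Proof. by rewrite divr_ge0 ?expR_ge0// ltW. Qed.

Lemma pam_size_gt0 b : (0 < pam_size b)%N. Proof. exact: round1_gt0. Qed.

Lemma pam_size_le b : 0 <= b -> (pam_size b)%:R <= expR (L * b / 2).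
Proof.
move=> b0; apply: round1_le_max => //.
  by rewrite ler_pdivrMr// ler_peMr ?expR_ge0//; move: tau1; lra.
by rewrite -[leLHS]expR0 ler_expR divr_ge0// mulr_ge0.
Qed.

Lemma pam_size_big b : (1 < pam_size b)%N ->
  (pam_size b)%:R * (5 * tau) <= expR (L * b / 2).
Proof. by move=> h; rewrite -ler_pdivlMr//; exact: round1_le h. Qed.

(** A zero exponent switches a stream off, and its gain condition with it. *)
Lemma pam_size0 : pam_size 0 = 1%N.
Proof.
apply: round1_eq1; rewrite y0 /= mulr0 mul0r expR0 ltr_pdivrMr// mul1r.
by move: tau1; lra.
Qed.

Lemma ln_pam_size_le b : 0 <= b -> ln (pam_size b * pam_size b)%:R <= L * b.
Proof.
move=> b0; rewrite -ler_expR lnK ?posrE ?ltr0n ?muln_gt0 ?pam_size_gt0//.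
have -> : expR (L * b) = expR (L * b / 2) * expR (L * b / 2).
  by rewrite -expRD; congr expR; field.
by rewrite natrM; apply: ler_pM => //; exact: pam_size_le.
Qed.

(** The constant [10 * tau] is [5 * tau] times the factor 2 lost by rounding. *)
Lemma ln_pam_size_ge b :
  L * b - 2 * ln (10 * tau) <= ln (pam_size b * pam_size b)%:R.
Proof.
have t10 : 0 < 10 * tau by rewrite mulr_gt0// (lt_trans ltr01).
rewrite -ler_expR lnK ?posrE ?ltr0n ?muln_gt0 ?pam_size_gt0//.
have -> : expR (L * b - 2 * ln (10 * tau)) =
    (expR (L * b / 2) / (5 * tau) / 2) * (expR (L * b / 2) / (5 * tau) / 2).
  rewrite expRD expRN -[2]/(2%:R) expRM_natl lnK ?posrE//.
  have -> : expR (L * b) = expR (L * b / 2) * expR (L * b / 2).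
    by rewrite -expRD; congr expR; field.
  by field; rewrite gt_eqF// (lt_trans ltr01).
have h := round1_ge (y0 b).
by rewrite natrM; apply: ler_pM => //; rewrite divr_ge0.
Qed.

Lemma ln_pam_size_ge0 b : 0 <= ln (pam_size b * pam_size b)%:R :> R.
Proof. by rewrite ln_ge0// ler1n muln_gt0 !pam_size_gt0. Qed.

Lemma pam_gain1 b : (1 < pam_size b)%N ->
  4 * tau * (pam_size b)%:R < Num.sqrt (snr `^ b).
Proof.
move=> h; rewrite sqrt_powR; apply: lt_le_trans (pam_size_big h).
have q0 : 0 < (pam_size b)%:R :> R by rewrite ltr0n pam_size_gt0.
by rewrite mulrC ltr_pM2l//; move: tau1; lra.
Qed.

Lemma pam_gain2 b b2 b' : 0 <= b -> b + b2 <= b' -> (1 < pam_size b2)%N ->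
  4 * tau * (pam_size b * pam_size b2)%:R < Num.sqrt (snr `^ b').
Proof.
move=> b0 bb' h; rewrite sqrt_powR natrM.
apply: (@lt_le_trans _ _ (expR (L * b / 2) * expR (L * b2 / 2))); last first.
  rewrite -expRD ler_expR -mulrDl ler_pM2r// -mulrDr.
  exact: ler_wpM2l.
have h1 := pam_size_le b0; have h2 := pam_size_big h.
have q0 : 0 < (pam_size b2)%:R :> R by rewrite ltr0n pam_size_gt0.
have e0 : 0 < expR (L * b / 2) by exact: expR_gt0.
apply: (@le_lt_trans _ _ (expR (L * b / 2) * ((pam_size b2)%:R * (4 * tau)))).
  rewrite [leLHS](_ : _ = (pam_size b)%:R * ((pam_size b2)%:R * (4 * tau))); last by ring.
  by rewrite ler_wpM2r// mulr_ge0 ?ltW// mulr_gt0// (lt_trans ltr01).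
rewrite ltr_pM2l//; apply: lt_le_trans h2.
by rewrite ltr_pM2l//; move: tau1; lra.
Qed.

Lemma pam_gain3 b b3 b' : 0 <= b -> b + b3 <= b' -> (1 < pam_size b3)%N ->
  (pam_size b3)%:R * (Num.sqrt (snr `^ b) + 4 * tau) < Num.sqrt (snr `^ b').
Proof.
move=> b0 bb' h; rewrite !sqrt_powR.
apply: (@lt_le_trans _ _ (expR (L * b / 2) * expR (L * b3 / 2))); last first.
  rewrite -expRD ler_expR -mulrDl ler_pM2r// -mulrDr.
  exact: ler_wpM2l.
have h2 := pam_size_big h.
have q0 : 0 < (pam_size b3)%:R :> R by rewrite ltr0n pam_size_gt0.
have e1 : 1 <= expR (L * b / 2).
  by rewrite -[leLHS]expR0 ler_expR divr_ge0// mulr_ge0.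
apply: (@lt_le_trans _ _ (expR (L * b / 2) * ((pam_size b3)%:R * (5 * tau)))); last first.
  by rewrite ler_wpM2l// expR_ge0.
(* With [x >= 1] and [tau > 1], the amplitude [x + 4 * tau] is below [5 * tau * x]. *)
rewrite mulrCA ltr_pM2l//; move: (expR _) e1 tau1 => x x1 t1; nra.
Qed.

End power_scaling.

End achievability.

(** * Choice of the parameters *)

Section achievable_rate.
Context (R : realType).
Variables (snr bsd brd bsr th : R).
Hypotheses (snr1 : 1 <= snr) (bsd0 : 0 <= bsd).
Let ch := HDChan (snr `^ bsr) (snr `^ bsd) (snr `^ brd) th.
Let L := ln snr.
Let L0 : 0 <= L. Proof. exact: ln_ge0. Qed.

(** Here [g] is the fraction of slots in which the relay listens. The fine stream has exponent [b2]
    on the way to the relay and [b3] from it, and conveys [rho] per slot of the whole block. Zero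
    exponents are free of conditions, which covers channels where the relay does not help. *)
Variables (delta g b2 b3 rho : R).
Hypotheses (delta0 : 0 < delta) (g01 : 0 <= g <= 1) (b20 : 0 <= b2) (b30 : 0 <= b3).
Hypotheses (hb2 : 0 < b2 -> bsd + b2 <= bsr) (hb3 : 0 < b3 -> bsd + b3 <= brd).
Hypotheses (rho2 : rho <= g * b2) (rho3 : rho <= (1 - g) * b3).

(** Large enough for the Chernoff bound, since [tau >= 1] and [tau * delta >= 2 * ln 8], and
    independent of the SNR. *)
Definition noise_threshold : R := 1 + 2 * ln 8 / delta.
Let tau := noise_threshold.

Let ln80 : 0 < ln 8 :> R. Proof. by rewrite ln_gt0// ltr1n. Qed.

Let tau1 : 1 < tau.
Proof. by rewrite /tau /noise_threshold ltrDl divr_gt0// mulr_gt0. Qed.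

Let htau : ln 8 <= tau ^+ 2 * delta / 2.
Proof.
have h : 2 * ln 8 / delta * delta = 2 * ln 8 by rewrite divfK// gt_eqF.
have td : 2 * ln 8 <= tau * delta.
  by rewrite /tau /noise_threshold (mulrDl 1 (_ / _)) h mul1r lerDr ltW.
rewrite ler_pdivlMr// mulrC; apply: (le_trans td).
by rewrite ler_pM2r// expr2 ler_peMl// ltW// (lt_trans ltr01).
Qed.

(** Each of the two streams loses [2 * ln (10 * tau)] to the alphabet size and [ln 2] to the
    Gilbert-Varshamov count; [ln 4] is the rounding of the numbers of messages. *)
Definition rate_loss : R := 4 * ln (10 * tau) + 2 * ln 2 + ln 4.

Lemma achievable_ge : achievable ch
  ((L * (bsd + rho) - 3 * delta * L * (bsd + b2 + b3) - rate_loss) / ln 2).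
Proof.
move=> eps eps0 K0.
(* The three terms ensure [K0 <= N], [1 <= delta * N] and [2 ^- N <= eps]. *)
pose N := (maxn K0 (maxn (Num.truncn delta^-1) (Num.truncn eps^-1))).+1.
have N0 : (0 < N)%N by [].
have NR0 : 0 < N%:R :> R by rewrite ltr0n.
have Nd : 1 <= delta * N%:R.
  rewrite mulrC -ler_pdivrMr// mul1r; apply: ltW.
  apply: lt_le_trans (truncnS_gt _) _.
  by rewrite ler_nat ltnS leq_max leq_max leqnn orbT.
have Ne : (2 ^+ N)^-1 <= eps.
  rewrite -[eps]invrK lef_pV2 ?posrE ?exprn_gt0 ?invr_gt0//.
  apply: ltW; apply: lt_le_trans (truncnS_gt _) _.
  rewrite -natrX ler_nat; apply: (@leq_trans N); last exact: ltnW (ltn_expl _ _).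
  by rewrite ltnS !leq_max leqnn !orbT.
have /andP[g0 g1] := g01.
have gN0 : 0 <= g * N%:R by rewrite mulr_ge0// ltW.
pose N1 := Num.truncn (g * N%:R).
have N1le : N1%:R <= g * N%:R by rewrite truncn_le.
have N1ge : g * N%:R - 1 <= N1%:R.
  by have := truncnS_gt (g * N%:R); rewrite -natr1 -/N1; lra.
have N1N : (N1 <= N)%N.
  by rewrite -(ler_nat R); apply: (le_trans N1le); rewrite ler_piMl// ltW.
pose N2 := (N - N1)%N.
have NE : (N1 + N2)%N = N by rewrite subnKC.
have N2E : N2%:R = N%:R - N1%:R :> R by rewrite natrB.
pose e := Num.truncn (delta * N%:R).
have dN0 : 0 <= delta * N%:R by rewrite mulr_ge0// ltW.
have ele : e%:R <= delta * N%:R by rewrite truncn_le.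
have ege : delta * N%:R <= e.+1%:R by apply: ltW; exact: truncnS_gt.
pose q := pam_size snr tau.
pose A b := ln (q b * q b)%:R : R.
pose k := 2 * ln (10 * tau).
have k0 : 0 <= k.
  by rewrite mulr_ge0// ln_ge0//; move: tau1; lra.
have A0 b : 0 <= A b by exact: ln_pam_size_ge0.
have Ale b : 0 <= b -> A b <= L * b by exact: ln_pam_size_le.
have Age b : L * b - k <= A b by exact: ln_pam_size_ge.
have l2 : 0 < ln 2 :> R by rewrite ln_gt0// ltr1n.
have q1big b : (1 < q b)%N -> 0 <= b -> 0 < b.
  move=> h; rewrite le_eqVlt => /predU1P[bE|//].
  by move: h; rewrite /q -bE pam_size0.
pose m1 := N%:R * (L * bsd - k - ln 2 - 2 * delta * (L * bsd)).
(* The distance [2 * e] costs [2 * delta]; the third [delta] absorbs the slot lost in truncating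
   [g * N], because [1 <= delta * N]. *)
pose m2 := N%:R * (L * rho - k - ln 2 - 3 * delta * (L * (b2 + b3))).
have hm1 : m1 <= (N%:R - (2 * e)%:R) * A bsd - N%:R * ln 2.
  rewrite natrM; have h1 := Age bsd; have h2 := Ale bsd bsd0.
  have h3 : N%:R * (L * bsd - k) <= N%:R * A bsd by rewrite ler_pM2l.
  have h4 : e%:R * A bsd <= delta * N%:R * (L * bsd) by apply: ler_pM.
  by rewrite /m1; lra.
(* Serves both phases, with [b] and [b'] exchanged: [c] is the fraction of the block that the phase
   occupies. *)
have hm (n : nat) c b b' : 0 <= b -> 0 <= b' -> 0 <= c <= 1 -> rho <= c * b -> (n <= N)%N ->
    c * N%:R - 1 <= n%:R ->
    N%:R * (L * rho - k - ln 2 - 3 * delta * (L * (b + b'))) <=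
    (n%:R - (2 * e)%:R) * A b - n%:R * ln 2.
  move=> hb hb' /andP[c0 c1] hrho nN hn; rewrite natrM.
  have h1 := Age b; have h2 := Ale b hb; have h0 := A0 b.
  have h3 : c * N%:R * (L * b - k) <= c * N%:R * A b.
    by apply: ler_wpM2l; rewrite // mulr_ge0// ltW.
  have h4 : (2 * e%:R + 1) * A b <= (3 * (delta * N%:R)) * (L * b).
    have e0 : 0 <= e%:R :> R by [].
    by apply: ler_pM => //; lra.
  have h5 : (c * N%:R - 1) * A b <= n%:R * A b by apply: ler_wpM2r.
  have h6 : n%:R * ln 2 <= N%:R * ln 2 :> R by rewrite ler_pM2r// ler_nat.
  have h7 : N%:R * (L * rho) <= N%:R * (L * (c * b)) by rewrite ler_pM2l//; apply: ler_wpM2l.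
  have h8 : c * N%:R * k <= N%:R * k by apply: ler_wpM2r => //; rewrite ler_piMl// ltW.
  have h9 : 0 <= delta * N%:R * (L * b').
    by apply: mulr_ge0 => //; exact: mulr_ge0.
  by lra.
have hm2 : m2 <= (N1%:R - (2 * e)%:R) * A b2 - N1%:R * ln 2.
  by apply: (hm N1 g).
have hm3 : m2 <= (N2%:R - (2 * e)%:R) * A b3 - N2%:R * ln 2.
  rewrite /m2 [b2 + b3]addrC; apply: (hm N2 (1 - g)) => //.
  - by apply/andP; split; lra.
  - exact: leq_subr.
  - by rewrite N2E; lra.
have tau0 : 0 < tau by exact: lt_trans ltr01 tau1.
have q0 b : (0 < q b)%N by exact: pam_size_gt0.
have g1' : (1 < q bsd)%N -> 4 * tau * (q bsd)%:R < Num.sqrt (snr `^ bsd).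
  exact: pam_gain1.
have g2' : (1 < q b2)%N -> 4 * tau * (q bsd * q b2)%:R < Num.sqrt (snr `^ bsr).
  by move=> h; apply: pam_gain2 => //; apply: hb2; exact: q1big h b20.
have g3' : (1 < q b3)%N ->
    (q b3)%:R * (Num.sqrt (snr `^ bsd) + 4 * tau) < Num.sqrt (snr `^ brd).
  by move=> h; apply: pam_gain3 => //; apply: hb3; exact: q1big h b30.
have := @exists_superposition_code R (snr `^ bsr) (snr `^ bsd) (snr `^ brd) th tau delta m1 m2
  N1 N2 e (q bsd) (q b2) (q b3) tau0 (q0 _) (q0 _) (q0 _) g1' g2' g3'.
rewrite NE => /(_ N0 ege htau hm1 hm2 hm3) [c [vc hM herr]].
exists N, c; split => //.
- by rewrite /N leqW// leq_maxl.
- apply: le_trans hM; rewrite /powR pnatr_eq0/=.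
  rewrite -[4](@lnK R) ?posrE// -expRN -expRD ler_expR -mulrA divfK ?gt_eqF//.
  have l4 : ln 4 <= N%:R * ln 4 :> R.
    by rewrite ler_peMl ?ln_ge0 ?ler1n.
  have dL : 0 <= N%:R * (delta * (L * bsd)).
    by rewrite !mulr_ge0// ltW.
  by rewrite /m1 /m2 /rate_loss -/k; rewrite /k; lra.
- by apply: (le_trans herr); rewrite lee_fin.
Qed.

End achievable_rate.

(** * The limit *)

Section capacity_bounds.
Context (R : realType).
Variables (bsd brd bsr th : R).
Hypothesis (bsd0 : 0 <= bsd).
Let d := gdof_formula bsd brd bsr.
Let ch (snr : R) := HDChan (snr `^ bsr) (snr `^ bsd) (snr `^ brd) th.

Lemma gdof_formula_ge0 : 0 <= gdof_formula bsd brd bsr.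
Proof.
rewrite /gdof_formula; case: ifP => // /andP[h1 h2].
have a0 : 0 <= brd - bsd by rewrite subr_ge0 ltW.
have b0 : 0 <= bsr - bsd by rewrite subr_ge0 ltW.
by rewrite addr_ge0// divr_ge0// ?mulr_ge0// addr_ge0.
Qed.

(** The choice [g = a / (a + b)] equalizes [g * b] and [(1 - g) * a], and their common value is the
    second term of the formula. That [B] depends on neither [snr] nor [delta] permits taking [delta]
    small first and [snr] large afterwards. *)
Lemma achievable_gdof : exists2 B : R, 0 <= B & forall snr delta : R, 1 <= snr -> 0 < delta ->
  achievable (ch snr) ((ln snr * d - 3 * delta * ln snr * B - rate_loss delta) / ln 2).
Proof.
rewrite /d /gdof_formula; case: ifP => [/andP[h1 h2]|_]; last first.
  exists (bsd + 0 + 0) => [|snr delta snr1 delta0]; first by rewrite !addr0.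
  rewrite -[X in _ * X - _]addr0; apply: (achievable_ge th snr1 bsd0 delta0 (g := 0)).
  all: rewrite ?mulr0 ?ltxx ?lexx ?ler01 //.
set a := brd - bsd; set b := bsr - bsd.
have a0 : 0 < a by rewrite subr_gt0.
have b0 : 0 < b by rewrite subr_gt0.
have ab0 : 0 < a + b by rewrite addr_gt0.
exists (bsd + b + a) => [|snr delta snr1 delta0];
  first by apply: addr_ge0 (ltW a0); apply: addr_ge0 (ltW b0).
apply: (achievable_ge th snr1 bsd0 delta0 (g := a / (a + b))).
- by rewrite divr_ge0 ?(ltW a0) ?(ltW ab0)//= ler_pdivrMr// mul1r lerDl ltW.
- exact: ltW.
- exact: ltW.
- by move=> _; rewrite /b addrC subrK.
- by move=> _; rewrite /a addrC subrK.
- by rewrite mulrAC.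
- rewrite (_ : 1 - a / (a + b) = b / (a + b)); last by field; rewrite gt_eqF.
  by rewrite (_ : b / (a + b) * a = a * b / (a + b)) // mulrAC (mulrC b).
Qed.

Lemma capacity_le snr : 1 <= snr ->
  hd_capacity (ch snr) * ln 2 <= ln 4 + 8 + ln 6 + ln snr * d.
Proof.
move=> snr1; have l2 : 0 < ln 2 :> R by rewrite ln_gt0// ltr1n.
rewrite -ler_pdivlMr//; apply: ge_sup.
  (* A supremum is controlled by an upper bound only when the set is nonempty, so achievability
     enters here. *)
  by have [B _ hB] := achievable_gdof; exact: (ex_intro _ _ (hB _ _ snr1 ltr01)).
by move=> r /= hr; rewrite ler_pdivlMr//; exact: achievable_le hr.
Qed.

(** A supremum dominates the elements of a set only when the set is bounded above, so the converse
    enters here. *)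
Lemma capacity_ge snr r : 1 <= snr -> achievable (ch snr) r -> r <= hd_capacity (ch snr).
Proof.
move=> snr1 hr; have l2 : 0 < ln 2 :> R by rewrite ln_gt0// ltr1n.
apply: ub_le_sup => //; exists ((ln 4 + 8 + ln 6 + ln snr * d) / ln 2) => x /= hx.
by rewrite ler_pdivlMr//; exact: achievable_le hx.
Qed.

Lemma capacity_ratio_cvg :
  (fun snr : R => hd_capacity (ch snr) / log2 (1 + snr)) @ +oo --> d.
Proof.
have [B B0 hB] := achievable_gdof.
have d0 : 0 <= d := gdof_formula_ge0.
have l2 : 0 < ln 2 :> R by rewrite ln_gt0// ltr1n.
have l4 : 0 < ln 4 :> R by rewrite ln_gt0// ltr1n.
have l6 : 0 < ln 6 :> R by rewrite ln_gt0// ltr1n.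
apply/cvgrPdist_le => eps eps0.
(* Half of [eps] is reserved for the loss proportional to [ln snr]. *)
pose delta := eps / (6 * (B + 1)).
have B1 : 0 < 6 * (B + 1) by rewrite mulr_gt0// ltr_wpDl.
have delta0 : 0 < delta by rewrite divr_gt0.
have deltaB : 3 * delta * B <= eps / 2.
  have -> : eps = delta * (6 * (B + 1)) by rewrite /delta divfK// gt_eqF.
  by lra.
(* The other half of [eps] covers the terms independent of the SNR once [ln (1 + snr) >= T]; among
   them [d * ln 2] comes from comparing [ln snr] with [ln (1 + snr)]. *)
pose T := 2 * (ln 4 + 8 + ln 6 + d * ln 2 + `|rate_loss delta|) / eps.
near=> snr.
have snr1 : 1 <= snr by near: snr; exact: nbhs_pinfty_ge.
have snrT : expR T <= snr by near: snr; exact: nbhs_pinfty_ge.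
have snr0 : 0 < snr by exact: lt_le_trans ltr01 snr1.
set l := ln (1 + snr).
have lT : T <= l.
  rewrite -(expRK T) ler_ln ?posrE ?expR_gt0 ?addr_gt0//.
  by apply: (le_trans snrT); rewrite lerDr.
have l0 : 0 < l by rewrite ln_gt0// ltrDl.
have Ll : ln snr <= l by rewrite ler_ln ?posrE ?addr_gt0// lerDr.
have lL : l <= ln snr + ln 2.
  by rewrite -lnM ?posrE// ler_ln ?posrE ?addr_gt0 ?mulr_gt0//; lra.
have up := capacity_le snr1.
have lo := capacity_ge snr1 (hB snr delta snr1 delta0).
rewrite ler_pdivrMr// in lo.
rewrite /log2 -/l invf_div mulrA.
set c := hd_capacity _ * _ in up lo *.
have hT : 2 * (ln 4 + 8 + ln 6 + d * ln 2 + `|rate_loss delta|) <= l * eps.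
  by rewrite -ler_pdivrMr.
have hK : rate_loss delta <= `|rate_loss delta| := ler_norm _.
have K0 : 0 <= `|rate_loss delta| := normr_ge0 _.
have dl2 : 0 <= d * ln 2 by rewrite mulr_ge0// ltW.
have e1 : ln snr * d <= l * d by apply: ler_wpM2r.
have e2 : (l - ln 2) * d <= ln snr * d by apply: ler_wpM2r => //; lra.
have e3 : ln snr * (3 * delta * B) <= l * (eps / 2).
  apply: ler_pM => //; first exact: ln_ge0.
  by apply: mulr_ge0 B0; apply: mulr_ge0 (ltW delta0).
have le0 : 0 <= l * eps by rewrite mulr_ge0// ltW.
rewrite ler_distlC; apply/andP; split.
  by rewrite ler_pdivlMr//; lra.
by rewrite ler_pdivrMr//; lra.
Unshelve. all: by end_near.
Qed.

End capacity_bounds.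

Theorem theorem1 (R : realType) (bsd brd bsr theta : R)
  (hsd : 0 <= bsd) (hrd : 0 <= brd) (hsr : 0 <= bsr) :
  (fun snr : R =>
     hd_capacity (HDChan (snr `^ bsr) (snr `^ bsd) (snr `^ brd) theta)
       / log2 (1 + snr))
    @ +oo --> gdof_formula bsd brd bsr.
Proof. exact: capacity_ratio_cvg. Qed.
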